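(* Let $f\in L^2(\nu_\rho)$ have the expansion $f=\sum_{n\ge0}\sum_{\xi\in\Omega_f:\|\xi\|=n}C_{n,\xi}D(\xi,\cdot)$ and suppose that $$\sum_{\xi,\xi'\in\Omega_f:\ \|\xi\|=\|\xi'\|=n,\ n\ge 0}|C_{n,\xi}\,C_{n,\xi'}|\,a(\xi')<\infty .$$ Let $k\ge1$, let $f_{k-1}$ denote the orthogonal projection of $f$ on $\mathcal H_{k-1}$, and let $\phi\in\mathcal S(\mathbb R^d)$. Then the field $$\mathsf X_N(f-f_{k-1},\eta;\phi)=\sum_{x\in\mathbb Z^d}\left(\tau_xf(\eta)-\tau_xf_{k-1}(\eta)\right)\phi\left(\tfrac xN\right)$$ of the system of independent random walkers satisfies, for every $t>0$, as $N\to\infty$, $$\mathbb E_{\nu_\rho}\left[\mathsf X_N(f-f_{k-1},\eta(0);\phi)\,\mathsf X_N(f-f_{k-1},\eta(N^2t);\phi)\right]=O\left(N^{-d(k-2)}\right).$$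
   Context: Fix $d\ge1$; $\mathbb N=\{0,1,2,\dots\}$; $\mathcal S(\mathbb R^d)$ is the space of (real) Schwartz functions. Let $p(i,j)$, $i,j\in\mathbb Z^d$, be a Markov transition function with $p(i,j)=p(j,i)=p(0,j-i)$, $\sum_jp(i,j)=1$, of finite range ($p(i,j)=0$ for $|i-j|>R$, some $R>0$), and irreducible. Independent random walkers: the Markov process $\{\eta(t):t\ge0\}$ on $\Omega=\mathbb N^{\mathbb Z^d}$ with generator $\mathcal Lf(\eta)=\sum_{i,j}p(i,j)\eta_i(f(\eta^{ij})-f(\eta))$ on local functions, where $\eta^{ij}$ is $\eta$ with one particle moved from $i$ to $j$; thus each particle independently performs a rate-1 continuous-time random walk with jump kernel $p$. The process is started from configurations for which it is well defined (a set of full $\nu_\rho$-measure). For $\rho>0$, $\nu_\rho$ is the homogeneous product measure on $\Omega$ with Poisson($\rho$) marginals, which is reversible; $\mathbb E_{\nu_\rho}$ is expectation for the process with $\eta(0)\sim\nu_\rho$. Shifts: $(\tau_x\eta)_y=\eta_{y+x}$ and $\tau_xf(\eta)=f(\tau_x\eta)$. $\Omega_f$ is the set of configurations with finitely many particles, $\|\xi\|=\sum_x\xi_x$. The orthogonal self-duality function is $D(\xi,\eta)=\prod_xd(\xi_x,\eta_x)$, $\xi\in\Omega_f$, with the Charlier polynomials $d(k,n)=\sum_{j=0}^k\binom kj(-\rho)^{-j}\frac{n!}{(n-j)!}$ (with $\frac{n!}{(n-j)!}=0$ for $j>n$). They satisfy $\int D(\xi,\eta)D(\xi',\eta)\,d\nu_\rho(\eta)=\delta_{\xi,\xi'}a(\xi)$,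 $a(\xi)=\|D(\xi,\cdot)\|^2_{L^2(\nu_\rho)}$. $\mathcal H_n$ is the closed subspace of $L^2(\nu_\rho)$ generated by $\{D(\xi,\cdot):\|\xi\|\le n\}$; the union of the $\mathcal H_n$ is dense in $L^2(\nu_\rho)$, so every $f\in L^2(\nu_\rho)$ has the (orthogonal, $L^2$-convergent) expansion with $C_{n,\xi}=\langle f,D(\xi,\cdot)\rangle/a(\xi)$, and $f_n=\sum_{\|\xi\|\le n}\langle f,D(\xi,\cdot)\rangle D(\xi,\cdot)/a(\xi)$. *)

(* Defs.v *)
(* MathComp-Analysis *)
From HB Require Import structures.
From mathcomp Require Import all_boot all_order all_algebra finmap.
From mathcomp Require Import all_classical all_reals all_analysis.
Import Order.TTheory GRing.Theory Num.Theory.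
Import numFieldNormedType.Exports.

Set Implicit Arguments.
Unset Strict Implicit.
Unset Printing Implicit Defensive.

Local Open Scope classical_set_scope.
Local Open Scope ring_scope.

Notation Zd d := 'rV[int]_d.

(* Absolutely convergent series over an arbitrary index type; in the absence of
   absolute convergence the value is meaningless. *)
Definition asum (R : realType) (I : choiceType) (g : I -> R) : R :=
  fine (esum [set: I] (EFin \o g)^\+ - esum [set: I] (EFin \o g)^\-)%E.

(** Jump kernel and the rate-1 random walk *)

Definition euclid_norm (R : realType) (d : nat) (x : Zd d) : R :=
  Num.sqrt (\sum_(l < d) (x ord0 l)%:~R ^+ 2).

Fixpoint nstep (R : realType) (d : nat) (p : Zd d -> Zd d -> R) (n : nat)
    (i j : Zd d) : R :=
  if n is n'.+1 then asum (fun l => p i l * nstep p n' l j) else (i == j)%:R.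

Record jump_kernel (R : realType) (d : nat) (p : Zd d -> Zd d -> R) : Prop := {
  jump_ge0 : forall i j, 0 <= p i j;
  jump_sym : forall i j, p i j = p j i;
  jump_shift : forall i j, p i j = p 0 (j - i);
  jump_sum1 : forall i, (\esum_(j in [set: Zd d]) (p i j)%:E)%E = 1%E;
  jump_range : exists2 r : R, 0 < r &
    forall i j, r < euclid_norm R (i - j) -> p i j = 0;
  jump_irreducible : forall i j, exists n, 0 < nstep p n i j
}.

(* The kernel of exp (t (p - Id)). *)
Definition transition (R : realType) (d : nat) (p : Zd d -> Zd d -> R)
    (t : R) (i j : Zd d) : R :=
  limn (series (fun n => expR (- t) * t ^+ n / n`!%:R * nstep p n i j)).

(* Probability that the walk sitting at i at time s is at x_1, ..., x_m at the
   successive times t_1 <= ... <= t_m, for h = [:: (t_1, x_1); ...]. *)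
Fixpoint path_prob (R : realType) (d : nat) (p : Zd d -> Zd d -> R)
    (s : R) (i : Zd d) (h : seq (R * Zd d)) : R :=
  if h is (t, x) :: h' then transition p (t - s) i x * path_prob p t x h'
  else 1.

Record random_walk (R : realType) (d : nat) (p : Zd d -> Zd d -> R)
    (disp : measure_display) (T : measurableType disp) (P : probability T R)
    (i : Zd d) (X : R -> T -> Zd d) : Prop := {
  walk_measurable : forall t x, 0 <= t -> measurable (X t @^-1` [set x]);
  walk_law : forall h : seq (R * Zd d), path <=%R 0 (map fst h) ->
    P [set w | forall u, u \in h -> X u.1 w = u.2] = (path_prob p 0 i h)%:E
}.

(** Configurations *)

Definition cylinders (d : nat) : set (set (Zd d -> nat)) :=
  [set A | exists x n, A = [set eta | eta x = n]].

(* nat ^ Zd with its product sigma-algebra *)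
Notation Omega d := (g_sigma_algebraType (@cylinders d)).

Notation Omegaf d := {fsfun Zd d -> nat with 0%N}.

Definition tau (d : nat) (x : Zd d) (eta : Omega d) : Omega d :=
  fun y => eta (y + x).

Definition mass (d : nat) (xi : Omegaf d) : nat :=
  (\sum_(x <- finsupp xi) xi x)%N.

Definition poisson_product (R : realType) (d : nat) (rho : R)
    (nu : probability (Omega d) R) : Prop :=
  forall (J : {fset Zd d}) (n : Zd d -> nat),
    nu [set eta | forall x, x \in J -> eta x = n x] =
    (\prod_(x <- J) poisson_pmf rho (n x))%:E.

(** Independent random walkers *)

(* F is a family of sigma-algebras. *)
Definition mutually_independent (R : realType)
    (disp : measure_display) (T : measurableType disp) (P : probability T R)
    (I : choiceType) (F : I -> set (set T)) : Prop :=
  forall (J : {fset I}) (E : I -> set T), (forall i, i \in J -> F i (E i)) ->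
    P (\bigcap_(i in [set` J]) E i) = (\prod_(i <- J) P (E i))%E.

Definition path_sigma (R : realType) (d : nat) (T : Type)
    (X : R -> T -> Zd d) : set (set T) :=
  <<s [set A | exists t x, 0 <= t /\ A = X t @^-1` [set x]] >>.

(* The m-th of the eta_i(0) particles initially at i (counting from m = 0) has
   trajectory X (i, m); walks X (i, m) with eta_i(0) <= m are not used.
   The number of particles at a site is almost surely finite. *)
Record independent_walkers (R : realType) (d : nat) (p : Zd d -> Zd d -> R)
    (nu : probability (Omega d) R)
    (disp : measure_display) (T : measurableType disp) (P : probability T R)
    (X : Zd d * nat -> R -> T -> Zd d) (eta : R -> T -> Omega d) : Prop := {
  eta_measurable : forall t, 0 <= t -> measurable_fun [set: T] (eta t);
  eta_initial : forall A, measurable A -> P (eta 0 @^-1` A) = nu A;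
  particle_walk : forall l, random_walk p P l.1 (X l);
  particle_independent :
    mutually_independent P (fun o : option (Zd d * nat) =>
      if o is Some l then path_sigma (X l)
      else preimage_set_system [set: T] (eta 0) measurable);
  eta_count : forall t, 0 <= t -> {ae P, forall w, forall x,
    ([set l : Zd d * nat | (l.2 < eta 0%R w l.1)%N /\ X l t w = x]
      #= `I_(eta t w x))%card}
}.

(** Orthogonal duality polynomials *)

Definition charlier (R : realType) (rho : R) (k n : nat) : R :=
  \sum_(j < k.+1) 'C(k, j)%:R * (- rho) ^- j * (n ^_ j)%:R.

(* The sites outside the support of xi contribute charlier rho 0 _ = 1. *)
Definition dual (R : realType) (d : nat) (rho : R) (xi : Omegaf d)
    (eta : Omega d) : R :=
  \prod_(x <- finsupp xi) charlier rho (xi x) (eta x).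

Definition dual_sqnorm (R : realType) (d : nat) (rho : R)
    (nu : probability (Omega d) R) (xi : Omegaf d) : R :=
  \int[nu]_(eta in [set: Omega d]) (dual rho xi eta ^+ 2).

(* Convergence in L^2 of the net of finite partial sums. *)
Definition has_expansion (R : realType) (d : nat) (rho : R)
    (nu : probability (Omega d) R) (f : Omega d -> R) (C : Omegaf d -> R) : Prop :=
  forall e : R, 0 < e -> exists S0 : {fset Omegaf d}, forall S : {fset Omegaf d},
    (S0 `<=` S)%fset ->
    ('N[nu]_2%:E[EFin \o (fun eta : Omega d =>
       f eta - \sum_(xi <- S) C xi * dual rho xi eta)%R] < e%:E)%E.

Definition chaos (R : realType) (d : nat) (rho : R)
    (nu : probability (Omega d) R) (n : nat) : set (Omega d -> R) :=
  [set g | g \in Lfun nu 2%:E /\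
    forall e : R, 0 < e -> exists (s : seq (Omegaf d)) (c : Omegaf d -> R),
      (forall xi, xi \in s -> (mass xi <= n)%N) /\
      ('N[nu]_2%:E[EFin \o (fun eta : Omega d =>
         g eta - \sum_(xi <- s) c xi * dual rho xi eta)%R] < e%:E)%E].

Definition chaos_projection (R : realType) (d : nat) (rho : R)
    (nu : probability (Omega d) R) (n : nat) (f g : Omega d -> R) : Prop :=
  chaos rho nu n g /\
  forall h, chaos rho nu n h ->
    \int[nu]_(eta in [set: Omega d]) ((f eta - g eta) * h eta) = 0.

(** Fluctuation fields *)

Definition pderiv (R : realType) (d : nat) (i : 'I_d) (g : 'rV[R]_d -> R) :
  'rV[R]_d -> R := fun x => 'D_(delta_mx ord0 i) g x.

Definition pderivs (R : realType) (d : nat) (s : seq 'I_d)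
  (g : 'rV[R]_d -> R) : 'rV[R]_d -> R := foldr (@pderiv R d) g s.

Record schwartz (R : realType) (d : nat) (phi : 'rV[R]_d -> R) : Prop := {
  schwartz_smooth : forall s (x : 'rV[R]_d), differentiable (pderivs s phi) x;
  schwartz_decay : forall (al : 'I_d -> nat) s, exists M : R, forall x : 'rV[R]_d,
    `|(\prod_(i < d) x ord0 i ^+ al i) * pderivs s phi x| <= M
}.

Definition fluct_field (R : realType) (d : nat) (N : nat) (g : Omega d -> R)
    (eta : Omega d) (phi : 'rV[R]_d -> R) : R :=
  asum (fun x : Zd d =>
    g (tau x eta) * phi (\row_(i < d) ((x ord0 i)%:~R / N%:R))).

(* Main.v *)
Require Import Defs.
From HB Require Import structures.
From mathcomp Require Import all_boot all_order all_algebra finmap.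
From mathcomp Require Import all_classical all_reals all_analysis.
From mathcomp Require Import measurable_realfun.
From mathcomp Require Import ring lra zify.
Import Order.TTheory GRing.Theory Num.Theory.
Import numFieldNormedType.Exports.

Set Implicit Arguments.
Unset Strict Implicit.
Unset Printing Implicit Defensive.

Local Open Scope classical_set_scope.
Local Open Scope ring_scope.

(** Let [g = f - fk] and [s = N^2 t].  The covariance of the field at the times
0 and [s] is the sum over [x] and [y] of [phi (x/N) phi (y/N)] times
[E (g (tau x (eta 0)) * g (tau y (eta s)))].  Since [phi] decays rapidly, the
sum of [|phi (x/N)|] over the lattice is of order [N^d]
([schwartz_lattice_sum]).  It is therefore enough to bound one covariance by a
constant times [N^(-dk)], uniformly in [x] and [y] ([field_cov_bound]): the
product [N^(2d) N^(-dk)] is the order asserted.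

One covariance is controlled by self-duality.  The dual polynomials are indexed
by the list of the positions of their particles, so that their algebra reduces
to two identities about one particle: consing [x] to the index subtracts
[eta x / rho] times the value at the configuration with a particle removed at [x]
([list_dual_cons]), and adding a particle at [y] to the configuration subtracts
a multiple of the dual with one [y] removed from the index
([list_dual_add_particle]).  The Mecke formula for the Poisson measure
([mecke_int]) exchanges the factor [eta x] for a particle added at [x].
A particle added at [x] at time 0 acts on a function [H] of [eta s] by the
operator [H m + sum_z p_s (x, z) (H (m + delta_z) - H m)], because the particles
are independent.  Altogether ([dual_particle_walk])
[[
  E (D (x :: a) (eta 0) H (eta s))
    = - E (D a (eta 0) sum_z p_s (x, z) (H (eta s + delta_z) - H (eta s))),
]]
and for [H] a dual polynomial [D b] this is the recursion [cov_cons]: the dual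
particle at [x] has to jump to one of the sites of [b].  By induction the
covariance of two dual polynomials vanishes unless they have the same number
[n] of particles.  When [n >= k], estimate [k] of the [n] successive factors by
[e], the supremum of [p_s], and sum the others to at most 1: the covariance is
at most [a(b) k! e^k], with a constant that does not depend on [n]
([cov_bound]).  That uniformity is what allows the sum over all the pairs of the
expansion of [g] to be bounded by the series assumed to converge.  The
expansion of [g] involves masses [>= k] only because [fk] is an orthogonal
projection ([chaos_expansion]); it converges in L^2 at time [s] as well as at
time 0 because [nu] is stationary ([eta_law]).

Finally [e = O(N^(-d))] ([transition_le]).  By irreducibility the jumps contain
[d] linearly independent vectors; by symmetry the kernel splits off a simple
random walk along each of them.  These walks commute with everything else, and
each one divides the supremum of the [n]-step kernel by the square root of [n]
([heat_peel]).

Two limits are involved.  The system is infinite, so identities about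
particles are first proved for those that start in a finite box
([box_integral]) and then passed to the limit.  The field is an infinite series;
it converges absolutely almost surely and is dominated by a square integrable
variable ([asum_cov_bound]). *)

(** * Binomial coefficients *)

Lemma leq_bin_step n i : (i.*2 < n)%N -> ('C(n, i) <= 'C(n, i.+1))%N.
Proof.
move=> lin; rewrite -(leq_pmul2l (ltn0Sn i)) mul_bin_left leq_pmul2r.
  lia.
by rewrite bin_gt0; lia.
Qed.

Lemma leq_bin_mid m i : ('C(m.*2, i) <= 'C(m.*2, m))%N.
Proof.
have low : forall j, (j <= m)%N -> ('C(m.*2, m - j) <= 'C(m.*2, m))%N.
  elim=> [|j IH] jm; first by rewrite subn0.
  apply: leq_trans (IH (ltnW jm)); rewrite -(subnSK jm).
  apply: leq_bin_step; lia.
have [im|mi] := leqP i m; first by rewrite -(subKn im) low ?leq_subr.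
have [im2|m2i] := leqP i m.*2; last by rewrite bin_small.
by rewrite -bin_sub // -[X in 'C(_, X)](_ : m - (i - m) = _)%N ?low; lia.
Qed.

(** The recursion [(m+1) 'C(2m+2, m+1) = 2 (2m+1) 'C(2m, m)] reduces the induction
step to [(2m+1) (2m+3) <= (2m+2)^2]. *)
Lemma leq_bin_mid_sqr m : ('C(m.*2, m) ^ 2 * m.*2.+1 <= 16 ^ m)%N.
Proof.
elim: m => [//|m IH].
have e1 : ('C(m.+1.*2, m.+1) * m.+1 = 'C(m.*2, m) * (m.*2.+1).*2)%N.
  have h1 := mul_bin_left m.*2.+1 m.
  have h2 := mul_bin_diag m.*2.+1 m.
  have h3 := binS m.*2.+1 m.
  have h4 := mul_bin_down m.*2.+1 m.
  rewrite doubleS h3 /= in h2 h4 *; nia.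
rewrite -(leq_pmul2r (m := m.+1 ^ 2)) ?expn_gt0 //.
have -> : ('C(m.+1.*2, m.+1) ^ 2 * (m.+1).*2.+1 * m.+1 ^ 2
   = ('C(m.*2, m) ^ 2 * m.*2.+1) * (4 * (m.*2.+1 * m.*2.+3)))%N.
  have -> : ('C(m.+1.*2, m.+1) ^ 2 * (m.+1).*2.+1 * m.+1 ^ 2 =
     ('C(m.+1.*2, m.+1) * m.+1) ^ 2 * (m.+1).*2.+1)%N by rewrite expnMn; lia.
  by rewrite e1 expnMn doubleS; lia.
apply: leq_trans (leq_mul IH (leqnn _)) _.
by rewrite [(16 ^ m.+1)%N]expnSr -mulnA leq_mul2l; apply/orP; right; nia.
Qed.

(** The probabilities of a simple random walk after [k] steps are at most
[(k+1)^(-1/2)].  The bound with [k+1] is exact at [k = 0] and is the one that makes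
the induction of [heat_peel] close.  An odd row is compared with the next even
one through Pascal's rule. *)
Lemma leq_bin_sqr k i : ('C(k, i) ^ 2 * k.+1 <= 4 ^ k)%N.
Proof.
rewrite -[k]odd_double_half; case: (odd k); rewrite ?add0n ?add1n; set m := k./2.
- have oddm : (('C(m.*2.+1, i)).*2 <= 'C(m.+1.*2, m.+1))%N.
    have key : forall j, (j <= m)%N -> (('C(m.*2.+1, j)).*2 <= 'C(m.+1.*2, m.+1))%N.
      move=> j jm; apply: leq_trans (leq_bin_mid m.+1 j.+1).
      by rewrite doubleS binS -addnn leq_add2r leq_bin_step //; lia.
    have [im|mi] := leqP i m; first exact: key.
    have [im2|m2i] := leqP i m.*2.+1; last by rewrite bin_small.
    by rewrite -bin_sub // key //; lia.
  have := leq_bin_mid_sqr m.+1.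
  have -> : (16 ^ m.+1 = 4 * 4 ^ m.*2.+1)%N.
    by rewrite -expnS -doubleS -muln2 mulnC expnM.
  rewrite doubleS in oddm *; move: ('C(_, _)) ('C(_, _)) (4 ^ _)%N oddm => b a c.
  rewrite -leq_sqr -muln2 expnMn => oddm H.
  rewrite -(leq_pmul2l (m := 4)) //; apply: leq_trans H.
  by rewrite mulnA (mulnC 4%N); apply: leq_mul.
- apply: leq_trans (_ : 'C(m.*2, m) ^ 2 * m.*2.+1 <= _)%N.
    by rewrite leq_mul2r leq_sqr leq_bin_mid orbT.
  by rewrite (_ : 4 ^ m.*2 = 16 ^ m)%N ?leq_bin_mid_sqr // -mul2n expnM.
Qed.

Lemma sum_pascal (R : pzRingType) (g : nat -> R) n :
  \sum_(i < n.+1) 'C(n, i)%:R * (g i.+1 + g i) =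
  \sum_(i < n.+2) 'C(n.+1, i)%:R * g i.
Proof.
rewrite [RHS]big_ord_recl bin0 mul1r.
under [X in _ = _ + X]eq_bigr do rewrite lift0 binS natrD mulrDl.
under [LHS]eq_bigr do rewrite mulrDr.
rewrite !big_split /= addrA [LHS]addrC; congr (_ + _).
rewrite big_ord_recl [X in _ = _ + X]big_ord_recr /= (bin_small (ltnSn n)) mul0r addr0.
by rewrite bin0 mul1r; congr (_ + _); apply: eq_bigr => i _; rewrite lift0.
Qed.

(** * Convolutions on an abelian group *)

Section Convolution.
Variables (R : realType) (V : zmodType).
Implicit Types (w : seq (V * R)) (h : V -> R) (z v : V).

(** The list [w] stands for the measure with mass [a.2] at [a.1].  Repeated points
are meant to add up, so that a kernel is decomposed by concatenation. *)
Definition convol w h z : R := \sum_(a <- w) a.2 * h (z - a.1).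
Definition total_weight w : R := \sum_(a <- w) a.2.

Lemma convolC w w' h : convol w (convol w' h) = convol w' (convol w h).
Proof.
apply/funext => z; rewrite /convol.
under eq_bigr do rewrite mulr_sumr.
rewrite exchange_big; apply: eq_bigr => b _.
by rewrite mulr_sumr; apply: eq_bigr => a _; rewrite mulrCA addrAC.
Qed.

Lemma iter_convolC w w' n h :
  iter n (convol w) (convol w' h) = convol w' (iter n (convol w) h).
Proof. by elim: n => //= n ->; rewrite convolC. Qed.

Lemma convol_cat w w' h z : convol (w ++ w') h z = convol w h z + convol w' h z.
Proof. by rewrite /convol big_cat. Qed.

(** The binomial theorem for two commuting operators. *)
Lemma iter_convolD w w' n h z :
  iter n (convol (w ++ w')) h z =
  \sum_(i < n.+1) 'C(n, i)%:R * iter (n - i) (convol w') (iter i (convol w) h) z.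
Proof.
(* The powers already taken of each operator are the induction parameters. *)
suff gen : forall k l, iter n (convol (w ++ w')) (iter l (convol w') (iter k (convol w) h)) z =
  \sum_(i < n.+1) 'C(n, i)%:R * iter (l + (n - i)) (convol w') (iter (k + i) (convol w) h) z.
  exact: (gen 0%N 0%N).
elim: n => [|n IH] k l; first by rewrite big_ord1 mul1r !addn0.
rewrite iterSr.
have -> : convol (w ++ w') (iter l (convol w') (iter k (convol w) h)) =
  fun y => iter l (convol w') (iter k.+1 (convol w) h) y + iter l.+1 (convol w') (iter k (convol w) h) y.
  by apply/funext => y; rewrite convol_cat -iter_convolC.
have lin : forall m (f g : V -> R) y, iter m (convol (w ++ w')) (fun x => f x + g x) y =
    iter m (convol (w ++ w')) f y + iter m (convol (w ++ w')) g y.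
  elim=> //= m IHm f g y; rewrite -big_split; apply: eq_bigr => a _.
  by rewrite IHm mulrDr.
rewrite lin !IH -big_split /=.
rewrite -(sum_pascal (fun i => iter (l + (n.+1 - i)) (convol w') (iter (k + i) (convol w) h) z)).
apply: eq_bigr => i _; have ik : (i <= n)%N by rewrite -ltnS.
by rewrite -mulrDr subSS (subSn ik) !addnS.
Qed.

Definition nonneg_steps w := forall a, a \in w -> 0 <= a.2.

Lemma convol_ge0 w h : nonneg_steps w -> (forall z, 0 <= h z) ->
  forall n z, 0 <= iter n (convol w) h z.
Proof.
move=> w0 h0; elim=> //= n IH z; rewrite /convol big_seq.
by apply: sumr_ge0 => a aw; rewrite mulr_ge0 // w0.
Qed.

Lemma convol_le w h M : nonneg_steps w -> (forall z, h z <= M) ->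
  forall n z, iter n (convol w) h z <= total_weight w ^+ n * M.
Proof.
move=> w0 hM; elim=> [|n IH] z; first by rewrite mul1r.
rewrite iterS exprS -mulrA /convol /total_weight mulr_suml big_seq [leRHS]big_seq.
by apply: ler_sum => a aw; rewrite ler_wpM2l // w0.
Qed.

Lemma iter_convol1 v (c : R) k h z :
  iter k (convol [:: (v, c)]) h z = c ^+ k * h (z - v *+ k).
Proof.
elim: k z => [|k IH] z; first by rewrite mul1r subr0.
by rewrite iterS /convol big_seq1 IH /= exprS mulrA mulrS opprD addrA.
Qed.

Definition pm_steps v (c : R) := [:: (v, c / 2); (- v, c / 2)].

Lemma iter_pm_steps v c k h z :
  iter k (convol (pm_steps v c)) h z =
  c ^+ k * \sum_(i < k.+1) 'C(k, i)%:R / 2 ^+ k * h (z - v *~ (i%:Z - (k - i)%:Z)).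
Proof.
rewrite -[pm_steps v c]/([:: (v, c / 2)] ++ [:: (- v, c / 2)]) iter_convolD mulr_sumr.
apply: eq_bigr => i _; have ik : (i <= k)%N by rewrite -ltnS.
have e : (c / 2) ^+ (k - i) * (c / 2) ^+ i = c ^+ k / 2 ^+ k.
  by rewrite -exprD subnK // expr_div_n.
rewrite !iter_convol1 [X in _ * X = _]mulrA e.
have -> : z - - v *+ (k - i) - v *+ i = z - v *~ (i%:Z - (k - i)%:Z).
  by rewrite mulrzBr mulNrn opprK opprB -!pmulrn addrA addrAC.
ring.
Qed.

Fixpoint zspan (vs : seq V) (x : V) : Prop :=
  if vs is v :: vs' then exists r : int, zspan vs' (x - v *~ r) else x = 0.

Fixpoint zfree (vs : seq V) : Prop :=
  if vs is v :: vs' then (forall r : int, zspan vs' (v *~ r) -> r = 0) /\ zfree vs'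
  else True.

Lemma zspan0 vs : zspan vs 0.
Proof. by elim: vs => //= v vs IH; exists 0; rewrite mulr0z subr0. Qed.

(** Each coset of the group generated by [vs] meets the support of [h] at most
once.  A walk along [vs] started from [h] then never brings together the masses
of two points, and spreads out as if started from one. *)
Definition sparse vs h :=
  forall z z', h z != 0 -> h z' != 0 -> zspan vs (z - z') -> z = z'.

Lemma sum_at_most_one (I : finType) (F : I -> R) (B : R) :
  0 <= B -> (forall i, F i <= B) -> (forall i j, F i != 0 -> F j != 0 -> i = j) ->
  \sum_i F i <= B.
Proof.
move=> B0 FB one; have [[i Fi]|none] := pselect (exists i, F i != 0).
  rewrite (bigD1 i) //= big1 ?addr0 // => j; apply: contraNeq => Fj.
  by rewrite (one _ _ Fi Fj).
rewrite big1 // => i _; apply/eqP; apply: contra_notT none => Fi.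
by exists i.
Qed.

Lemma bin_exp2_le k i : 'C(k, i)%:R / 2 ^+ k <= (Num.sqrt k.+1%:R)^-1 :> R.
Proof.
rewrite ler_pdivrMr ?exprn_gt0 // mulrC ler_pdivlMr ?sqrtr_gt0 ?ltr0n //.
rewrite -(ler_pXn2r (n := 2)) ?nnegrE ?mulr_ge0 ?sqrtr_ge0 ?exprn_ge0 //.
rewrite exprMn sqr_sqrtr ?ler0n // -exprM mulnC exprM -!natrX -natrM ler_nat.
exact: leq_bin_sqr.
Qed.

(** For a sparse [h] at most one term of the binomial sum is nonzero at a given
point, so the walk along [v] multiplies the supremum by one binomial probability. *)
Lemma iter_pm_steps_le v vs (c : R) k h M :
  0 <= c -> zfree (v :: vs) -> sparse (v :: vs) h ->
  (forall z, 0 <= h z) -> (forall z, h z <= M) ->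
  forall z, iter k (convol (pm_steps v c)) h z <= c ^+ k * (M / Num.sqrt k.+1%:R).
Proof.
move=> c0 [vfree _] hs h0 hM z.
have M0 : 0 <= M := le_trans (h0 0) (hM 0).
rewrite iter_pm_steps ler_wpM2l ?exprn_ge0 //.
apply: sum_at_most_one => [|i|i j Fi Fj].
- by rewrite divr_ge0 // sqrtr_ge0.
- by rewrite mulrC ler_pM // ?divr_ge0 ?exprn_ge0 ?ler0n // bin_exp2_le.
suff ij : (i : nat) = j by apply/val_inj.
move: Fi Fj; rewrite !mulf_eq0 !negb_or => /andP[_ Fi] /andP[_ Fj].
have := hs _ _ Fi Fj; set a := (_ - _ : int); set b := (_ - _ : int).
have ab : b - a = ((j : nat)%:Z - (i : nat)%:Z) *+ 2.
  (* The displacement of the walk is twice an index, up to a constant. *)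
  by rewrite /a /b; have := ltn_ord i; have := ltn_ord j; lia.
have e : z - v *~ a - (z - v *~ b) = v *~ (b - a).
  by rewrite mulrzBr opprB addrC addrA subrK.
have span : zspan (v :: vs) (z - v *~ a - (z - v *~ b)).
  by rewrite e; exists (b - a); rewrite subrr; apply: zspan0.
move=> /(_ span)/eqP; rewrite -subr_eq0 e => /eqP vab.
have /vfree : zspan vs (v *~ (b - a)) by rewrite vab; apply: zspan0.
by rewrite ab mulr2n; lia.
Qed.

(** Walking along [v] only uses up that direction: as [v] is independent of [vs],
the result is still sparse along [vs]. *)
Lemma sparse_iter_pm_steps v vs (c : R) k h :
  zfree (v :: vs) -> sparse (v :: vs) h -> sparse vs (iter k (convol (pm_steps v c)) h).
Proof.
move=> [vfree _] hs z z'; rewrite !iter_pm_steps.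
have supp y : c ^+ k * (\sum_(i < k.+1) 'C(k, i)%:R / 2 ^+ k *
    h (y - v *~ (i%:Z - (k - i)%:Z))) != 0 -> exists r : int, h (y - v *~ r) != 0.
  move=> nz; apply: contrapT => none; move/eqP: nz; apply.
  rewrite big1 ?mulr0 // => i _; apply/eqP; rewrite mulf_eq0; apply/orP; right.
  by apply: contra_notT none => hy; eexists; exact: hy.
move=> /supp[r hr] /supp[r' hr'] span.
have e : z - v *~ r - (z' - v *~ r') = z - z' - v *~ (r - r').
  by rewrite mulrzBr !opprD !opprK addrACA.
have /(hs _ _ hr hr') : zspan (v :: vs) (z - v *~ r - (z' - v *~ r')).
  by rewrite e; exists (r' - r); rewrite -addrA -opprD -mulrzDr (_ : r - r' + (r' - r) = 0) ?mulr0z ?subr0 //; lia.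
move=> /eqP; rewrite -subr_eq0 e subr_eq0 => /eqP zz'.
have r0 : r - r' = 0 by apply: vfree; rewrite -zz'.
by apply/eqP; rewrite -subr_eq0 zz' r0 mulr0z.
Qed.

(** The Cauchy-Schwarz inequality with free weights: up to the factor
[\sum_i w i * u i], the difference of the two sides is the variance of [x i / u i]
under the weights [w i * u i]. *)
Lemma sum_sqr_le (I : finType) (w x u : I -> R) :
  (forall i, 0 <= w i) -> (forall i, 0 < u i) -> 0 < \sum_i w i * u i ->
  (\sum_i w i * x i) ^+ 2 <= (\sum_i w i * u i) * (\sum_i w i * (x i ^+ 2 / u i)).
Proof.
move=> w0 u0; set S := \sum_i w i * u i => S0; set X := \sum_i w i * x i.
have : 0 <= \sum_i w i * (u i * (x i / u i - X / S) ^+ 2).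
  by apply: sumr_ge0 => i _; rewrite mulr_ge0 ?w0 // mulr_ge0 ?sqr_ge0 // ltW.
have -> : \sum_i w i * (u i * (x i / u i - X / S) ^+ 2) =
    \sum_i w i * (x i ^+ 2 / u i) - X * (X / S *+ 2) + S * (X / S) ^+ 2.
  move: (X / S) => l; rewrite /X /S !mulr_suml -sumrB -big_split /=.
  apply: eq_bigr => i _; have un0 : u i != 0 by rewrite gt_eqF.
  by rewrite mulr2n; field.
have -> : S * (X / S) ^+ 2 = X * (X / S) by field; rewrite gt_eqF.
rewrite mulr2n mulrDr opprD addrA subrK subr_ge0 mulrA -expr2 ler_pdivrMr //.
by rewrite [_ * S]mulrC.
Qed.

Definition with_pm w0 (vcs : seq (V * R)) :=
  w0 ++ flatten [seq pm_steps a.1 a.2 | a <- vcs].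

(** Induction on the list of directions.  The [n]-th power of a sum of two commuting
convolutions is a binomial mixture over the number [i] of steps made along [v].
These steps gain a factor [(i+1)^(-1/2)] by [iter_pm_steps_le], and the [n - i]
others are covered by the induction hypothesis.  The factor [1/(i+1)] of the
squares raises the binomial coefficient [(n, i)] to [(n + j + 1, i + 1)], and the
mixture is again part of a binomial expansion.  Squares are estimated in order to
avoid half-integer powers, and [n! / (n + j)!] replaces [n^(-j)] for the same
reason: it fits the binomial coefficients exactly. *)
Lemma heat_peel w0 (vcs : seq (V * R)) h M :
  nonneg_steps w0 -> 0 < total_weight w0 -> (forall a, a \in vcs -> 0 < a.2) ->
  zfree [seq a.1 | a <- vcs] -> sparse [seq a.1 | a <- vcs] h ->
  (forall z, 0 <= h z) -> (forall z, h z <= M) ->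
  forall n z, (iter n (convol (with_pm w0 vcs)) h z) ^+ 2 <=
    M ^+ 2 * (total_weight (with_pm w0 vcs)) ^+ (n.*2 + size vcs) *
    (n`!%:R / (n + size vcs)`!%:R) / \prod_(a <- vcs) a.2.
Proof.
move=> w0ge w0gt; elim: vcs h M => [|[v c] vcs IH] h M cgt free hs h0 hM n z.
  rewrite /with_pm cats0 big_nil /= !addn0 invr1 mulr1 divff ?mulr1; last first.
    by rewrite pnatr_eq0 -lt0n fact_gt0.
  rewrite -mul2n mulnC exprM -exprMn lerXn2r ?nnegrE ?convol_ge0 //.
    by rewrite mulr_ge0 ?exprn_ge0 ?(ltW w0gt) // (le_trans (h0 0) (hM 0)).
  by rewrite mulrC convol_le.
rewrite -/(with_pm w0 vcs) in IH *.
have c0 : 0 < c by apply: (cgt (v, c)); rewrite mem_head.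
have cgt' a : a \in vcs -> 0 < a.2 by move=> av; rewrite cgt // inE av orbT.
have flatE : flatten [seq pm_steps a.1 a.2 | a <- (v, c) :: vcs] =
  pm_steps v c ++ flatten [seq pm_steps a.1 a.2 | a <- vcs] by [].
have perm h' : convol (with_pm w0 ((v, c) :: vcs)) h' = convol (pm_steps v c ++ with_pm w0 vcs) h'.
  by apply/funext => y; rewrite /with_pm flatE !convol_cat addrCA.
have -> : total_weight (with_pm w0 ((v, c) :: vcs)) = c + total_weight (with_pm w0 vcs).
  by rewrite /total_weight /with_pm flatE !big_cat /= /pm_steps !big_cons big_nil /=; lra.
have iterE m : iter m (convol (with_pm w0 ((v, c) :: vcs))) h =
    iter m (convol (pm_steps v c ++ with_pm w0 vcs)) h.
  by elim: m => //= m ->; rewrite perm.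
rewrite iterE iter_convolD.
have {}IH i : (iter (n - i) (convol (with_pm w0 vcs)) (iter i (convol (pm_steps v c)) h) z) ^+ 2 <=
    (c ^+ i * (M / Num.sqrt i.+1%:R)) ^+ 2 * total_weight (with_pm w0 vcs) ^+ ((n - i).*2 + size vcs) *
    ((n - i)`!%:R / (n - i + size vcs)`!%:R) / \prod_(a <- vcs) a.2.
  apply: IH => //; first by case: free.
  - exact: sparse_iter_pm_steps.
  - by apply: convol_ge0 => // a; rewrite !inE => /orP[]/eqP-> /=; rewrite divr_ge0 // ltW.
  - exact: (iter_pm_steps_le _ (ltW c0) free hs h0 hM).
set s := total_weight (with_pm w0 vcs) in IH *.
have s0 : 0 < s.
  rewrite /s /total_weight big_cat /= ltr_pwDl // big_flatten big_map big_seq sumr_ge0 // => a av.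
  by rewrite !big_cons big_nil /= addr0 addr_ge0 // divr_ge0 // ltW ?cgt'.
set x := fun i : nat => iter (n - i) (convol (with_pm w0 vcs)) (iter i (convol (pm_steps v c)) h) z.
set j := size vcs in IH *; set Pi := \prod_(a <- vcs) a.2 in IH *.
have Pi0 : 0 < Pi by rewrite /Pi big_seq prodr_gt0.
have xE : \sum_(i < n.+1) 'C(n, i)%:R * x i = \sum_(i < n.+1) ('C(n, i)%:R * c ^+ i) * (x i / c ^+ i).
  by apply: eq_bigr => i _; field; rewrite expf_neq0 // gt_eqF.
have binE : \sum_(i < n.+1) ('C(n, i)%:R * c ^+ i) * s ^+ (n - i) = (c + s) ^+ n.
  rewrite [c + s]addrC exprDn; apply: eq_bigr => i _; rewrite -[RHS]mulr_natl; ring.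
(* The weights [s ^+ (n - i)] are proportional to the size of the i-th term, up to
   a slowly varying factor: no power of [n] is lost in Cauchy-Schwarz. *)
rewrite xE; apply: le_trans (@sum_sqr_le 'I_n.+1 (fun i => 'C(n, i)%:R * c ^+ i)
  (fun i => x i / c ^+ i) (fun i => s ^+ (n - i)) _ _ _) _.
- by move=> i; rewrite mulr_ge0 ?ler0n // exprn_ge0 // ltW.
- by move=> i; rewrite exprn_gt0.
- by rewrite binE exprn_gt0 // addr_gt0.
rewrite binE.
set K := M ^+ 2 * (n`!%:R / (n + j.+1)`!%:R) / (c * Pi).
have K0 : 0 <= K.
  apply: divr_ge0; last by rewrite ltW // mulr_gt0.
  by apply: mulr_ge0; rewrite ?sqr_ge0 // divr_ge0 ?ler0n.
have -> : M ^+ 2 * (c + s) ^+ (n.*2 + j.+1) * (n`!%:R / (n + j.+1)`!%:R) / (\prod_(a <- (v, c) :: vcs) a.2) =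
    (c + s) ^+ n * (K * (c + s) ^+ (n + j.+1)).
  rewrite big_cons -/Pi /= -addnn -addnA exprD /K; field.
  by rewrite pnatr_eq0 -lt0n fact_gt0 !gt_eqF.
rewrite ler_wpM2l ?exprn_ge0 ?addr_ge0 ?(ltW c0) ?(ltW s0) //.
apply: (@le_trans _ _ (K * \sum_(i < n.+1) 'C(n + j.+1, i.+1)%:R * (c ^+ i.+1 * s ^+ (n + j - i)))).
  rewrite mulr_sumr; apply: ler_sum => i _.
  have ci0 : 0 < c ^+ i by rewrite exprn_gt0.
  have si0 : 0 < s ^+ (n - i) by rewrite exprn_gt0.
  have ik : (i <= n)%N by rewrite -ltnS.
  have {IH} := IH i; rewrite -/(x i) => IH.
  have h1 : (x i / c ^+ i) ^+ 2 / s ^+ (n - i) <=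
     M ^+ 2 / i.+1%:R * s ^+ (n - i + j) * ((n - i)`!%:R / (n - i + j)`!%:R) / Pi.
    rewrite ler_pdivrMr // expr_div_n ler_pdivrMr ?exprn_gt0 //.
    apply: le_trans IH _; rewrite exprMn expr_div_n sqr_sqrtr ?ler0n //.
    rewrite -addnn -addnA exprD le_eqVlt; apply/orP; left; apply/eqP; field.
    by rewrite !gt_eqF ?ltr0n ?fact_gt0 //.
  apply: le_trans (ler_wpM2l _ h1) _; first by rewrite mulr_ge0 ?ler0n // ltW.
  have e1 : ('C(n, i) * (i`! * (n - i)`!) = n`!)%N by apply: bin_fact.
  have e2 : ('C(n + j.+1, i.+1) * (i.+1`! * (n - i + j)`!) = (n + j.+1)`!)%N.
    rewrite (_ : n - i + j = n + j.+1 - i.+1)%N; last lia.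
    by apply: bin_fact; lia.
  rewrite (_ : n + j - i = n - i + j)%N; last lia.
  have e1' : 'C(n, i)%:R * (i`!%:R * (n - i)`!%:R) = n`!%:R :> R by rewrite -!natrM e1.
  have e2' : 'C(n + j.+1, i.+1)%:R * (i.+1%:R * i`!%:R * (n - i + j)`!%:R) = (n + j.+1)`!%:R :> R.
    by rewrite -!natrM -factS e2.
  rewrite /K -e1' -e2' le_eqVlt; apply/orP; left; apply/eqP.
  have nz m : m`!%:R != 0 :> R by rewrite pnatr_eq0 -lt0n fact_gt0.
  have bz : 'C(n + j.+1, i.+1)%:R != 0 :> R by rewrite pnatr_eq0 -lt0n bin_gt0; lia.
  rewrite [c ^+ i.+1]exprS; field.
  by rewrite !nz bz !gt_eqF ?ltr0n.
rewrite ler_wpM2l // [c + s]addrC exprDn [leRHS]big_ord_recl /=.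
apply: (@le_trans _ _ (\sum_(i < n + j.+1) 'C(n + j.+1, i.+1)%:R * (c ^+ i.+1 * s ^+ (n + j - i)))).
  pose F i := 'C(n + j.+1, i.+1)%:R * (c ^+ i.+1 * s ^+ (n + j - i)).
  rewrite -!(big_mkord xpredT F).
  rewrite [leRHS](big_cat_nat (n := n.+1)) //=; last by lia.
  rewrite lerDl sumr_ge0 // => i _.
  by rewrite mulr_ge0 ?ler0n // mulr_ge0 // exprn_ge0 // ltW.
rewrite ler_wpDl ?mulrn_wge0 ?mulr_ge0 ?exprn_ge0 ?(ltW c0) ?(ltW s0) //.
apply: ler_sum => i _; rewrite -[leRHS]mulr_natl (_ : n + j.+1 - i.+1 = n + j - i)%N; last by lia.
by rewrite [_ ^+ _ * c ^+ _]mulrC.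
Qed.

End Convolution.

(** * Heat kernel bound *)

Lemma esum_fset_supp (R : realType) (I : choiceType) (s : {fset I}) (g : I -> \bar R) :
  (forall x, (0 <= g x)%E) -> (forall x, x \notin s -> g x = 0%E) ->
  (\esum_(x in [set: I]) g x = \sum_(x <- s) g x)%E.
Proof.
move=> g0 gs; transitivity (\esum_(x in [set` s]) g x)%E.
  rewrite [RHS]esum_mkcond; apply: eq_esum => x _.
  by case: ifPn => //; rewrite notin_setE /= => /negP/gs.
rewrite (esum_fset (finite_fset s)) //.
by rewrite (fsbig_finite _ _ (finite_fset s)) set_fsetK.
Qed.

Lemma asum_fset_supp (R : realType) (I : choiceType) (s : {fset I}) (g : I -> R) :
  (forall x, x \notin s -> g x = 0) -> asum g = \sum_(x <- s) g x.
Proof.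
move=> gs; rewrite /asum !(esum_fset_supp (s := s)) //; last 2 first.
- by move=> x xs; rewrite funenegE /= gs // oppr0 maxxx.
- by move=> x xs; rewrite funeposE /= gs // maxxx.
have -> : (EFin \o g)^\+%E = (EFin \o (fun x => Num.max (g x) 0)).
  by apply/funext => x; rewrite funeposE /= EFin_max.
have -> : (EFin \o g)^\-%E = (EFin \o (fun x => Num.max (- g x) 0)).
  by apply/funext => x; rewrite funenegE /= EFin_max.
rewrite !sumEFin -EFinB /= -sumrB; apply: eq_bigr => x _.
by rewrite /Num.max; case: ltP => h1; case: ltP => h2; lra.
Qed.

Section HeatKernel.
Variables (R : realType) (d : nat) (p : Zd d -> Zd d -> R).
Hypothesis hp : jump_kernel p.

Lemma finite_jumps : finite_set [set v | p 0 v != 0].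
Proof.
case: (jump_range hp) => r r0 hr.
pose B := Num.bound r.
apply: (@sub_finite_set _ _ ((fun M : 'rV['I_(B.*2.+1)]_d =>
   map_mx (fun i : 'I_(B.*2.+1) => (i : nat)%:Z - B%:Z) M) @` setT)); last first.
  exact/finite_image/finite_finset.
move=> v /= pv.
have vr l : `|v ord0 l| <= B%:Z.
  rewrite -(ler_int R) -[leRHS]pmulrn; apply/ltW; apply: le_lt_trans (archi_boundP (ltW r0)).
  have : euclid_norm R (0 - v) <= r.
    by rewrite leNgt; apply/negP => /hr p0; rewrite p0 eqxx in pv.
  apply: le_trans; rewrite /euclid_norm intr_norm -sqrtr_sqr ler_sqrt; last first.
    by apply: sumr_ge0 => i _; exact: sqr_ge0.
  rewrite (bigD1 l) //= sub0r mxE rmorphN sqrrN lerDl.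
  by apply: sumr_ge0 => i _; exact: sqr_ge0.
exists (\row_l inord (absz (v ord0 l + B%:Z))) => //.
apply/rowP => l; have := vr l; rewrite ler_norml => /andP[h1 h2]; rewrite !mxE.
by change (v 0 l) with (v ord0 l); rewrite inordK; lia.
Qed.

Definition jumps : {fset Zd d} := fset_set [set v | p 0 v != 0].

Lemma jumpsP v : (v \in jumps) = (p 0 v != 0).
Proof. by rewrite /jumps in_fset_set ?inE //; [apply/idP/idP; rewrite ?inE | exact: finite_jumps]. Qed.

Lemma p0_sym v : p 0 (- v) = p 0 v.
Proof. by rewrite (jump_sym hp) (jump_shift hp) opprK add0r. Qed.

Definition steps := [seq (v, p 0 v) | v <- jumps].
Definition delta0 (z : Zd d) : R := (z == 0)%:R.

Lemma nstepE n i j : nstep p n i j = iter n (convol steps) delta0 (j - i).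
Proof.
elim: n i => [|n IH] i /=; first by rewrite /delta0 subr_eq0 eq_sym.
have supp l : l \notin [fset (i + v)%R | v in jumps]%fset -> p i l * nstep p n l j = 0.
  move=> lj; suff -> : p i l = 0 by rewrite mul0r.
  rewrite (jump_shift hp); apply: contraNeq lj; rewrite -jumpsP => lj.
  by apply/imfsetP; exists (l - i) => //; rewrite addrC subrK.
rewrite (asum_fset_supp supp) big_imfset /=; last by move=> x y _ _; apply: addrI.
rewrite /convol big_map; apply: eq_bigr => v _.
by rewrite IH (jump_shift hp) addrAC subrr add0r opprD addrA.
Qed.

Lemma steps_ge0 : nonneg_steps steps.
Proof. by move=> a /mapP[v _ ->]; exact: jump_ge0. Qed.

Lemma steps_mass : total_weight steps = 1.
Proof.
rewrite /total_weight big_map /=; apply: EFin_inj; rewrite -sumEFin -(jump_sum1 hp 0).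
rewrite (esum_fset_supp (s := jumps)) // => x; first by rewrite lee_fin jump_ge0.
by rewrite jumpsP negbK => /eqP ->.
Qed.

Lemma iter_steps_sym n z : iter n (convol steps) delta0 (- z) = iter n (convol steps) delta0 z.
Proof.
elim: n z => [|n IH] z; first by rewrite /= /delta0 oppr_eq0.
rewrite !iterS /convol !big_map /=.
have e : (jumps = [fset (- v)%R | v in jumps])%fset.
  apply/fsetP => v; rewrite jumpsP; apply/idP/imfsetP => /= [pv|[u]].
    by exists (- v); rewrite ?opprK // jumpsP p0_sym.
  by rewrite jumpsP => pu ->; rewrite p0_sym.
rewrite [in LHS]e big_imfset /=; last by move=> x y _ _; apply: oppr_inj.
by apply: eq_bigr => v _; rewrite p0_sym -[iter _ _ _ (- z - _)]IH opprD !opprK.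
Qed.

Lemma nstep_sym n i j : nstep p n i j = nstep p n j i.
Proof. by rewrite !nstepE -iter_steps_sym opprB. Qed.

Lemma transition_sym t i j : transition p t i j = transition p t j i.
Proof.
by rewrite /transition; congr (limn (series _)); apply/funext => n; rewrite nstep_sym.
Qed.

Definition ratrow (v : Zd d) : 'rV[rat]_d := map_mx intr v.
Definition jump_mx : 'M[rat]_(#|` jumps|, d) := \matrix_i ratrow (jumps`_i).

Lemma ratrowB u v : ratrow (u - v) = ratrow u - ratrow v.
Proof. by apply/rowP => l; rewrite !mxE rmorphB. Qed.

(** Each unit vector of the lattice can be reached from 0, hence is a sum of
jumps.  Rational coefficients turn the extraction of [d] independent jumps into
linear algebra. *)
Lemma jump_mx_full : row_full jump_mx.
Proof.
have sub n z : iter n (convol steps) delta0 z != 0 -> (ratrow z <= jump_mx)%MS.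
  elim: n z => [|n IH] z.
    rewrite /= /delta0; have [-> _|_] := eqVneq z 0; last by rewrite eqxx.
    rewrite (_ : ratrow 0 = 0) ?sub0mx //; apply/rowP => l; rewrite !mxE //.
  move=> nz; have [v vj hv] : exists2 v, v \in jumps & iter n (convol steps) delta0 (z - v) != 0.
    apply: contrapT => none; move/eqP: nz; apply.
    rewrite iterS /convol big_map big_seq big1 // => v vj /=.
    have [->|h] := eqVneq (iter n (convol steps) delta0 (z - v)) 0; first by rewrite mulr0.
    by exfalso; apply: none; exists v.
  have -> : ratrow z = ratrow (z - v) + ratrow v by rewrite ratrowB subrK.
  apply: addmx_sub; first exact: IH.
  have vi : (index v jumps < #|` jumps|)%N by rewrite index_mem.
  have -> : ratrow v = row (Ordinal vi) jump_mx.
    by apply/rowP => l; rewrite !mxE /= nth_index.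
  exact: row_sub.
rewrite -sub1mx; apply/row_subP => i.
have -> : row i 1%:M = ratrow (delta_mx ord0 i).
  by apply/rowP => l; rewrite !mxE eqxx /= eq_sym; case: (_ == _).
case: (jump_irreducible hp 0 (delta_mx ord0 i)) => n; rewrite nstepE subr0 => h.
by apply: (sub n); rewrite gt_eqF.
Qed.

Definition dir (k : 'I_d) : Zd d := jumps`_(fullrankfun jump_mx_full k).

Lemma dir_jump k : dir k \in jumps.
Proof. exact/mem_nth/ltn_ord. Qed.

Lemma dir_free (a : 'I_d -> int) : \sum_k dir k *~ a k = 0 -> forall k, a k = 0.
Proof.
move=> a0; pose u : 'rV[rat]_d := \row_k (a k)%:~R.
suff u0 : u = 0.
  by move=> k; have /rowP/(_ k) := u0; rewrite !mxE => /eqP; rewrite intr_eq0 => /eqP.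
have uA := fullrowsub_unit jump_mx_full.
rewrite -[u](mulmxK uA) (_ : u *m _ = 0) ?mul0mx //.
rewrite mulmx_sum_row; apply/rowP => l.
have /rowP/(_ l) := a0; rewrite summxE [in RHS]mxE => al.
rewrite summxE [RHS]mxE -[RHS](mulr0z 1) -al rmorph_sum /=.
apply: eq_bigr => k _; rewrite !mxE.
by rewrite -[dir k *~ a k]scaler_int mxE intz rmorphM.
Qed.

Lemma zspan_dir (l : seq 'I_d) x : uniq l -> zspan [seq dir k | k <- l] x ->
  exists a : 'I_d -> int, (forall k, k \notin l -> a k = 0) /\ x = \sum_k dir k *~ a k.
Proof.
elim: l x => [|i l IH] x /=.
  by move=> _ ->; exists (fun=> 0); split => //; rewrite big1 // => k _; rewrite mulr0z.
move=> /andP[il ul] [r /(IH _ ul)[a [al xE]]].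
exists (fun k => a k + r * (k == i)%:R); split.
  by move=> k; rewrite inE negb_or => /andP[/negPf-> kl]; rewrite mulr0 addr0 al.
under eq_bigr do rewrite mulrzDr; rewrite big_split /= -xE (bigD1 i) //=.
rewrite eqxx mulr1 big1 ?addr0 ?subrK // => k /negPf ->.
by rewrite mulr0 mulr0z.
Qed.

Lemma zfree_dir (l : seq 'I_d) : uniq l -> zfree [seq dir k | k <- l].
Proof.
elim: l => //= i l IH /andP[il ul]; split; last exact: IH.
move=> r /(zspan_dir ul)[a [al e]].
suff /(_ i) : forall k, a k - r * (k == i)%:R = 0.
  by rewrite al // eqxx mulr1 sub0r => /eqP; rewrite oppr_eq0 => /eqP.
apply: dir_free; under eq_bigr do rewrite mulrzBr.
rewrite sumrB -e (bigD1 i) //= eqxx mulr1 big1 ?addr0 ?subrr // => k /negPf ->.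
by rewrite mulr0 mulr0z.
Qed.

(** Dividing by [2 d] leaves at least half of its mass to every jump once the [d]
simple walks have been split off ([rest_weight_ge]). *)
Definition dir_weight (k : 'I_d) : R := p 0 (dir k) / d.*2%:R.
Definition dir_steps := [seq (dir k, dir_weight k) | k <- enum 'I_d].
Definition rest_weight z : R := p 0 z -
  \sum_k dir_weight k / 2 * ((z == dir k)%:R + (z == - dir k)%:R).
Definition rest_steps := [seq (z, rest_weight z) | z <- jumps].

Lemma dir_weight_gt0 k : 0 < dir_weight k.
Proof.
rewrite divr_gt0 ?ltr0n ?double_gt0 ?(leq_ltn_trans _ (ltn_ord k)) //.
by rewrite lt0r jump_ge0 // andbT -jumpsP dir_jump.
Qed.

(** Each direction takes at most [p 0 z / (2 d)] from the jump [z], even where [z] is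
counted both as the direction and as its opposite. *)
Lemma rest_weight_ge z : z \in jumps -> p 0 z / 2 <= rest_weight z.
Proof.
move=> zj; rewrite /rest_weight lerBrDl -lerBrDr.
have [d0|d0] := posnP d.
  rewrite big1 ?subr_ge0; last by move=> k; exfalso; move: (ltn_ord k); lia.
  by have := jump_ge0 hp 0 z; lra.
apply: (@le_trans _ _ (\sum_(k < d) p 0 z / (d.*2)%:R)).
  apply: ler_sum => k _; rewrite /dir_weight.
  have [->|_] := eqVneq z (dir k).
    case: (_ == _); rewrite /= ?addr0 ?mulr1 -?[1 + 1]/2; first by rewrite mulfVK.
    by rewrite ler_pdivrMr // ler_peMr ?ler1n // divr_ge0 // jump_ge0.
  have [->|_] := eqVneq z (- dir k).
    rewrite /= add0r mulr1 p0_sym.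
    by rewrite ler_pdivrMr // ler_peMr ?ler1n // divr_ge0 // jump_ge0.
  by rewrite addr0 mulr0 divr_ge0 // jump_ge0.
rewrite sumr_const card_ord -mulr_natl -muln2 natrM; move: (p 0 z) => q.
rewrite le_eqVlt; apply/orP; left; apply/eqP; field.
by rewrite pnatr_eq0 -lt0n.
Qed.

Lemma rest_steps_ge0 : nonneg_steps rest_steps.
Proof.
move=> a /mapP[z zj ->] /=; apply: le_trans (rest_weight_ge zj).
by rewrite divr_ge0 // jump_ge0.
Qed.

Lemma rest_steps_mass : 0 < total_weight rest_steps.
Proof.
apply: (@lt_le_trans _ _ (total_weight steps / 2)); first by rewrite steps_mass; lra.
rewrite /total_weight !big_map mulr_suml big_seq [leRHS]big_seq.
by apply: ler_sum => z zj; exact: rest_weight_ge.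
Qed.

Lemma convol_dir_rest : convol (with_pm rest_steps dir_steps) = convol steps.
Proof.
apply/funext => h; apply/funext => z; rewrite convol_cat.
rewrite /convol !big_map big_flatten /= big_map big_map /= big_enum /=.
have pick (y : Zd d) : y \in jumps -> \sum_(v <- jumps) (v == y)%:R * h (z - v) = h (z - y).
  move=> yj; rewrite (bigD1_seq y) ?fset_uniq //= eqxx mul1r big1 ?addr0 // => v /negPf ->.
  by rewrite mul0r.
rewrite [X in _ + X = _](_ : _ = \sum_(v <- jumps)
    (\sum_k dir_weight k / 2 * ((v == dir k)%:R + (v == - dir k)%:R)) * h (z - v)).
  by rewrite -big_split /=; apply: eq_bigr => v _; rewrite -mulrDl subrK.
under [RHS]eq_bigr do rewrite mulr_suml.
rewrite exchange_big /=; apply: eq_bigr => k _.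
rewrite !big_cons big_nil /= addr0.
under [RHS]eq_bigr do rewrite -mulrA mulrDl mulrDr.
rewrite big_split /= -!mulr_sumr !pick ?dir_jump //.
by rewrite jumpsP p0_sym -jumpsP dir_jump.
Qed.

Lemma heat_bound : exists K : R, 0 <= K /\ forall n z,
  (iter n (convol steps) delta0 z) ^+ 2 <= K * (n`!%:R / (n + d)`!%:R).
Proof.
exists (\prod_(a <- dir_steps) a.2)^-1; split.
  by rewrite invr_ge0 big_map prodr_ge0 // => k _; rewrite ltW ?dir_weight_gt0.
move=> n z.
have dirs : [seq a.1 | a <- dir_steps] = [seq dir k | k <- enum 'I_d] by rewrite -map_comp.
rewrite -convol_dir_rest.
apply: le_trans (@heat_peel _ _ rest_steps dir_steps delta0 1 rest_steps_ge0
  rest_steps_mass _ _ _ _ _ n z) _; rewrite ?dirs.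
- by move=> a /mapP[k _ ->]; exact: dir_weight_gt0.
- exact/zfree_dir/enum_uniq.
- move=> x y; rewrite /delta0; have [->|_] := eqVneq x 0; last by rewrite eqxx.
  by have [-> //|_] := eqVneq y 0; rewrite eqxx.
- by move=> x; rewrite /delta0 ler0n.
- by move=> x; rewrite /delta0 lern1 leq_b1.
have -> : total_weight (with_pm rest_steps dir_steps) = 1.
  have := congr1 (fun F => F (fun=> 1) 0) convol_dir_rest.
  rewrite /convol; under eq_bigr do rewrite mulr1; rewrite -/(total_weight _) => ->.
  by under eq_bigr do rewrite mulr1; exact: steps_mass.
by rewrite !expr1n !mul1r size_map size_enum_ord mulrC.
Qed.

Lemma exp_series_le (x : R) m : 0 <= x -> \sum_(0 <= n < m) x ^+ n / n`!%:R <= expR x.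
Proof.
move=> x0; rewrite /expR; have := nondecreasing_cvgn_le _ (is_cvg_series_exp_coeff x) m.
apply; apply/nondecreasing_seqP => n; rewrite /series /= big_nat_recr //= lerDl.
by rewrite /exp_coeff divr_ge0 ?exprn_ge0.
Qed.

(** Poissonization.  With [A = N^d], the bound on the square of the [n]-step kernel [u]
is made linear by [2 u <= 1/A + A u^2].  The Poisson weight [T^n / n!] then meets
[n! / (n + d)!] and leaves [T^n / (n + d)!], which sums to [T^(-d) exp T] at most. *)
Lemma transition_le (t : R) : 0 < t -> exists K : R, 0 <= K /\ forall N i j, (0 < N)%N ->
  transition p (N%:R ^+ 2 * t) i j <= K / N%:R ^+ d.
Proof.
move=> t0; have [K [K0 hK]] := heat_bound.
exists ((1 + K / t ^+ d) / 2); split.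
  by rewrite divr_ge0 // addr_ge0 // divr_ge0 // exprn_ge0 // ltW.
move=> N i j N0; set T := N%:R ^+ 2 * t.
have Nd0 : 0 < N%:R ^+ d :> R by rewrite exprn_gt0 // ltr0n.
have T0 : 0 < T by rewrite mulr_gt0 // exprn_gt0 // ltr0n.
set u := fun n => iter n (convol steps) delta0 (j - i).
have u0 n : 0 <= u n.
  by apply: convol_ge0 => [|z]; [exact: steps_ge0 | rewrite /delta0 ler0n].
have ule n : u n <= ((N%:R ^+ d)^-1 + N%:R ^+ d * (K * (n`!%:R / (n + d)`!%:R))) / 2.
  apply: (@le_trans _ _ (((N%:R ^+ d)^-1 + N%:R ^+ d * u n ^+ 2) / 2)).
    rewrite ler_pdivlMr // -subr_ge0.
    have -> : (N%:R ^+ d)^-1 + N%:R ^+ d * u n ^+ 2 - u n * 2 =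
        (1 - N%:R ^+ d * u n) ^+ 2 / N%:R ^+ d by field; rewrite gt_eqF.
    by rewrite divr_ge0 ?sqr_ge0 // ltW.
  rewrite ler_pM2r // lerD2l ler_pM2l //; exact: hK.
set F := fun n => expR (- T) * T ^+ n / n`!%:R * nstep p n i j.
have FE n : F n = expR (- T) * T ^+ n / n`!%:R * u n by rewrite /F nstepE.
have F0 n : 0 <= F n.
  by rewrite FE !mulr_ge0 ?invr_ge0 ?expR_ge0 ?exprn_ge0 // ltW.
have bound m : series F m <= (1 + K / t ^+ d) / 2 / N%:R ^+ d.
  rewrite /series /=; apply: (@le_trans _ _ (expR (- T) * ((N%:R ^+ d)^-1 / 2) *
      (\sum_(0 <= n < m) T ^+ n / n`!%:R) + expR (- T) * (N%:R ^+ d * K / T ^+ d / 2) *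
      (\sum_(0 <= n < m) T ^+ (n + d) / (n + d)`!%:R))).
    rewrite !mulr_sumr -big_split /=; apply: ler_sum => n _; rewrite FE.
    apply: le_trans (ler_wpM2l _ (ule n)) _.
      by rewrite !mulr_ge0 ?invr_ge0 ?expR_ge0 ?exprn_ge0 // ltW.
    rewrite le_eqVlt; apply/orP; left; apply/eqP; rewrite exprD; field.
    by rewrite !gt_eqF ?exprn_gt0 ?ltr0n ?fact_gt0.
  have e1 : expR (- T) * expR T = 1 by rewrite -expRD addNr expR0.
  have h1 := exp_series_le m (ltW T0).
  have h2 : \sum_(0 <= n < m) T ^+ (n + d) / (n + d)`!%:R <= expR T.
    apply: le_trans (exp_series_le (m + d) (ltW T0)).
    rewrite [leRHS](big_cat_nat (n := d)) ?leq_addl //=.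
    rewrite -[X in _ <= _ + \sum_(X <= _ < _) _]add0n big_addn addnK lerDr.
    by apply: sumr_ge0 => n _; rewrite divr_ge0 ?exprn_ge0 // ltW.
  apply: le_trans (lerD (ler_wpM2l _ h1) (ler_wpM2l _ h2)) _.
  - by rewrite !mulr_ge0 ?expR_ge0 ?invr_ge0 // ltW.
  - by rewrite !mulr_ge0 ?expR_ge0 ?invr_ge0 ?exprn_ge0 // ltW.
  have e2 y : expR (- T) * y * expR T = y by rewrite mulrAC e1 mul1r.
  rewrite !e2.
  have -> : T ^+ d = N%:R ^+ d * N%:R ^+ d * t ^+ d by rewrite exprMn expr2 exprMn.
  rewrite le_eqVlt; apply/orP; left; apply/eqP; field.
  by rewrite !gt_eqF ?exprn_gt0 ?ltr0n.
have mono : {homo series F : n m / (n <= m)%N >-> n <= m}.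
  by apply/nondecreasing_seqP => n; rewrite /series /= big_nat_recr //= lerDl F0.
apply: limr_le; last by apply: nearW.
apply: nondecreasing_is_cvgn => //.
by exists ((1 + K / t ^+ d) / 2 / N%:R ^+ d) => _ [m _ <-].
Qed.

End HeatKernel.

(** * Charlier duals indexed by lists of sites *)

Section Charlier.
Variables (R : realType) (sg : R).
Hypothesis sg0 : sg != 0.

Lemma charlier0 n : charlier sg 0 n = 1.
Proof. by rewrite /charlier big_ord1 bin0 expr0 invr1 ffactn0 !mulr1. Qed.

(** Adding one particle to the index; [charlier_diff] adds one to the configuration.
The two rules are exchanged by the Mecke formula, and all the computations with
duals below are made of them. *)
Lemma charlierS k n : charlier sg k.+1 n = charlier sg k n - n%:R / sg * charlier sg k n.-1.
Proof.
rewrite /charlier; under eq_bigr do rewrite -mulrA.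
rewrite -(sum_pascal (fun j => (- sg) ^- j * (n ^_ j)%:R)) mulr_sumr -sumrB.
apply: eq_bigr => j _; rewrite ffactnS natrM exprS.
have : (- sg) ^+ j != 0 by rewrite expf_neq0 // oppr_eq0.
by move: ((- sg) ^+ j) => a a0; field; rewrite sg0 a0.
Qed.

Lemma charlier_diff k n :
  charlier sg k n.+1 = charlier sg k n - k%:R / sg * charlier sg k.-1 n.
Proof.
elim: k n => [|k IH] n; first by rewrite !charlier0 mul0r mul0r subr0.
rewrite !charlierS /= IH; case: n => [|n] /=.
  rewrite mul0r mul0r subr0; case: k IH => [|k] IH; first by rewrite !charlier0; field.
  have := charlierS k 0; rewrite mul0r mul0r subr0 => e.
  by rewrite e /= -[k.+2%:R]natr1; field.
case: k IH => [|k] IH /=; first by rewrite !charlier0 -(natr1 n.+1); field.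
have e1 := IH n; rewrite /= in e1.
have e2 : charlier sg k n.+1 = charlier sg k.+1 n.+1 + n.+1%:R / sg * charlier sg k n.
  by rewrite charlierS /= subrK.
rewrite e2 e1 -(natr1 n.+1) -(natr1 k.+1); move: (n.+1%:R) (k.+1%:R) => a b.
by field.
Qed.

End Charlier.

Section DualList.
Variables (R : realType) (I : eqType).
Implicit Types (s r : seq I) (eta : I -> nat) (sg : R).

Definition add_particle eta y : I -> nat := fun x => (eta x + (x == y))%N.
Definition remove_particle eta y : I -> nat := fun x => (eta x - (x == y))%N.

Lemma add_particleK eta y : remove_particle (add_particle eta y) y = eta.
Proof. by apply/funext => x; rewrite /remove_particle /add_particle addnK. Qed.

(** The dual particles are given by the list of their positions, so that they can be
added and removed one at a time.  The value depends on the list up to permutation. *)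
Definition list_dual sg s eta : R := \prod_(x <- undup s) charlier sg (count_mem x s) (eta x).

Lemma list_dual_nil sg eta : list_dual sg [::] eta = 1.
Proof. by rewrite /list_dual big_nil. Qed.

Lemma list_dualE sg s r eta : uniq r -> {subset s <= r} ->
  list_dual sg s eta = \prod_(x <- r) charlier sg (count_mem x s) (eta x).
Proof.
move=> ur sr; rewrite [RHS](bigID (mem s)) /= [X in _ * X]big1 ?mulr1; last first.
  by move=> x /count_memPn ->; rewrite charlier0.
rewrite /list_dual -[RHS]big_filter; apply: perm_big; apply: uniq_perm.
- exact: undup_uniq.
- exact: filter_uniq.
by move=> x; rewrite mem_undup mem_filter andb_idr // => /sr.
Qed.

Lemma list_dual_perm sg s s' eta : perm_eq s s' -> list_dual sg s eta = list_dual sg s' eta.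
Proof.
move=> ss; rewrite (@list_dualE sg s (undup s')) ?undup_uniq //.
  by apply: eq_bigr => x _; have /permP -> := ss.
by move=> x; rewrite mem_undup (perm_mem ss).
Qed.

Lemma list_dual_cons sg x s eta : sg != 0 ->
  list_dual sg (x :: s) eta = list_dual sg s eta - (eta x)%:R / sg * list_dual sg s (remove_particle eta x).
Proof.
move=> sg0; set r := undup (x :: s).
have ur : uniq r by rewrite undup_uniq.
have xr : x \in r by rewrite mem_undup mem_head.
have sub1 : {subset x :: s <= r} by move=> y; rewrite mem_undup.
have sub2 : {subset s <= r} by move=> y ys; rewrite mem_undup inE ys orbT.
rewrite (list_dualE _ _ ur sub1) !(list_dualE _ _ ur sub2) !(bigD1_seq x xr ur) /=.
rewrite eqxx add1n charlierS // /remove_particle eqxx subn1.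
have -> : \prod_(i <- r | i != x) charlier sg ((x == i) + count_mem i s) (eta i) =
          \prod_(i <- r | i != x) charlier sg (count_mem i s) (eta i).
  by apply: eq_bigr => i /negPf; rewrite eq_sym => ->.
have -> : \prod_(i <- r | i != x) charlier sg (count_mem i s) (eta i - (i == x)) =
          \prod_(i <- r | i != x) charlier sg (count_mem i s) (eta i).
  by apply: eq_bigr => i /negPf ->; rewrite subn0.
by ring.
Qed.

Lemma list_dual_add_particle sg s eta y : sg != 0 -> list_dual sg s (add_particle eta y) =
  list_dual sg s eta - (count_mem y s)%:R / sg * list_dual sg (rem y s) eta.
Proof.
move=> sg0; have [ys|/count_memPn y0] := boolP (y \in s); last first.
  rewrite y0 mul0r mul0r subr0; apply: eq_big_seq => x; rewrite mem_undup => xs.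
  rewrite /add_particle; case: eqP => [xy|_]; last by rewrite addn0.
  by move: xs; rewrite xy => /count_memPn; rewrite y0.
set r := undup s.
have ur : uniq r by rewrite undup_uniq.
have yr : y \in r by rewrite mem_undup.
have sub1 : {subset s <= r} by move=> x; rewrite mem_undup.
have sub2 : {subset rem y s <= r} by move=> x xs; rewrite mem_undup (mem_rem xs).
rewrite (list_dualE _ _ ur sub2) !(list_dualE _ _ ur sub1) !(bigD1_seq y yr ur) /=.
rewrite /add_particle eqxx addn1 charlier_diff //.
have cnt x : count_mem x (rem y s) = (count_mem x s - (x == y))%N.
  have /permP/(_ (pred1 x)) := perm_to_rem ys => ->.
  by rewrite /= eq_sym addKn.
have -> : \prod_(i <- r | i != y) charlier sg (count_mem i s) (eta i + (i == y)) =
          \prod_(i <- r | i != y) charlier sg (count_mem i s) (eta i).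
  by apply: eq_bigr => i /negPf ->; rewrite addn0.
have -> : \prod_(i <- r | i != y) charlier sg (count_mem i (rem y s)) (eta i) =
          \prod_(i <- r | i != y) charlier sg (count_mem i s) (eta i).
  by apply: eq_bigr => i /negPf iy; rewrite cnt iy subn0.
by rewrite cnt eqxx subn1; ring.
Qed.

Definition local_on (A : Type) (J : seq I) (H : (I -> nat) -> A) :=
  forall m m', {in J, m =1 m'} -> H m = H m'.

Lemma list_dual_local sg s : local_on s (list_dual sg s).
Proof. by move=> m m' mm; apply: eq_big_seq => x; rewrite mem_undup => /mm ->. Qed.

End DualList.

(** * Measurability on the space of configurations *)

Section CountableFibers.
Context disp (T : measurableType disp) (K : Type) (C : countType).
Variable Y : K -> T -> C.
Hypothesis mY : forall k c, measurable [set w | Y k w = c].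

Lemma measurable_map_fiber (L : seq K) (c : seq C) :
  measurable [set w | [seq Y k w | k <- L] = c].
Proof.
elim: L c => [|k L IH] [|y c] /=.
- by rewrite (_ : mkset _ = setT) //; apply/seteqP; split.
- by rewrite (_ : mkset _ = set0) //; apply/seteqP; split.
- by rewrite (_ : mkset _ = set0) //; apply/seteqP; split.
rewrite (_ : mkset _ = [set w | Y k w = y] `&` [set w | [seq Y k w | k <- L] = c]).
  exact: measurableI.
by apply/seteqP; split => w /= => [[-> ->]|[-> ->]].
Qed.

Lemma measurable_map disp' (S : measurableType disp') (L : seq K) (G : seq C -> S) :
  measurable_fun [set: T] (fun w => G [seq Y k w | k <- L]).
Proof.
move=> _ B mB; rewrite setTI.
rewrite (_ : _ @^-1` B = \bigcup_c
    (if `[< B (G c) >] then [set w | [seq Y k w | k <- L] = c] else set0)).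
  apply: countable_bigcupT_measurable => [|c]; first exact: countableP.
  by case: asboolP => // _; exact: measurable_map_fiber.
apply/seteqP; split => w /=.
  by move=> Bw; exists [seq Y k w | k <- L] => //=; case: asboolP.
by move=> [c _]; case: asboolP => //= Bc ->.
Qed.

End CountableFibers.

Section Cylinders.
Variables (R : realType) (d : nat).

Lemma measurable_site (x : Zd d) n : measurable [set eta : Omega d | eta x = n].
Proof. by apply: sub_gen_smallest; exists x, n. Qed.

Lemma measurable_to_Omega disp (T : measurableType disp) (f : T -> Omega d) :
  (forall x n, measurable [set w | f w x = n]) -> measurable_fun [set: T] f.
Proof.
move=> fm; apply: (@measurability _ _ T (Omega d) setT f (@cylinders d)) => // _ [_ [x [n ->]] <-].
by rewrite setTI; exact: fm.
Qed.

Lemma measurable_sites disp (T : measurableType disp) (f : T -> Omega d)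
    (J : seq (Zd d)) (c : Zd d -> nat) :
  measurable_fun [set: T] f -> measurable [set w | {in J, f w =1 c}].
Proof.
move=> mf; elim: J => [|x J IH].
  by rewrite (_ : mkset _ = setT) //; apply/seteqP; split.
rewrite (_ : mkset _ = [set w | f w x = c x] `&` [set w | {in J, f w =1 c}]).
  apply: measurableI => //; rewrite -[X in measurable X]setTI.
  exact: (mf _ [set eta : Omega d | eta x = c x] (measurable_site x (c x))).
apply/seteqP; split => w /= h.
  by split=> [|y yJ]; apply: h; rewrite inE ?eqxx ?yJ ?orbT.
by move=> y; rewrite inE => /predU1P[->|]; [exact: h.1 | exact: h.2].
Qed.

Lemma measurable_values disp (T : measurableType disp) (f : T -> Omega d)
    (J : seq (Zd d)) (c : seq nat) :
  measurable_fun [set: T] f -> measurable [set w | map (f w) J = c].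
Proof.
move=> mf; apply: (@measurable_map_fiber _ T (Zd d) nat (fun x w => f w x)) => x n.
rewrite -[X in measurable X]setTI.
exact: (mf _ [set eta : Omega d | eta x = n] (measurable_site x n)).
Qed.

(** The restriction of a configuration to [J] takes countably many values. *)
Lemma measurable_local disp (T : measurableType disp) disp' (S : measurableType disp')
    (f : T -> Omega d) (J : seq (Zd d)) (H : Omega d -> S) :
  measurable_fun [set: T] f -> local_on J H -> measurable_fun [set: T] (H \o f).
Proof.
move=> mf Hl.
rewrite (_ : _ \o _ = fun w => H (fun y => nth 0%N (map (fun x => f w x) J) (index y J))).
  apply: (@measurable_map _ T (Zd d) nat (fun x w => f w x) _ _ S J
    (fun c => H (fun y => nth 0%N c (index y J)))) => x n.
  rewrite -[X in measurable X]setTI.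
  exact: (mf _ [set eta : Omega d | eta x = n] (measurable_site x n)).
apply/funext => w; apply: Hl => y yJ.
by rewrite (nth_map y) ?index_mem // nth_index.
Qed.

Lemma measurable_add_particle (x : Zd d) :
  measurable_fun [set: Omega d] (fun eta : Omega d => add_particle eta x : Omega d).
Proof.
apply: measurable_to_Omega => y n.
have := @measurable_local _ _ _ _ _ [:: y] (fun eta => (eta y + (y == x))%N)
  (@measurable_id _ (Omega d) setT) _.
move=> /(_ _ measurableT [set n] I); rewrite setTI; apply.
by move=> m m' /(_ y); rewrite mem_head => ->.
Qed.

Lemma measurable_remove_particle (x : Zd d) :
  measurable_fun [set: Omega d] (fun eta : Omega d => remove_particle eta x : Omega d).
Proof.
apply: measurable_to_Omega => y n.
have := @measurable_local _ _ _ _ _ [:: y] (fun eta => (eta y - (y == x))%N)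
  (@measurable_id _ (Omega d) setT) _.
move=> /(_ _ measurableT [set n] I); rewrite setTI; apply.
by move=> m m' /(_ y); rewrite mem_head => ->.
Qed.

Lemma measurable_tau (x : Zd d) : measurable_fun [set: Omega d] (tau x).
Proof. by apply: measurable_to_Omega => y n; exact: measurable_site. Qed.

(** The cylinders and the empty set form a family that is stable under intersection
and generates the sigma-algebra. *)
Lemma Omega_measure_unique (m1 m2 : {measure set (Omega d) -> \bar R}) :
  (forall (J : {fset Zd d}) c, m1 [set eta : Omega d | {in J, eta =1 c}] = m2 [set eta : Omega d | {in J, eta =1 c}]) ->
  (m1 setT < +oo)%E ->
  forall A : set (Omega d), measurable A -> m1 A = m2 A.
Proof.
move=> m12 fin.
pose G : set (set (Omega d)) :=
  [set A | A = set0 \/ exists (J : {fset Zd d}) c, A = [set eta : Omega d | {in J, eta =1 c}]].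
have GT : G setT by right; exists fset0, (fun=> 0%N); apply/seteqP; split.
have mG : @measurable _ (Omega d) = <<s G >>.
  apply/seteqP; split.
    apply: smallest_sub; first exact: smallest_sigma_algebra.
    move=> _ [x [n ->]]; apply: sub_gen_smallest; right.
    exists [fset x]%fset, (fun=> n); apply/seteqP; split => eta /=.
      by move=> e y; rewrite inE => /eqP ->.
    by apply; rewrite inE.
  apply: smallest_sub; first exact: sigma_algebra_measurable.
  move=> A [->|[J [c ->]]]; first exact: measurable0.
  exact: (measurable_sites _ _ (@measurable_id _ (Omega d) setT)).
apply: (measure_unique G (fun=> setT) mG) => //.
- move=> A B [->|[J [c ->]]]; first by left; rewrite set0I.
  move=> [->|[J' [c' ->]]]; first by left; rewrite setI0.
  have [cc'|ncc'] := pselect (forall x, x \in J -> x \in J' -> c x = c' x).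
    right; exists (J `|` J')%fset, (fun x => if x \in J then c x else c' x).
    apply/seteqP; split => eta /=.
      move=> [h h'] x; rewrite inE => /orP[xJ|xJ']; first by rewrite xJ h.
      by case: ifPn => xJ; [rewrite h | rewrite h'].
    move=> h; split => x xJ; have := h x; rewrite inE xJ ?orbT; first exact.
    by move=> /(_ isT) ->; case: ifPn => // xJJ; rewrite cc'.
  left; apply/seteqP; split => eta //= -[h h']; apply: ncc' => x xJ xJ'.
  by rewrite -h // -h'.
- by rewrite bigcup_const.
- by move=> A [->|[J [c ->]]]; [rewrite !measure0 | exact: m12].
Qed.

End Cylinders.

(** The pushforward, with the structure of measure that it owes to [mf]. *)
Definition image_measure d d' (T1 : measurableType d) (T2 : measurableType d')
    (R : realFieldType) (m : {measure set T1 -> \bar R}) (f : T1 -> T2)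
    (mf : measurable_fun [set: T1] f) : {measure set T2 -> \bar R} :=
  measure_function_pushforward__canonical__measure_function_Measure m mf.

(** * The Mecke formula for the Poisson product measure *)

Section Mecke.
Variables (R : realType) (d : nat) (rho : R).
Hypothesis hrho : 0 < rho.
Variable nu : probability (Omega d) R.
Hypothesis hnu : poisson_product rho nu.

Lemma poisson_unique (mu : {measure set (Omega d) -> \bar R}) :
  (forall (J : {fset Zd d}) n, mu [set eta | forall x, x \in J -> eta x = n x] =
     (\prod_(x <- J) poisson_pmf rho (n x))%:E) ->
  forall A : set (Omega d), measurable A -> mu A = nu A.
Proof.
move=> hmu; apply: Omega_measure_unique => [J c|].
  exact: (etrans (hmu J c) (esym (hnu J c))).
rewrite (_ : setT = [set eta | forall x, x \in fset0 -> eta x = 0%N]).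
  by rewrite hmu ltry.
by apply/seteqP; split.
Qed.

Lemma poisson_pmfS n : n.+1%:R * poisson_pmf rho n.+1 = rho * poisson_pmf rho n.
Proof.
rewrite /poisson_pmf hrho factS natrM exprS.
have : n.+1%:R != 0 :> R by rewrite pnatr_eq0.
have : n`!%:R != 0 :> R by rewrite pnatr_eq0 -lt0n fact_gt0.
by move: (n`!%:R) (n.+1%:R) => a b a0 b0; field; rewrite a0 b0.
Qed.

(** On a cylinder this is [poisson_pmfS] at the site [x]; both sides are finite
measures in [A]. *)
Lemma mecke_set x n (A : set (Omega d)) : measurable A ->
  A `<=` [set eta : Omega d | eta x = n.+1] ->
  (n.+1%:R%:E * nu A = rho%:E * nu ((fun eta : Omega d => add_particle eta x : Omega d) @^-1` A))%E.
Proof.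
move=> mA AD; pose ad := fun eta : Omega d => add_particle eta x : Omega d.
have mad : measurable_fun setT ad := measurable_add_particle x.
have mD := measurable_site x n.+1.
pose m1 : {measure set (Omega d) -> \bar R} := mscale (NngNum (ler0n R n.+1)) (mrestr nu mD).
pose m2 : {measure set (Omega d) -> \bar R} :=
  mscale (NngNum (ltW hrho)) (mrestr (image_measure nu mad) mD).
have m1E B : m1 B = (n.+1%:R%:E * nu (B `&` [set eta : Omega d | eta x = n.+1]))%E by [].
have m2E B : m2 B = (rho%:E * nu (ad @^-1` (B `&` [set eta : Omega d | eta x = n.+1])))%E by [].
have := @Omega_measure_unique R d m1 m2; rewrite m1E => /(_ _ _ A mA).
rewrite m1E m2E (setIidl AD); apply; last first.
  rewrite setTI -(fineK (fin_num_measure nu _ mD)) -EFinM ltry //.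
move=> J c; rewrite m1E m2E.
have [[xJ cx]|ok] := pselect (x \in J /\ c x <> n.+1).
  rewrite (_ : _ `&` _ = set0) ?preimage_set0 ?measure0 ?mule0 //.
  by apply/seteqP; split => eta //= -[/(_ x xJ) -> ].
have cJ y : y \in J -> (if y == x then n.+1 else c y) = c y.
  move=> yJ; case: eqP => // yx; apply: contrapT => ne; apply: ok; rewrite -yx.
  by split => // e; apply: ne; rewrite e.
rewrite (_ : _ `&` _ = [set eta : Omega d | forall y, y \in (x |` J)%fset ->
   eta y = if y == x then n.+1 else c y]); last first.
  apply/seteqP; split => eta /=.
    move=> [h ex] y; rewrite !inE => /orP[/eqP->|yJ]; first by rewrite eqxx.
    by rewrite cJ // h.
  move=> h; split => [y yJ|]; first by rewrite -cJ // h // !inE yJ orbT.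
  by have := h x; rewrite !inE eqxx; exact.
rewrite (_ : ad @^-1` _ = [set eta : Omega d | forall y, y \in (x |` J)%fset ->
   eta y = if y == x then n else c y]); last first.
  apply/seteqP; split => eta /= h y yJ; have := h y yJ; rewrite /ad /add_particle.
    by case: eqP => [_ /eqP|_]; rewrite ?addn1 ?addn0 // eqSS => /eqP.
  by case: eqP => [_|_] ->; rewrite ?addn1 ?addn0.
rewrite (hnu _ (fun y => if y == x then n.+1 else c y)).
rewrite (hnu _ (fun y => if y == x then n else c y)) -!EFinM; congr EFin.
rewrite (big_fsetD1 x) ?fset1U1 //= [in RHS](big_fsetD1 x) ?fset1U1 //=.
rewrite eqxx !mulrA poisson_pmfS; congr (_ * _).
by apply: eq_big_seq => y; rewrite !inE => /andP[/negPf-> _].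
Qed.

Lemma mecke_level x n (F : Omega d -> \bar R) :
  measurable_fun [set: Omega d] F -> (forall eta, (0 <= F eta)%E) ->
  (n.+1%:R%:E * \int[nu]_(eta in [set eta : Omega d | eta x = n.+1]) F eta =
   rho%:E * \int[nu]_(eta in [set eta : Omega d | eta x = n]) F (add_particle eta x))%E.
Proof.
move=> mF F0; pose ad := fun eta : Omega d => add_particle eta x : Omega d.
have mad : measurable_fun setT ad := measurable_add_particle x.
have mD := measurable_site x n.+1.
have mFD : measurable_fun [set eta : Omega d | eta x = n.+1] F by exact: measurable_funS mF.
rewrite -(ge0_integral_mscale nu mD (NngNum (ler0n R n.+1)) mFD) //.
rewrite (eq_measure_integral (mscale (NngNum (ltW hrho)) (image_measure nu mad))).
  rewrite ge0_integral_mscale //= ge0_integral_pushforward //.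
  congr (_ * integral _ _ _)%E; apply/seteqP; split => eta /=; rewrite /ad /add_particle eqxx addn1.
    by move=> -[].
  by move=> ->.
by move=> A mA AD; exact: mecke_set.
Qed.

(** The level [eta x = n + 1] on the left corresponds to the level [eta x = n] on the
right. *)
Lemma mecke x (F : Omega d -> \bar R) :
  measurable_fun [set: Omega d] F -> (forall eta, (0 <= F eta)%E) ->
  (\int[nu]_eta ((eta x)%:R%:E * F eta) = rho%:E * \int[nu]_eta F (add_particle eta x))%E.
Proof.
move=> mF F0.
have cover : \bigcup_n [set eta : Omega d | eta x = n] = setT.
  by apply/seteqP; split => // eta _; exists (eta x).
have triv : trivIset setT (fun n => [set eta : Omega d | eta x = n]).
  by move=> i j _ _ [eta /= []] -> ->.
have mx : measurable_fun [set: Omega d] (fun eta : Omega d => (eta x)%:R%:E : \bar R).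
  apply: (@measurable_local _ _ _ _ _ id [:: x] (fun eta : Omega d => (eta x)%:R%:E : \bar R)) => //.
  by move=> m m' /(_ x); rewrite mem_head => ->.
have mxF : measurable_fun [set: Omega d] (fun eta : Omega d => (eta x)%:R%:E * F eta)%E.
  exact: emeasurable_funM.
have mFa : measurable_fun [set: Omega d] (fun eta : Omega d => F (add_particle eta x)).
  exact: (measurableT_comp mF (measurable_add_particle x)).
have xF0 (eta : Omega d) : (0 <= (eta x)%:R%:E * F eta)%E by rewrite mule_ge0 // lee_fin ler0n.
rewrite -cover !ge0_integral_bigcup ?cover //; try by move=> n; exact: measurable_site.
rewrite -nneseriesZl; last by move=> n _; apply: integral_ge0 => eta _.
rewrite nneseries_recl //; last by move=> n _; apply: integral_ge0 => eta _.
rewrite integral0_eq ?add0e; last by move=> eta /= ->; rewrite mul0e.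
rewrite -nneseries_addn //; last by move=> n; apply: integral_ge0 => eta _.
apply: eq_eseriesr => n _; rewrite addn1 -mecke_level //.
rewrite -ge0_integralZl //; first by apply: eq_integral => eta; rewrite inE /= => ->.
- exact: measurable_site.
- exact: measurable_funS mF.
Qed.

End Mecke.

(** * Image laws and orthogonality of the duals *)

Lemma integrable_subZ (disp : measure_display) (T : measurableType disp) (R : realType)
    (mu : {measure set T -> \bar R}) (f g : T -> R) (a : R) :
  mu.-integrable [set: T] (EFin \o f) -> mu.-integrable [set: T] (EFin \o g) ->
  mu.-integrable [set: T] (EFin \o (fun x => f x - a * g x)).
Proof.
move=> fi gi; have -> : EFin \o (fun x => f x - a * g x) =
    ((EFin \o f) \- (fun x => a%:E * (EFin \o g) x))%E by [].
by apply: integrableB => //; apply: integrableZl.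
Qed.

Lemma Rintegral_subZ (disp : measure_display) (T : measurableType disp) (R : realType)
    (mu : {measure set T -> \bar R}) (f g : T -> R) (a : R) :
  mu.-integrable [set: T] (EFin \o f) -> mu.-integrable [set: T] (EFin \o g) ->
  \int[mu]_x (f x - a * g x) = \int[mu]_x f x - a * \int[mu]_x g x.
Proof.
move=> fi gi; rewrite RintegralB //; last exact: (integrableZl _ _ gi).
by rewrite RintegralZl.
Qed.

Section Law.
Variables (R : realType) (d : nat) (disp : measure_display) (T : measurableType disp).
Variables (P : {measure set T -> \bar R}) (nu : {measure set (Omega d) -> \bar R}).
Variable phi : T -> Omega d.
Hypothesis mphi : measurable_fun [set: T] phi.
Hypothesis law : forall A, measurable A -> P (phi @^-1` A) = nu A.

Lemma ge0_integral_law (F : Omega d -> \bar R) :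
  measurable_fun [set: Omega d] F -> (forall eta, 0 <= F eta)%E ->
  (\int[P]_w F (phi w) = \int[nu]_eta F eta)%E.
Proof.
move=> mF F0; rewrite [RHS](eq_measure_integral (image_measure P mphi)).
  rewrite (ge0_integral_pushforward mphi) //.
by move=> A mA _; rewrite /= /pushforward law.
Qed.

Lemma integral_law (F : Omega d -> \bar R) :
  measurable_fun [set: Omega d] F -> (\int[P]_w F (phi w) = \int[nu]_eta F eta)%E.
Proof.
move=> mF; rewrite integralE [RHS]integralE.
rewrite (_ : (fun w => F (phi w)) = F \o phi) // funepos_comp funeneg_comp.
by rewrite -!ge0_integral_law //; [exact: measurable_funeneg | exact: measurable_funepos].
Qed.

Lemma Rintegral_law (F : Omega d -> R) :
  measurable_fun [set: Omega d] F -> \int[P]_w F (phi w) = \int[nu]_eta F eta.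
Proof.
by move=> mF; rewrite /Rintegral (integral_law (F := EFin \o F)) //; exact/measurable_EFinP.
Qed.

Lemma integrable_law (F : Omega d -> R) :
  nu.-integrable [set: Omega d] (EFin \o F) -> P.-integrable [set: T] (EFin \o (F \o phi)).
Proof.
move=> /integrableP[mF iF]; apply/integrableP; split.
  exact: (measurableT_comp mF mphi).
rewrite (@ge0_integral_law (fun eta => `|(F eta)%:E|)%E) //.
by apply: measurableT_comp => //; exact: mF.
Qed.

End Law.

Section DualMoments.
Variables (R : realType) (d : nat) (rho : R).
Hypothesis hrho : 0 < rho.
Variable nu : probability (Omega d) R.
Hypothesis hnu : poisson_product rho nu.

Lemma measurable_site_fun (A : nat -> R) (x : Zd d) :
  measurable_fun [set: Omega d] (fun eta : Omega d => A (eta x)).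
Proof.
apply: (@measurable_local _ _ _ _ _ id [:: x] (fun eta : Omega d => A (eta x))) => //.
by move=> m m' /(_ x); rewrite mem_head => ->.
Qed.

(** The form used for polynomials: the particle is removed on the left instead of
being added on the right.  Where [eta x = 0]
the removal is truncated, but the factor [eta x] vanishes. *)
Lemma mecke_int x (F : Omega d -> R) :
  nu.-integrable [set: Omega d] (EFin \o F) ->
  nu.-integrable [set: Omega d] (EFin \o (fun eta => (eta x)%:R * F (remove_particle eta x))) /\
  \int[nu]_eta ((eta x)%:R * F (remove_particle eta x)) = rho * \int[nu]_eta F eta.
Proof.
move=> iF; have /integrableP[mF iF'] := iF.
have msF : measurable_fun [set: Omega d] (fun eta : Omega d => (F (remove_particle eta x))%:E).
  exact: (measurableT_comp mF (measurable_remove_particle x)).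
have meckeS (G : Omega d -> \bar R) : measurable_fun [set: Omega d] G ->
    (forall eta, (0 <= G eta)%E) ->
    (\int[nu]_eta ((eta x)%:R%:E * G (remove_particle eta x)) = rho%:E * \int[nu]_eta G eta)%E.
  move=> mG G0; rewrite (mecke hrho hnu x (F := fun eta => G (remove_particle eta x))) //.
    by congr (_ * _)%E; apply: eq_integral => eta _; rewrite add_particleK.
  exact: (measurableT_comp mG (measurable_remove_particle x)).
split.
  apply/integrableP; split.
    apply/measurable_EFinP; apply: measurable_funM; first exact: (measurable_site_fun (fun n => n%:R)).
    exact/measurable_EFinP.
  under eq_integral do rewrite /= normrM normr_nat EFinM.
  rewrite (meckeS (fun eta => `|(F eta)%:E|)%E) //; last exact: measurableT_comp.
  by rewrite lte_mul_pinfty // lee_fin ltW.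
rewrite /Rintegral -[rho]/(fine rho%:E) -fineM //; last exact: integrable_fin_num.
congr fine; rewrite integralE [in RHS]integralE muleBr //; last first.
  exact: integrable_add_def.
have pos a (b : R) : 0 <= a -> (maxe (a * b)%:E 0 = a%:E * maxe b%:E 0)%E.
  by move=> a0; rewrite -!EFin_max -EFinM maxr_pMr // mulr0.
rewrite -!meckeS; try exact: measurable_funepos; try exact: measurable_funeneg; try by [].
congr (_ - _)%E; apply: eq_integral => eta _.
  by rewrite !funeposE pos.
by rewrite !funenegE -!EFinN -mulrN pos.
Qed.

Variable sg : R.
Hypothesis sg0 : sg != 0.

Lemma measurable_list_dual s : measurable_fun [set: Omega d] (list_dual sg s : Omega d -> R).
Proof. exact: (@measurable_local _ _ _ _ _ id s (list_dual sg s : Omega d -> R) _ (@list_dual_local _ _ sg s)). Qed.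

Lemma list_dual_mecke x s s' (eta : Omega d) :
  list_dual sg (x :: s) eta * list_dual sg s' eta = list_dual sg s eta * list_dual sg s' eta -
  sg^-1 * ((eta x)%:R * (list_dual sg s (remove_particle eta x) *
    list_dual sg s' (add_particle (remove_particle eta x) x))).
Proof.
rewrite list_dual_cons //; have [->|x0] := eqVneq (eta x) 0%N; first by rewrite !mul0r mulr0 !subr0.
have -> : add_particle (remove_particle eta x) x = eta.
  apply/funext => y; rewrite /add_particle /remove_particle; case: eqP => [->|_]; last by rewrite subn0 addn0.
  by rewrite subnK // lt0n.
ring.
Qed.

(** The left index is built one particle at a time, as in [dual_ip_cons] below: each
step only involves pairs whose left index is shorter. *)
Lemma dual_pair_integrable s s' :
  nu.-integrable [set: Omega d] (EFin \o (fun eta => list_dual sg s eta * list_dual sg s' eta)).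
Proof.
pose D u v := nu.-integrable [set: Omega d] (EFin \o (fun eta => list_dual sg u eta * list_dual sg v eta)).
have step x u v : D u v -> D u (rem x v) -> D (x :: u) v.
  move=> uv uxv.
  have iF : nu.-integrable [set: Omega d]
      (EFin \o (fun eta => list_dual sg u eta * list_dual sg v (add_particle eta x))).
    have -> : (fun eta => list_dual sg u eta * list_dual sg v (add_particle eta x)) =
        (fun eta => list_dual sg u eta * list_dual sg v eta -
        ((count_mem x v)%:R / sg) * (list_dual sg u eta * list_dual sg (rem x v) eta)).
      by apply/funext => eta; rewrite list_dual_add_particle //; ring.
    exact: integrable_subZ.
  have [iM _] := mecke_int x iF.
  rewrite /D (_ : (fun eta => _) = (fun eta => list_dual sg u eta * list_dual sg v eta -
     sg^-1 * ((eta x)%:R * (list_dual sg u (remove_particle eta x) *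
       list_dual sg v (add_particle (remove_particle eta x) x))))).
    exact: integrable_subZ.
  by apply/funext => eta; rewrite list_dual_mecke.
have sym u v : D u v -> D v u.
  by rewrite /D (_ : (fun eta => _) = (fun eta => list_dual sg v eta * list_dual sg u eta)) //;
    apply/funext => eta; rewrite mulrC.
have D0 u : D u [::].
  elim: u => [|x u IH]; last exact: step.
  rewrite /D (_ : _ \o _ = cst 1%E); first exact: finite_measure_integrable_cst.
  by apply/funext => eta; rewrite /= list_dual_nil mulr1.
rewrite -/(D s s'); elim: s s' => [|x s IH] s'; first exact/sym/D0.
by apply: step; exact: IH.
Qed.

Definition dual_ip s s' : R := \int[nu]_eta (list_dual sg s eta * list_dual sg s' eta).

Lemma dual_ipC s s' : dual_ip s s' = dual_ip s' s.
Proof. by apply: eq_Rintegral => eta _; rewrite mulrC. Qed.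

End DualMoments.

Section DualOrthogonal.
Variables (R : realType) (d : nat) (rho : R).
Hypothesis hrho : 0 < rho.
Variable nu : probability (Omega d) R.
Hypothesis hnu : poisson_product rho nu.

Let rho0 : rho != 0. Proof. by rewrite gt_eqF. Qed.
Local Notation ip := (dual_ip nu rho).

(** The factor [eta x] of [list_dual_cons] is exchanged for a particle added at [x], and
in the difference only the term where [x] is paired with a particle of [s']
remains. *)
Lemma dual_ip_cons x s s' :
  ip (x :: s) s' = (count_mem x s')%:R / rho * ip s (rem x s').
Proof.
have iss := dual_pair_integrable hrho hnu rho0 s s'.
have issx := dual_pair_integrable hrho hnu rho0 s (rem x s').
have eF : (fun eta => list_dual rho s eta * list_dual rho s' (add_particle eta x)) =
    (fun eta => list_dual rho s eta * list_dual rho s' eta -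
    ((count_mem x s')%:R / rho) * (list_dual rho s eta * list_dual rho (rem x s') eta)).
  by apply/funext => eta; rewrite list_dual_add_particle //; ring.
have [iM eM] : nu.-integrable [set: Omega d] (EFin \o (fun eta : Omega d => (eta x)%:R *
       (list_dual rho s (remove_particle eta x) * list_dual rho s' (add_particle (remove_particle eta x) x)))) /\
    \int[nu]_eta ((eta x)%:R * (list_dual rho s (remove_particle eta x) *
      list_dual rho s' (add_particle (remove_particle eta x) x))) =
    rho * \int[nu]_eta (list_dual rho s eta * list_dual rho s' (add_particle eta x)).
  apply: (mecke_int hrho hnu x (F := fun eta => list_dual rho s eta * list_dual rho s' (add_particle eta x))).
  by rewrite eF; exact: integrable_subZ.
rewrite /dual_ip.
under eq_Rintegral do rewrite list_dual_mecke //.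
rewrite Rintegral_subZ // eM eF Rintegral_subZ // mulrA mulVf // mul1r; ring.
Qed.

Lemma dual_ip_size s s' : size s != size s' -> ip s s' = 0.
Proof.
elim: s s' => [|x s IH] [|y s'] //= ss'.
- by rewrite dual_ipC dual_ip_cons /= !mul0r.
- by rewrite dual_ip_cons /= !mul0r.
rewrite dual_ip_cons; have [xs|/count_memPn -> ] := boolP (x \in y :: s').
  by rewrite IH ?mulr0 // size_rem //= -eqSS.
by rewrite !mul0r.
Qed.

Lemma dual_ip_perm s1 s1' s2 s2' : perm_eq s1 s1' -> perm_eq s2 s2' -> ip s1 s2 = ip s1' s2'.
Proof.
by move=> p1 p2; apply: eq_Rintegral => eta _; rewrite (list_dual_perm _ _ p1) (list_dual_perm _ _ p2).
Qed.

Lemma dual_sqnorm_rem y s : y \in s ->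
  ip s s = (count_mem y s)%:R / rho * ip (rem y s) (rem y s).
Proof. by move=> ys; rewrite (dual_ip_perm (perm_to_rem ys) (perm_refl s)) dual_ip_cons. Qed.

Lemma dual_sqnorm_ge0 s : 0 <= ip s s.
Proof. by apply: Rintegral_ge0 => eta _; rewrite -expr2 sqr_ge0. Qed.

Lemma list_dual_tau (sg : R) s (x : Zd d) (eta : Omega d) :
  list_dual sg s (tau x eta) = list_dual sg [seq y + x | y <- s] eta.
Proof.
have inj : injective (fun y : Zd d => y + x) by exact: addIr.
rewrite /list_dual (undup_map_inj inj) big_map; apply: eq_bigr => y _.
rewrite count_map /tau; congr charlier; apply: eq_count => z /=.
by rewrite (inj_eq inj).
Qed.

Lemma tau_law x A : measurable A -> nu (tau x @^-1` A) = nu A.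
Proof.
move=> mA; apply: (poisson_unique hnu (mu := image_measure nu (measurable_tau x))) mA.
move=> J n; rewrite /= /pushforward.
have -> : tau x @^-1` [set eta | forall y, y \in J -> eta y = n y] =
   [set eta : Omega d | forall y, y \in [fset (y + x)%R | y in J]%fset -> eta y = n (y - x)].
  apply/seteqP; split => eta /= h y.
    by move=> /imfsetP[z /= zJ ->]; rewrite addrK -h.
  by move=> yJ; rewrite /tau h ?addrK //; apply/imfsetP; exists y.
rewrite (hnu _ (fun y => n (y - x))) big_imfset /=; last by move=> y z _ _; exact: addIr.
by congr EFin; apply: eq_bigr => y _; rewrite addrK.
Qed.

Lemma dual_sqnorm_shift x s :
  ip [seq y + x | y <- s] [seq y + x | y <- s] = ip s s.
Proof.
have mF : measurable_fun [set: Omega d] (fun eta : Omega d => list_dual rho s eta * list_dual rho s eta).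
  by apply: measurable_funM; exact: measurable_list_dual.
rewrite [RHS](esym (Rintegral_law (measurable_tau x) (tau_law x) mF)).
by apply: eq_Rintegral => eta _; rewrite !list_dual_tau.
Qed.

End DualOrthogonal.

(** * Action of a particle on local functions *)

Section OneParticle.
Variables (R : realType) (I : eqType) (q : I -> I -> R) (J : seq I).
Implicit Types (H : (I -> nat) -> R) (m : I -> nat) (l : seq I).

(** For [H] local on [J], the expectation of [H] after a particle started from [i] has
been added to [m].  It is written with differences because a particle that ends outside [J] leaves a
function local on [J] unchanged. *)
Definition walk_op i H m : R := H m + \sum_(z <- J) q i z * (H (add_particle m z) - H m).
Definition walk_ops l H : (I -> nat) -> R := foldr walk_op H l.

Lemma add_particleC m y z : add_particle (add_particle m y) z = add_particle (add_particle m z) y.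
Proof. by apply/funext => x; rewrite /add_particle addnAC. Qed.

Lemma TopC i j H : walk_op i (walk_op j H) = walk_op j (walk_op i H).
Proof.
apply/funext => m; rewrite /walk_op.
under [X in _ + X = _]eq_bigr do rewrite opprD addrACA mulrDr.
under [X in _ = _ + X]eq_bigr do rewrite opprD addrACA mulrDr.
rewrite !big_split /= !addrA; congr (_ + _); first by rewrite -!addrA; congr (_ + _); rewrite addrC.
under eq_bigr do rewrite -sumrB mulr_sumr.
under [RHS]eq_bigr do rewrite -sumrB mulr_sumr.
rewrite exchange_big /=; apply: eq_bigr => z _; apply: eq_bigr => z' _.
by rewrite (add_particleC m z'); ring.
Qed.

Lemma walk_ops_walk_op l i H : walk_ops l (walk_op i H) = walk_op i (walk_ops l H).
Proof. by elim: l => //= j l ->; rewrite TopC. Qed.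

Lemma walk_ops_perm l l' H : perm_eq l l' -> walk_ops l H = walk_ops l' H.
Proof.
move: l'; elim: l => [|i l IH] l' p; first by rewrite perm_sym in p; rewrite (perm_nilP p).
have il' : i \in l' by rewrite -(perm_mem p) mem_head.
have {p}/IH e : perm_eq l (rem i l').
  by rewrite -(perm_cons i); apply: perm_trans p (perm_to_rem il').
rewrite /= e; clear -il'; elim: l' il' => //= j l' IH; rewrite inE.
have [-> //|ij] := eqVneq i j; rewrite /= => /IH <-.
by rewrite TopC.
Qed.

Lemma walk_op_local i H : local_on J H -> local_on J (walk_op i H).
Proof.
move=> Hl m m' mm; rewrite /walk_op (Hl _ _ mm); congr (_ + _).
apply: eq_bigr => z _; congr (_ * (_ - _)); apply: Hl => y yJ.
by rewrite /add_particle (mm y yJ).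
Qed.

Lemma walk_op_mix i H m : walk_op i H m =
  (1 - \sum_(z <- J) q i z) * H m + \sum_(z <- J) q i z * H (add_particle m z).
Proof.
rewrite /walk_op; under eq_bigr do rewrite mulrBr.
by rewrite sumrB -mulr_suml; ring.
Qed.

Hypothesis q0 : forall i z, 0 <= q i z.
Hypothesis q1 : forall i, \sum_(z <- J) q i z <= 1.

Lemma walk_op_bounded i H M : (forall m, `|H m| <= M) -> forall m, `|walk_op i H m| <= M.
Proof.
move=> HM m; rewrite walk_op_mix; apply: le_trans (ler_normD _ _) _.
apply: (@le_trans _ _ ((1 - \sum_(z <- J) q i z) * M + (\sum_(z <- J) q i z) * M)); last first.
  by rewrite -mulrDl subrK mul1r.
apply: lerD; first by rewrite normrM ger0_norm ?subr_ge0 // ler_wpM2l ?subr_ge0.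
apply: le_trans (ler_norm_sum _ _ _) _; rewrite mulr_suml; apply: ler_sum => z _.
by rewrite normrM ger0_norm // ler_wpM2l.
Qed.

Lemma walk_ops_bounded l H M : (forall m, `|H m| <= M) -> forall m, `|walk_ops l H m| <= M.
Proof. by move=> HM; elim: l => //= i l IH; exact: walk_op_bounded. Qed.

Hypothesis uJ : uniq J.

Definition add_op y H m : R := H (add_particle m y).
Definition count_op y H m : R := (m y)%:R * H m.

Lemma walk_op_add_op i y H : walk_op i (add_op y H) = add_op y (walk_op i H).
Proof.
apply/funext => m; rewrite /walk_op /add_op; congr (_ + _); apply: eq_bigr => z _.
by rewrite add_particleC.
Qed.

Lemma walk_ops_add_op l y H : walk_ops l (add_op y H) = add_op y (walk_ops l H).
Proof. by elim: l => //= i l ->; rewrite walk_op_add_op. Qed.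

Lemma walk_op_count_op i y H m : y \in J ->
  walk_op i (count_op y H) m = count_op y (walk_op i H) m + q i y * add_op y H m.
Proof.
move=> yJ; rewrite /walk_op /count_op /add_op mulrDr -addrA; congr (_ + _).
rewrite mulr_sumr [in LHS](bigD1_seq y) //= [in RHS](bigD1_seq y) //=.
rewrite /add_particle eqxx addn1 -natr1 [RHS]addrAC; congr (_ + _).
  by ring.
by apply: eq_bigr => z /negPf zy; rewrite eq_sym zy addn0; ring.
Qed.

Lemma walk_op_lin i (K : Type) (r : seq K) (c : K -> R) (G : K -> (I -> nat) -> R) H :
  walk_op i (fun m => H m + \sum_(x <- r) c x * G x m) =
  (fun m => walk_op i H m + \sum_(x <- r) c x * walk_op i (G x) m).
Proof.
apply/funext => m; rewrite /walk_op.
under [X in _ + X = _]eq_bigr do rewrite opprD addrACA mulrDr.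
under [X in _ = _ + X]eq_bigr do rewrite mulrDr.
rewrite !big_split /= !addrA; congr (_ + _); first by rewrite -!addrA; congr (_ + _); rewrite addrC.
under [RHS]eq_bigr do rewrite mulr_sumr.
rewrite exchange_big /=; apply: eq_bigr => z _.
rewrite -sumrB mulr_sumr; apply: eq_bigr => x _; ring.
Qed.

(** The particles found at [y] at the end are those of [m] and those of [l] that have
moved to [y]. *)
Lemma walk_ops_count_op l y H m : y \in J -> walk_ops l (count_op y H) m =
  count_op y (walk_ops l H) m + \sum_(x <- l) q x y * walk_ops (rem x l) (add_op y H) m.
Proof.
move=> yJ; elim: l m => [|i l IH] m; first by rewrite big_nil addr0.
have -> : walk_ops (i :: l) (count_op y H) = walk_op i (fun m => count_op y (walk_ops l H) m +
    \sum_(x <- l) q x y * walk_ops (rem x l) (add_op y H) m).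
  by rewrite /=; congr walk_op; apply/funext => m'; rewrite IH.
rewrite walk_op_lin walk_op_count_op // big_cons /= eqxx addrA; congr (_ + _ + _).
  by rewrite walk_ops_add_op.
apply: eq_big_seq => x xl; congr (_ * _).
have [xi|xi] := eqVneq x i; last by [].
rewrite xi (walk_ops_perm _ (perm_to_rem xl)) /= xi.
done.
Qed.

End OneParticle.

(** * Independent walkers *)

Section Walkers.
Variables (R : realType) (d : nat) (p : Zd d -> Zd d -> R).
Variables (nu : probability (Omega d) R).
Variables (disp : measure_display) (T : measurableType disp) (P : probability T R).
Variables (X : Zd d * nat -> R -> T -> Zd d) (eta : R -> T -> Omega d).
Hypothesis heta : independent_walkers p nu P X eta.
Variable s : R.
Hypothesis s0 : 0 <= s.

Local Notation q := (transition p s).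

Lemma measurable_walker l z : measurable [set w | X l s w = z].
Proof. exact: (walk_measurable (particle_walk heta l) z s0). Qed.

Lemma walker_law l z : P [set w | X l s w = z] = (q l.1 z)%:E.
Proof.
have := walk_law (particle_walk heta l) (h := [:: (s, z)]).
rewrite /= s0 subr0 mulr1 => <- //; congr (P _); apply/seteqP; split => w /=.
  by move=> h u; rewrite inE => /eqP ->.
by move=> /(_ (s, z)); rewrite mem_head; exact.
Qed.

Lemma transition_ge0 i z : 0 <= q i z.
Proof. by rewrite -lee_fin -(walker_law (i, 0%N)) measure_ge0. Qed.

Lemma walker_notin_law l (J : seq (Zd d)) : uniq J ->
  measurable [set w | X l s w \notin J] /\
  P [set w | X l s w \notin J] = (1 - \sum_(z <- J) q l.1 z)%:E.
Proof.
elim: J => [|z J IH] /=.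
  rewrite big_nil subr0 (_ : mkset _ = setT); last by apply/seteqP; split.
  by split; [exact: measurableT | exact: probability_setT].
move=> /andP[zJ uJ]; have [mJ PJ] := IH uJ.
have e : [set w | X l s w \notin z :: J] =
    [set w | X l s w \notin J] `\` [set w | X l s w = z].
  apply/seteqP; split => w /=; rewrite inE negb_or.
    by move=> /andP[/eqP ? ?]; split.
  by move=> [-> /eqP ->].
rewrite e; split; first by apply: measurableD => //; exact: measurable_walker.
rewrite measureD //=; [|exact: measurable_walker|by rewrite PJ ltry].
rewrite (_ : _ `&` _ = [set w | X l s w = z]); last first.
  by apply/seteqP; split => w /= => [[]//|e']; split => //; rewrite e'.
by rewrite walker_law PJ -EFinB big_cons; congr EFin; ring.
Qed.

Lemma transition_sum_le1 i (J : seq (Zd d)) : uniq J -> \sum_(z <- J) q i z <= 1.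
Proof.
move=> uJ; rewrite -subr_ge0 -lee_fin.
by have [_ <-] := walker_notin_law (i, 0%N) uJ; exact: measure_ge0.
Qed.

Definition walker_sigma (o : option (Zd d * nat)) : set (set T) :=
  if o is Some l then path_sigma (X l)
  else preimage_set_system [set: T] (eta 0) measurable.

Lemma walker_sigma_at l z : walker_sigma (Some l) [set w | X l s w = z].
Proof. by apply: sub_gen_smallest; exists s, z. Qed.

Lemma walker_sigma_notin l (J : seq (Zd d)) : walker_sigma (Some l) [set w | X l s w \notin J].
Proof.
pose G := [set A | exists t x, 0 <= t /\ A = X l t @^-1` [set x]].
rewrite -/(@measurable _ (g_sigma_algebraType G) _).
have mz z : @measurable _ (g_sigma_algebraType G) [set w | X l s w = z].
  exact: (@walker_sigma_at l z).
have -> : [set w | X l s w \notin J] =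
    ~` (\big[setU/set0]_(z <- J) [set w | X l s w = z]).
  apply/seteqP; split => w /=.
    move=> h; rewrite -bigcup_seq => -[z /= zJ e]; by rewrite e zJ in h.
  by move=> h; apply/negP => XJ; apply: h; rewrite -bigcup_seq; exists (X l s w).
apply: (@measurableC _ (g_sigma_algebraType G)).
by apply: (@bigsetU_measurable _ (g_sigma_algebraType G)) => z _; exact: mz.
Qed.

Lemma measurable_walker_sigma o E : walker_sigma o E -> measurable E.
Proof.
case: o => [l|] /=.
  apply: smallest_sub; first exact: sigma_algebra_measurable.
  move=> _ [t [x [t0 ->]]]; exact: (walk_measurable (particle_walk heta l)).
move=> [A mA <-]; exact: (eta_measurable heta (lexx 0) measurableT).
Qed.

Definition event (K : {fset option (Zd d * nat)}) (Ev : option (Zd d * nat) -> set T) : set T :=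
  \bigcap_(o in [set` K]) Ev o.

Lemma measurable_event K Ev : (forall o, o \in K -> walker_sigma o (Ev o)) ->
  measurable (event K Ev).
Proof.
move=> FE; apply: fin_bigcap_measurable => [|o oK]; first exact: finite_fset.
by apply: (@measurable_walker_sigma o); exact: FE.
Qed.

(** Independence in the form that suits an induction on the walkers: a fresh walker
multiplies the probability of an event about the others. *)
Lemma event_add K Ev l B : Some l \notin K -> (forall o, o \in K -> walker_sigma o (Ev o)) ->
  walker_sigma (Some l) B ->
  let Ev' := fun o => if o == Some l then B else Ev o in
  [/\ forall o, o \in (Some l |` K)%fset -> walker_sigma o (Ev' o),
      event (Some l |` K)%fset Ev' = event K Ev `&` B &
      fine (P (event (Some l |` K)%fset Ev')) = fine (P (event K Ev)) * fine (P B)].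
Proof.
move=> lK FE FB Ev'.
have FE' o : o \in (Some l |` K)%fset -> walker_sigma o (Ev' o).
  rewrite !inE /Ev'; have [-> //|_] /= := eqVneq o (Some l); exact: FE.
have Ev'K o : o \in K -> Ev' o = Ev o.
  by rewrite /Ev'; case: eqP => // -> ; rewrite (negPf lK).
split => //.
  apply/seteqP; split => w /=.
    move=> h; split; last by have := h (Some l); rewrite /= /Ev' eqxx; apply; rewrite !inE eqxx.
    by move=> o /= oK; rewrite -Ev'K //; apply: h; rewrite /= !inE oK orbT.
  move=> [h hB] o /=; rewrite !inE => /orP[/eqP ->|oK]; first by rewrite /Ev' eqxx.
  by rewrite Ev'K //; exact: h.
rewrite (particle_independent heta FE') (particle_independent heta FE).
rewrite big_fsetU1 //= {1}/Ev' eqxx fineM; last 2 first.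
- by apply: fin_num_measure; exact: measurable_walker_sigma FB.
- rewrite big_seq; apply: prode_fin_num => o oK; apply: fin_num_measure.
  by apply: (@measurable_walker_sigma o); apply: FE'; rewrite !inE oK orbT.
rewrite mulrC; congr (fine _ * _).
by apply: eq_big_seq => o oK; rewrite Ev'K.
Qed.

Lemma integral_split (Y : T -> Zd d) (J : seq (Zd d)) (E : set T) (f : T -> \bar R) :
  (forall z, measurable [set w | Y w = z]) -> measurable E -> measurable_fun [set: T] f ->
  uniq J ->
  (\int[P]_(w in E) f w = \sum_(z <- J) \int[P]_(w in E `&` [set w | Y w = z]) f w +
     \int[P]_(w in E `&` [set w | Y w \notin J]) f w)%E.
Proof.
move=> mY mE mf.
have mN (J' : seq (Zd d)) : measurable [set w | Y w \notin J'].
  elim: J' => [|z J' IH]; first by rewrite (_ : mkset _ = setT) //; apply/seteqP; split.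
  rewrite (_ : mkset _ = [set w | Y w \notin J'] `\` [set w | Y w = z]); first exact: measurableD.
  apply/seteqP; split => w /=; rewrite inE negb_or.
    by move=> /andP[/eqP ? ?]; split.
  by move=> [-> /eqP ->].
elim: J => [_|z J IH /= /andP[zJ uJ]].
  by rewrite big_nil add0e (_ : [set w | _] = setT) ?setIT //; apply/seteqP; split.
rewrite IH // big_cons -addeA [RHS]addeCA; congr (_ + _)%E.
rewrite -integral_setU //; [|exact: measurableI|exact: measurableI|exact: measurable_funS mf|].
  congr (integral _ _ _); apply/seteqP; split => w /=; rewrite inE negb_or.
    move=> [Ew nJ]; have [<-|ne] := pselect (Y w = z); [by left | right; split => //].
    by rewrite nJ andbT; apply/eqP.
  by move=> [[Ew ->]|[Ew /andP[_]]].
by apply/disj_setPS => w /= [[_ ->] [_]]; rewrite inE eqxx.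
Qed.

Definition add_walkers (m : Omega d) (L : seq (Zd d * nat)) (w : T) : Omega d :=
  foldl (fun m l => add_particle m (X l s w)) m L.

Lemma add_walkersE m L w y : add_walkers m L w y = (m y + count (fun l => X l s w == y) L)%N.
Proof.
elim: L m => [|l L IH] m /=; first by rewrite addn0.
by rewrite IH /add_particle addnA eq_sym.
Qed.

Lemma measurable_add_walkers disp' (S : measurableType disp') (H : Omega d -> S) m L :
  measurable_fun [set: T] (fun w => H (add_walkers m L w)).
Proof.
have -> : (fun w => H (add_walkers m L w)) =
    fun w => H (foldl (fun m (x : Zd d) => add_particle m x) m [seq X l s w | l <- L]).
  apply/funext => w; congr H; rewrite /add_walkers; elim: L m => //= l L IH m; exact: IH.
apply: (@measurable_map _ T (Zd d * nat) (Zd d) (fun l w => X l s w) _ _ S L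
  (fun c => H (foldl (fun m (x : Zd d) => add_particle m x) m c))).
exact: measurable_walker.
Qed.

Variable J : seq (Zd d).
Hypothesis uJ : uniq J.

Lemma add_walkers_local (H : Omega d -> R) m m' L w : local_on J H -> {in J, m =1 m'} ->
  H (add_walkers m L w) = H (add_walkers m' L w).
Proof. by move=> Hl mm; apply: Hl => y yJ; rewrite !add_walkersE mm. Qed.

(** Induction on the walkers.  The event carries the conditioning: it is enlarged by
the position of the first walker, in [J] or outside [J], which keeps it in the
class to which independence applies. *)
Lemma walkers_integral (H : Omega d -> R) (L : seq (Zd d * nat)) m K Ev : local_on J H ->
  uniq L -> (forall l, l \in L -> Some l \notin K) ->
  (forall o, o \in K -> walker_sigma o (Ev o)) ->
  (\int[P]_(w in event K Ev) (H (add_walkers m L w))%:E =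
    (fine (P (event K Ev)) * walk_ops q J [seq l.1 | l <- L] H m)%:E)%E.
Proof.
move=> Hl; elim: L m K Ev => [|l L IH] m K Ev.
  move=> _ _ FE; have mE := measurable_event FE.
  rewrite (eq_integral (cst (H m)%:E)) //.
  by rewrite integral_cst // EFinM fineK ?fin_num_measure // muleC.
move=> /= /andP[lL uL] LK FE; have mE := measurable_event FE.
have lK : Some l \notin K by apply: LK; rewrite mem_head.
have LK' l' : l' \in L -> Some l' \notin (Some l |` K)%fset.
  move=> l'L; rewrite !inE negb_or LK ?inE ?l'L ?orbT // andbT.
  by apply: contraNN lL => /eqP[<-].
rewrite (@integral_split (X l s) J) //; last 2 first.
- exact: measurable_walker.
- exact/measurable_EFinP/(measurable_add_walkers H m (l :: L)).
have [mJ PJ] := walker_notin_law l uJ.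
have piece B m' : walker_sigma (Some l) B ->
    (forall w, B w -> H (add_walkers (add_particle m (X l s w)) L w) = H (add_walkers m' L w)) ->
    (\int[P]_(w in event K Ev `&` B) (H (add_walkers m (l :: L) w))%:E =
     (fine (P (event K Ev)) * fine (P B) * walk_ops q J [seq l.1 | l <- L] H m')%:E)%E.
  move=> FB eB; have [FE' <- <-] := event_add lK FE FB.
  rewrite -IH //; apply: eq_integral => w; rewrite inE => h; congr EFin; apply: eB.
  by have := h (Some l); rewrite /= eqxx; apply; rewrite !inE eqxx.
rewrite (piece _ m (@walker_sigma_notin l J)); last first.
  move=> w /= wJ; apply: add_walkers_local => // y yJ; rewrite /add_particle.
  by case: eqP => [e|_]; [rewrite -e yJ in wJ | rewrite addn0].
rewrite (eq_bigr (fun z => (fine (P (event K Ev)) * q l.1 z *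
    walk_ops q J [seq l.1 | l <- L] H (add_particle m z))%:E)); last first.
  move=> z _; rewrite (piece _ (add_particle m z) (@walker_sigma_at l z)); last by move=> w /= ->.
  by rewrite walker_law.
rewrite PJ sumEFin -EFinD /= walk_op_mix; congr EFin.
rewrite [RHS]mulrDr [in RHS]mulr_sumr [LHS]addrC.
by congr (_ + _); [rewrite mulrA | apply: eq_bigr => z _; rewrite mulrA].
Qed.

End Walkers.

(** * Particles that start from a finite box *)

Lemma integrable_mul_bounded (disp : measure_display) (T : measurableType disp) (R : realType)
    (mu : {measure set T -> \bar R}) (f g : T -> R) (M : R) :
  mu.-integrable [set: T] (EFin \o f) -> measurable_fun [set: T] g ->
  (forall x, `|g x| <= M) -> mu.-integrable [set: T] (EFin \o (fun x => f x * g x)).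
Proof.
move=> fi mg gM; have /integrableP[/measurable_EFinP mf _] := fi.
apply: (@le_integrable _ _ _ mu _ measurableT _ (EFin \o (fun x => M * f x))).
- by apply/measurable_EFinP; exact: measurable_funM.
- move=> x _ /=; rewrite lee_fin !normrM mulrC ler_wpM2r //.
  by apply: le_trans (gM x) _; rewrite ler_norm.
exact: (integrableZl measurableT M fi).
Qed.

Lemma integrable_bounded (disp : measure_display) (T : measurableType disp) (R : realType)
    (mu : probability T R) (g : T -> R) (M : R) :
  measurable_fun [set: T] g -> (forall x, `|g x| <= M) -> mu.-integrable [set: T] (EFin \o g).
Proof.
move=> mg gM; have := integrable_mul_bounded (finite_measure_integrable_cst mu 1 measurableT) mg gM.
by under [X in EFin \o X]funext do rewrite mul1r.
Qed.

Section Boxes.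
Variables (R : realType) (d : nat) (p : Zd d -> Zd d -> R).
Variables (nu : probability (Omega d) R).
Variables (disp : measure_display) (T : measurableType disp) (P : probability T R).
Variables (X : Zd d * nat -> R -> T -> Zd d) (eta : R -> T -> Omega d).
Hypothesis heta : independent_walkers p nu P X eta.
Variable s : R.
Hypothesis s0 : 0 <= s.

Local Notation q := (transition p s).

Lemma measurable_eta t : 0 <= t -> measurable_fun [set: T] (eta t).
Proof. exact: (eta_measurable heta). Qed.

Lemma eta0_law A : measurable A -> P (eta 0 @^-1` A) = nu A.
Proof. exact: (eta_initial heta). Qed.

Definition walkers_of (Lam : seq (Zd d)) (c : Zd d -> nat) : seq (Zd d * nat) :=
  flatten [seq [seq (i, m) | m <- iota 0 (c i)] | i : Zd d <- Lam].
Definition sites_of (Lam : seq (Zd d)) (c : Zd d -> nat) : seq (Zd d) :=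
  flatten [seq nseq (c i) i | i <- Lam].

Lemma walkers_of_sites Lam c : [seq l.1 | l <- walkers_of Lam c] = sites_of Lam c.
Proof.
rewrite /walkers_of map_flatten -map_comp; congr flatten; apply: eq_map => i /=.
have gen n k : [seq i | _ <- iota k n] = nseq n i by elim: n k => //= n IH k; rewrite IH.
by rewrite -map_comp; exact: gen.
Qed.

Lemma walkers_of_uniq Lam c : uniq Lam -> uniq (walkers_of Lam c).
Proof.
move=> uL; apply: (@allpairs_uniq_dep (Zd d) (fun=> nat) _ (fun i m => (i, m)) Lam (fun i => iota 0 (c i))) => //=.
  by move=> i _; exact: iota_uniq.
by move=> [i m] [j n] _ _ /= [-> ->].
Qed.

Lemma walkers_of_eq Lam c c' : {in Lam, c =1 c'} -> walkers_of Lam c = walkers_of Lam c'.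
Proof. by move=> cc; congr flatten; apply/eq_in_map => i iL; rewrite cc. Qed.

Lemma sites_of_eq Lam c c' : {in Lam, c =1 c'} -> sites_of Lam c = sites_of Lam c'.
Proof. by move=> cc; rewrite -!walkers_of_sites (walkers_of_eq cc). Qed.

Definition box_conf Lam (w : T) : Omega d :=
  add_walkers X s (fun=> 0%N) (walkers_of Lam (eta 0 w)) w.

Variable J : seq (Zd d).
Hypothesis uJ : uniq J.

Definition box_op Lam (H : Omega d -> R) : Omega d -> R :=
  fun c => walk_ops q J (sites_of Lam c) H (fun=> 0%N).

Lemma box_op_local Lam H : local_on Lam (box_op Lam H).
Proof. by move=> c c' cc; rewrite /box_op (sites_of_eq cc). Qed.

Lemma box_op_bounded Lam H M : (forall m, `|H m| <= M) -> forall c, `|box_op Lam H c| <= M.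
Proof.
move=> HM c; apply: walk_ops_bounded => //.
- by move=> i z; exact: (transition_ge0 heta s0).
- by move=> i; exact: (transition_sum_le1 heta s0).
Qed.

(** [piece Lam] enumerates the level sets of the initial configuration in [Lam], and
[cf Lam c] is a configuration with the values [c] on [Lam]. *)
Let cf (Lam : seq (Zd d)) (c : seq nat) : Omega d := fun y => nth 0%N c (index y Lam).
Let piece Lam (k : nat) : set T :=
  if (choice.pickle_inv k : option (seq nat)) is Some c then [set w | map (eta 0 w) Lam = c] else set0.

Let piece_cover Lam : \bigcup_k piece Lam k = setT.
Proof.
apply/seteqP; split => // w _; exists (choice.pickle (map (eta 0 w) Lam)) => //.
by rewrite /piece choice.pickleK_inv.
Qed.

Let piece_triv Lam : trivIset [set: nat] (piece Lam).
Proof.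
move=> i j _ _ [w []]; rewrite /piece.
have := @choice.pickle_invK (seq nat) i; have := @choice.pickle_invK (seq nat) j.
case: choice.pickle_inv => [c|] //=; case: choice.pickle_inv => [c'|] //= <- <- <- <-.
by [].
Qed.

Let cf_eq Lam c w : map (eta 0 w) Lam = c -> {in Lam, eta 0 w =1 cf Lam c}.
Proof.
by move=> <- y yL; rewrite /cf (nth_map y) ?index_mem // nth_index.
Qed.

Let measurable_piece Lam k : measurable (piece Lam k).
Proof.
rewrite /piece; case: choice.pickle_inv => [c|] //.
exact/measurable_values/(measurable_eta (lexx 0)).
Qed.

Variable Lam : seq (Zd d).
Hypothesis uLam : uniq Lam.
Variables (H : Omega d -> R) (M : R).
Hypotheses (Hl : local_on J H) (HM : forall m, `|H m| <= M).

Lemma measurable_box : measurable_fun [set: T] (fun w => H (box_conf Lam w)).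
Proof.
rewrite -(piece_cover Lam); apply/measurable_fun_bigcup => [|k]; first exact: measurable_piece.
rewrite /piece; case: choice.pickle_inv => [c|]; last exact: measurable_fun_set0.
apply: (@eq_measurable_fun _ _ _ _ _ (fun w => H (add_walkers X s (fun=> 0%N) (walkers_of Lam (cf Lam c)) w))).
  by move=> w; rewrite inE /= => wc; rewrite /box_conf (walkers_of_eq (cf_eq wc)).
apply: (measurable_funS measurableT) => //.
exact: (measurable_add_walkers heta s0 H).
Qed.

Variable G : Omega d -> R.
Hypotheses (Gl : local_on Lam G) (Gi : nu.-integrable [set: Omega d] (EFin \o G)).

Lemma integrable_box :
  P.-integrable [set: T] (EFin \o (fun w => G (eta 0 w) * H (box_conf Lam w))).
Proof.
apply: (integrable_mul_bounded (M := M)) => //; last exact: measurable_box.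
exact: (integrable_law (measurable_eta (lexx 0)) eta0_law).
Qed.

Lemma integrable_box_op :
  nu.-integrable [set: Omega d] (EFin \o (fun c => G c * box_op Lam H c)).
Proof.
apply: (integrable_mul_bounded (M := M)) => //; last exact: box_op_bounded.
exact: (@measurable_local _ _ _ _ _ id Lam (box_op Lam H) (@measurable_id _ _ _) (@box_op_local Lam H)).
Qed.

(** The initial configuration in [Lam] takes countably many values; on each of the
corresponding events the list of walkers is deterministic, and [walkers_integral]
applies. *)
Lemma box_integral :
  \int[P]_w (G (eta 0 w) * H (box_conf Lam w)) = \int[nu]_c (G c * box_op Lam H c).
Proof.
have mGU : measurable_fun [set: Omega d] (fun c => G c * box_op Lam H c).
  by have /integrableP[/measurable_EFinP] := integrable_box_op.
rewrite -(Rintegral_law (measurable_eta (lexx 0)) eta0_law mGU).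
have iY := integrable_box.
have iY' := integrable_law (measurable_eta (lexx 0)) eta0_law integrable_box_op.
rewrite /Rintegral; congr fine; rewrite -(piece_cover Lam).
rewrite !integral_bigcup ?piece_cover //; try exact: piece_triv; try exact: measurable_piece.
apply: eq_eseriesr => k _; have := measurable_piece Lam k; rewrite /piece.
case: choice.pickle_inv => [c|] mA; last by rewrite !integral_set0.
pose A := [set w | map (eta 0 w) Lam = c].
pose Ev : option (Zd d * nat) -> set T := fun=> A.
have EvE : event [fset None]%fset Ev = A.
  by apply/seteqP; split => w /= h; [apply: (h None); rewrite /= inE | move=> o _].
have FE o : o \in [fset None]%fset -> walker_sigma X eta o (Ev o).
  rewrite inE => /eqP -> /=; exists [set c' : Omega d | map c' Lam = c]; last by rewrite setTI.
  exact: (measurable_values _ _ (@measurable_id _ (Omega d) setT)).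
transitivity (\int[P]_(w in A) ((G (cf Lam c))%:E *
     (H (add_walkers X s (fun=> 0%N) (walkers_of Lam (cf Lam c)) w))%:E))%E.
  apply: eq_integral => w; rewrite inE /= => wc; rewrite EFinM /box_conf (walkers_of_eq (cf_eq wc)).
  by rewrite (Gl (cf_eq wc)).
rewrite integralZl //; last first.
  apply: (integrableS measurableT) => //.
  by apply: (@integrable_bounded _ _ _ P _ M) => //; exact: (measurable_add_walkers heta s0 H).
rewrite -EvE (walkers_integral heta s0 uJ) //; last 2 first.
- exact: walkers_of_uniq.
- by move=> l _; rewrite inE.
rewrite EvE walkers_of_sites -/(box_op Lam H (cf Lam c)).
rewrite (eq_integral (cst (G (cf Lam c) * box_op Lam H (cf Lam c))%:E)); last first.
  move=> w; rewrite inE /= => wc.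
  by rewrite -(Gl (cf_eq wc)) -(@box_op_local Lam H _ _ (cf_eq wc)).
rewrite integral_cst // -[X in _ = (_ * X)%E]fineK ?fin_num_measure // -!EFinM.
by congr EFin; ring.
Qed.

End Boxes.

(** * Duality for the particles of a box *)

(** Local functions of the particles of a box are eventually constant when the box
grows, and truncations of a function are eventually equal to it. *)
Lemma Rintegral_eventually_eq (disp : measure_display) (T : measurableType disp) (R : realType)
    (mu : {measure set T -> \bar R}) (f_ : nat -> T -> R) (f g : T -> R) :
  (forall n, measurable_fun [set: T] (f_ n)) -> measurable_fun [set: T] f ->
  {ae mu, forall w, exists N, forall n, (N <= n)%N -> f_ n w = f w} ->
  mu.-integrable [set: T] (EFin \o g) -> {ae mu, forall w, forall n, `|f_ n w| <= g w} ->
  mu.-integrable [set: T] (EFin \o f) /\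
  (\int[mu]_w f_ n w @[n --> \oo] --> \int[mu]_w f w).
Proof.
move=> mf_ mf ff ig fg.
have [|||||fi _ cv] := @dominated_convergence _ _ _ mu _ measurableT (fun n => EFin \o f_ n)
   (EFin \o f) (EFin \o g).
- by move=> n; exact/measurable_EFinP.
- exact/measurable_EFinP.
- apply: filterS ff => w [N hN] _; apply: cvg_near_cst; exists N => // n /= Nn.
  by rewrite hN.
- exact: ig.
- by apply: filterS fg => w h n _; rewrite /= lee_fin.
split => //; apply: fine_cvg.
rewrite fineK //; exact: integrable_fin_num.
Qed.

Lemma Rintegral_bool (disp : measure_display) (T : measurableType disp) (R : realType)
    (mu : {measure set T -> \bar R}) (b : T -> bool) : measurable [set w | b w] ->
  \int[mu]_w (b w)%:R = fine (mu [set w | b w]) :> R.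
Proof.
move=> mb; rewrite /Rintegral; congr fine.
rewrite -[X in _ = mu X]setIT -integral_indic //.
apply: eq_integral => w _; rewrite indicE (_ : _ \in _ = b w) //.
by apply/idP/idP; rewrite inE.
Qed.

Lemma Rintegral_sumZ (disp : measure_display) (T : measurableType disp) (R : realType)
    (mu : {measure set T -> \bar R}) (K : Type) (r : seq K) (c : K -> R) (f : K -> T -> R) :
  (forall i, mu.-integrable [set: T] (EFin \o f i)) ->
  mu.-integrable [set: T] (EFin \o (fun x => \sum_(i <- r) c i * f i x)) /\
  \int[mu]_x (\sum_(i <- r) c i * f i x) = \sum_(i <- r) c i * \int[mu]_x f i x.
Proof.
move=> fi; elim: r => [|i r [IHi IHe]].
  have z : (fun x => \sum_(i <- [::]) c i * f i x) = cst 0.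
    by apply/funext => x; rewrite big_nil.
  rewrite z big_nil; split; first exact: integrable0.
  by rewrite /Rintegral integral0.
have e : (fun x => \sum_(j <- i :: r) c j * f j x) =
    (fun x => \sum_(j <- r) c j * f j x - (- c i) * f i x).
  by apply/funext => x; rewrite big_cons mulNr opprK addrC.
rewrite e; split; first exact: integrable_subZ.
by rewrite Rintegral_subZ // IHe big_cons mulNr opprK addrC.
Qed.

Section Limits.
Variables (R : realType) (d : nat) (p : Zd d -> Zd d -> R) (rho : R).
Hypothesis hp : jump_kernel p.
Hypothesis hrho : 0 < rho.
Variables (nu : probability (Omega d) R).
Hypothesis hnu : poisson_product rho nu.
Variables (disp : measure_display) (T : measurableType disp) (P : probability T R).
Variables (X : Zd d * nat -> R -> T -> Zd d) (eta : R -> T -> Omega d).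
Hypothesis heta : independent_walkers p nu P X eta.
Variable s : R.
Hypothesis s0 : 0 <= s.

Local Notation q := (transition p s).
Local Notation D := (list_dual rho).
Local Notation box := (box_conf X eta s).
Let rho0 : rho != 0. Proof. by rewrite gt_eqF. Qed.

Lemma count_sites_of (Lam : seq (Zd d)) (c : Zd d -> nat) y :
  uniq Lam -> count_mem y (sites_of Lam c) = (c y * (y \in Lam))%N.
Proof.
elim: Lam => [|i Lam IH] /=; first by rewrite muln0.
move=> /andP[iL uL]; rewrite [sites_of _ _]/(nseq (c i) i ++ sites_of Lam c) count_cat count_nseq /= IH // inE.
have [->|yi] := eqVneq y i; first by rewrite (negPf iL) /= muln0 addn0 mul1n muln1.
by rewrite /= mul0n add0n.
Qed.

Lemma sites_of_add_particle (Lam : seq (Zd d)) (c : Zd d -> nat) x : uniq Lam -> x \in Lam ->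
  perm_eq (sites_of Lam (add_particle c x)) (x :: sites_of Lam c).
Proof.
move=> uL xL; apply/allP => y _ /=; rewrite !count_sites_of // /add_particle eq_sym.
by have [<-|_] := eqVneq x y; rewrite ?xL ?muln1 ?addn1 ?addn0 ?add1n ?add0n.
Qed.

Lemma box_op_add_particle J (Lam : seq (Zd d)) H (c : Omega d) x : uniq Lam -> x \in Lam ->
  box_op p s J Lam H (add_particle c x) = box_op p s J Lam (walk_op q J x H) c.
Proof. by move=> uL xL; rewrite /box_op (walk_ops_perm _ _ _ (sites_of_add_particle c uL xL)) /= walk_ops_walk_op. Qed.

Lemma dual_integrable t : nu.-integrable [set: Omega d] (EFin \o D t).
Proof.
have := dual_pair_integrable hrho hnu rho0 t [::].
by under [X in EFin \o X]funext do rewrite list_dual_nil mulr1.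
Qed.

Lemma remove_particleK (c : Zd d -> nat) x : c x != 0%N -> add_particle (remove_particle c x) x = c.
Proof.
move=> cx; apply/funext => y; rewrite /add_particle /remove_particle; case: eqP => [->|_]; last by rewrite subn0 addn0.
by rewrite subnK // lt0n.
Qed.

Section Box.
Variable J : seq (Zd d).
Hypothesis uJ : uniq J.
Local Notation U := (box_op p s J).

Lemma walk_op_local_bounded x H M : local_on J H -> (forall m, `|H m| <= M) ->
  local_on J (walk_op q J x H) /\ forall m, `|walk_op q J x H m| <= M.
Proof.
move=> Hl HM; split; first exact: walk_op_local.
apply: walk_op_bounded => // [i z|i]; first exact: (transition_ge0 heta s0).
exact: (transition_sum_le1 heta s0).
Qed.

(** By the Mecke formula the dual particle at [x] becomes a particle added at [x] to the
initial configuration, which acts on [H] by the one-particle operator. *)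
Lemma box_dual Lam x t (H : Omega d -> R) M : uniq Lam -> x \in Lam -> {subset t <= Lam} ->
  local_on J H -> (forall m, `|H m| <= M) ->
  \int[P]_w (D (x :: t) (eta 0 w) * H (box Lam w)) =
  \int[P]_w (D t (eta 0 w) * H (box Lam w)) -
  \int[P]_w (D t (eta 0 w) * walk_op q J x H (box Lam w)).
Proof.
move=> uL xL tL Hl HM; have [Tl TM] := walk_op_local_bounded x Hl HM.
have Dl t' : {subset t' <= Lam} -> local_on Lam (D t').
  by move=> t'L m m' mm; apply: list_dual_local => y /t'L; exact: mm.
have Dxl : local_on Lam (D (x :: t)).
  by apply: Dl => y; rewrite inE => /predU1P[->|/tL].
have Dtl := Dl t tL.
rewrite !(box_integral heta s0 uJ uL _ (M := M)) //; try exact: dual_integrable.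
have iU G : local_on J G -> (forall m, `|G m| <= M) ->
    nu.-integrable [set: Omega d] (EFin \o (fun c : Omega d => D t c * U Lam G c)).
  by move=> Gl GM; apply: (integrable_box_op heta s0 uJ Lam GM); exact: dual_integrable.
have [iF eF] := mecke_int hrho hnu x (iU _ Tl TM).
rewrite (eq_Rintegral _ (g := fun c : Omega d => D t c * U Lam H c - rho^-1 *
   ((c x)%:R * (D t (remove_particle c x) * U Lam (walk_op q J x H) (remove_particle c x))))); last first.
  move=> c _; rewrite list_dual_cons //; have [->|cx] := eqVneq (c x) 0%N.
    by rewrite !mul0r mulr0 !subr0.
  by rewrite -box_op_add_particle // remove_particleK //; ring.
rewrite Rintegral_subZ // ?eF; last exact: iU.
by rewrite mulrA mulVf // mul1r.
Qed.

(** The particles at [y] are counted by their starting points; the Mecke formula removes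
one particle from its starting point [i], with weight [rho q i y]. *)
Lemma box_count_op Lam y (H : Omega d -> R) M M' : uniq Lam -> y \in J ->
  local_on J H -> (forall m, `|H m| <= M) -> (forall m, `|count_op y H m| <= M') ->
  \int[P]_w (count_op y H (box Lam w)) =
  rho * (\sum_(i <- Lam) q i y) * \int[P]_w (add_op y H (box Lam w)).
Proof.
move=> uL yJ Hl HM MM.
have Ml : local_on J (count_op y H) by move=> m m' mm; rewrite /count_op (Hl _ _ mm) mm.
have Sl : local_on J (add_op y H).
  by move=> m m' mm; apply: Hl => z zJ; rewrite /add_particle mm.
have SM m : `|add_op y H m| <= M by exact: HM.
have boxE G B : local_on J G -> (forall m, `|G m| <= B) ->
    \int[P]_w G (box Lam w) = \int[nu]_c U Lam G c.
  move=> Gl GB; have := box_integral heta s0 uJ uL Gl GB (G := fun=> 1).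
  rewrite (eq_Rintegral _ (g := fun w => G (box Lam w))); last by move=> w _; rewrite mul1r.
  rewrite [RHS](eq_Rintegral _ (g := U Lam G)); last by move=> w _; rewrite mul1r.
  by apply => //; exact: finite_measure_integrable_cst.
rewrite (boxE _ M') // (boxE _ M) //.
have iU : nu.-integrable [set: Omega d] (EFin \o U Lam (add_op y H)).
  have := integrable_box_op heta s0 uJ Lam SM (G := fun=> 1).
  rewrite (_ : (fun c : Omega d => 1 * _) = U Lam (add_op y H)); first last.
    by apply/funext => c; rewrite mul1r.
  by apply; exact: finite_measure_integrable_cst.
rewrite (eq_Rintegral _ (g := fun c : Omega d => \sum_(i <- Lam) q i y *
   ((c i)%:R * U Lam (add_op y H) (remove_particle c i)))); last first.
  move=> c _; rewrite /box_op walk_ops_count_op // /count_op mul0r add0r.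
  rewrite [in LHS]/sites_of big_flatten big_map /=.
  apply: eq_big_seq => i iL; rewrite big_nseq; have [->|ci] := eqVneq (c i) 0%N.
    by rewrite /= mul0r mulr0.
  rewrite iter_addr_0 -/(sites_of Lam c) -mulrnAr; congr (_ * _).
  rewrite -[LHS]mulr_natl; congr (_ * _).
  apply: (congr1 (fun F => F _)); apply: walk_ops_perm.
  rewrite -(perm_cons i); apply: (@perm_trans _ (sites_of Lam c)).
    by rewrite perm_sym perm_to_rem // -has_pred1 has_count count_sites_of // iL muln1 lt0n.
  by rewrite -{1}(remove_particleK ci) sites_of_add_particle.
have mk i := mecke_int hrho hnu i iU.
rewrite (proj2 (Rintegral_sumZ _ _ (fun i => proj1 (mk i)))).
rewrite mulrAC mulr_sumr; apply: eq_bigr => i _.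
by rewrite (proj2 (mk i)); ring.
Qed.

End Box.
End Limits.

(** * Exhaustion of the lattice and stationarity *)

Lemma cvg_eventually_eq (R : realType) (u v : nat -> R) (a b : R) :
  u n @[n --> \oo] --> a -> v n @[n --> \oo] --> b -> (exists N, forall n, (N <= n)%N -> u n = v n) -> a = b.
Proof.
move=> ua vb [N uv].
have ub : u n @[n --> \oo] --> b.
  apply: cvg_trans vb; apply: near_eq_cvg; exists N => // n /= Nn.
  by rewrite uv.
by rewrite -(cvg_lim (@norm_hausdorff _ _) ua) (cvg_lim (@norm_hausdorff _ _) ub).
Qed.

Section Stationarity.
Variables (R : realType) (d : nat) (p : Zd d -> Zd d -> R) (rho : R).
Hypothesis hp : jump_kernel p.
Hypothesis hrho : 0 < rho.
Variables (nu : probability (Omega d) R).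
Hypothesis hnu : poisson_product rho nu.
Variables (disp : measure_display) (T : measurableType disp) (P : probability T R).
Variables (X : Zd d * nat -> R -> T -> Zd d) (eta : R -> T -> Omega d).
Hypothesis heta : independent_walkers p nu P X eta.
Variable s : R.
Hypothesis s0 : 0 <= s.

Local Notation q := (transition p s).
Local Notation D := (list_dual rho).
Local Notation box := (box_conf X eta s).
Let rho0 : rho != 0. Proof. by rewrite gt_eqF. Qed.

Definition exhaust n : seq (Zd d) :=
  pmap (fun k => choice.pickle_inv k : option (Zd d)) (iota 0 n).

Lemma exhaust_uniq n : uniq (exhaust n).
Proof. exact: (pmap_uniq (@choice.pickle_invK (Zd d)) (iota_uniq 0 n)). Qed.

Lemma mem_exhaust n x : (choice.pickle x < n)%N -> x \in exhaust n.
Proof.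
move=> xn; rewrite mem_pmap; apply/mapP; exists (choice.pickle x).
  by rewrite mem_iota.
by rewrite choice.pickleK_inv.
Qed.

Lemma sub_exhaust (J : seq (Zd d)) : exists N, forall n, (N <= n)%N -> {subset J <= exhaust n}.
Proof.
exists (\max_(x <- J) (choice.pickle x).+1)%N => n Nn x xJ; apply: mem_exhaust.
apply: leq_trans Nn; rewrite (big_rem x xJ) /=; exact: leq_maxl.
Qed.

Lemma mem_walkers_of (Lam : seq (Zd d)) (c : Zd d -> nat) l :
  (l \in walkers_of Lam c) = (l.1 \in Lam) && (l.2 < c l.1)%N.
Proof.
case: l => i m /=; apply/flatten_mapP/andP.
  move=> [j jL /mapP[k]]; rewrite mem_iota add0n => /= kc e.
  have /= -> := congr1 fst e; have /= -> := congr1 snd e.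
  by [].
move=> [iL mc]; exists i => //; apply/mapP; exists m => //.
by rewrite mem_iota.
Qed.

(** Almost surely there are finitely many particles at [x], so all of them have started
from a large enough box. *)
Lemma box_cvg_site : {ae P, forall w, forall x, exists N, forall n, (N <= n)%N ->
  box (exhaust n) w x = eta s w x}.
Proof.
apply: filterS (eta_count heta s0) => w hw x; have cK := hw x.
set K := [set l | _] in cK.
have fK : finite_set K by exists (eta s w x).
have [N hN] := sub_exhaust [seq l.1 | l <- fset_set K].
exists N => n /hN sub; rewrite /box_conf add_walkersE add0n.
rewrite -size_filter; apply/card_eq_II; apply: card_eq_trans cK.
rewrite -(fset_setK fK); rewrite card_eq_sym; apply/card_eq_fsetP.
apply: perm_size; apply: uniq_perm; first exact: fset_uniq.
  exact/filter_uniq/walkers_of_uniq/exhaust_uniq.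
move=> l; rewrite mem_filter mem_walkers_of in_fset_set //.
apply/idP/idP; rewrite inE /= /K /=.
  move=> [l2 /eqP lx]; rewrite lx l2 andbT /=; apply: sub.
  apply/mapP; exists l => //; rewrite in_fset_set // inE; split => //; exact/eqP.
by move=> /andP[/eqP lx /andP[_ l2]].
Qed.

Lemma box_cvg_local (A : Type) J (H : Omega d -> A) : local_on J H ->
  {ae P, forall w, exists N, forall n, (N <= n)%N -> H (box (exhaust n) w) = H (eta s w)}.
Proof.
move=> Hl; apply: filterS box_cvg_site => w hw.
suff [N hN] : exists N, forall n, (N <= n)%N -> {in J, box (exhaust n) w =1 eta s w}.
  by exists N => n /hN/Hl.
elim: J {Hl} => [|x J [N hN]]; first by exists 0%N.
have [N' hN'] := hw x; exists (maxn N N') => n; rewrite geq_max => /andP[Nn N'n] y.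
by rewrite inE => /predU1P[->|]; [exact: hN' | exact: hN].
Qed.

Variable J : seq (Zd d).
Hypothesis uJ : uniq J.

Lemma box_integral_cvg (G H : Omega d -> R) M : local_on J H ->
  (forall m, `|H m| <= M) -> nu.-integrable [set: Omega d] (EFin \o G) ->
  P.-integrable [set: T] (EFin \o (fun w => G (eta 0 w) * H (eta s w))) /\
  (\int[P]_w (G (eta 0 w) * H (box (exhaust n) w)) @[n --> \oo] -->
     \int[P]_w (G (eta 0 w) * H (eta s w))).
Proof.
move=> Hl HM Gi; have iG := integrable_law (measurable_eta heta (lexx 0)) (eta0_law heta) Gi.
have mG : measurable_fun [set: T] (fun w => G (eta 0 w)).
  by have /integrableP[/measurable_EFinP] := iG.
apply: (Rintegral_eventually_eq (g := fun w => `|G (eta 0 w)| * M)).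
- by move=> n; apply: measurable_funM => //; exact: (measurable_box heta s0).
- by apply: measurable_funM => //; exact: (measurable_local (measurable_eta heta s0) Hl).
- by apply: filterS (box_cvg_local Hl) => w [N hN]; exists N => n /hN ->.
- have := integrableZl measurableT M (integrable_abse iG).
  by rewrite (_ : (fun x => _) = EFin \o (fun w => `|G (eta 0 w)| * M)) //;
    apply/funext => w; rewrite /= mulrC.
- by apply/aeW => w n; rewrite normrM ler_wpM2l.
Qed.

(** The limit of [box_dual].  The two integrals of [H] on the right cancel, up to the
differences contained in [walk_op]: the dual particle performs the walk [q]. *)
Lemma dual_particle_walk x t (H : Omega d -> R) M : local_on J H -> (forall m, `|H m| <= M) ->
  \int[P]_w (D (x :: t) (eta 0 w) * H (eta s w)) =
  \int[P]_w (D t (eta 0 w) * H (eta s w)) -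
  \int[P]_w (D t (eta 0 w) * walk_op q J x H (eta s w)).
Proof.
move=> Hl HM; have [Tl TM] := walk_op_local_bounded heta s0 uJ x Hl HM.
have di t' := dual_integrable hrho hnu t'.
have [_ c1] := box_integral_cvg Hl HM (di (x :: t)).
have [_ c2] := box_integral_cvg Hl HM (di t).
have [_ c3] := box_integral_cvg Tl TM (di t).
apply: (cvg_eventually_eq c1 (cvgB c2 c3)).
have [N hN] := sub_exhaust (x :: t); exists N => n /hN sub.
apply: (box_dual hrho hnu heta s0 uJ (exhaust_uniq n) _ _ Hl HM).
  by apply: sub; rewrite mem_head.
by move=> y yt; apply: sub; rewrite inE yt orbT.
Qed.

(** By symmetry this is the mass of the law at time [s] of the walker started from [y],
which has full mass because the walker is somewhere. *)
Lemma transition_sum_cvg y : \sum_(i <- exhaust n) q i y @[n --> \oo] --> (1 : R).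
Proof.
pose Y := X (y, 0%N) s.
have mY := measurable_walker heta s0 (y, 0%N).
have mN n : measurable [set w | Y w \in exhaust n].
  have [m _] := walker_notin_law heta s0 (y, 0%N) (exhaust_uniq n).
  rewrite (_ : mkset _ = ~` [set w | Y w \notin exhaust n]); first exact: measurableC.
  by apply/seteqP; split => w /= => [->//|/negP]; rewrite negbK.
have e n : \sum_(i <- exhaust n) q i y = \int[P]_w (Y w \in exhaust n)%:R.
  rewrite Rintegral_bool //.
  have [m Pm] := walker_notin_law heta s0 (y, 0%N) (exhaust_uniq n).
  rewrite (_ : [set w | _] = ~` [set w | Y w \notin exhaust n]); last first.
    by apply/seteqP; split => w /= => [->//|/negP]; rewrite negbK.
  transitivity (fine (P (~` [set w | Y w \notin exhaust n]))); last by [].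
  rewrite probability_setC // Pm -EFinB /= subKr; apply: eq_bigr => i _.
  by rewrite transition_sym.
have e1 : \int[P]_w (cst 1 w) = 1 :> R.
  by rewrite Rintegral_cst // (_ : _ setT = 1%E) ?mulr1 //; exact: probability_setT.
have [|||||_ c] := @Rintegral_eventually_eq _ _ _ P (fun n w => (Y w \in exhaust n)%:R) (cst 1) (cst 1);
  last by rewrite e1 in c; rewrite (funext e); exact: c.
- move=> n; rewrite (_ : (fun w => _) = \1_[set w | Y w \in exhaust n]); first exact: measurable_indic.
  apply/funext => w; rewrite indicE.
  by have -> : (w \in [set w | Y w \in exhaust n]) = (Y w \in exhaust n) by apply/idP/idP; rewrite inE.
- exact: measurable_cst.
- by apply/aeW => w; have [N hN] := sub_exhaust [:: Y w]; exists N => n /hN ->; rewrite ?mem_head.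
- exact: finite_measure_integrable_cst.
- by apply/aeW => w n; rewrite normr_nat lern1 leq_b1.
Qed.

(** The Mecke formula for [eta s], which characterizes its law. *)
Lemma mecke_eta y (H : Omega d -> R) M M' : y \in J -> local_on J H ->
  (forall m, `|H m| <= M) -> (forall m, `|count_op y H m| <= M') ->
  \int[P]_w (count_op y H (eta s w)) = rho * \int[P]_w (add_op y H (eta s w)).
Proof.
move=> yJ Hl HM MM.
have Ml : local_on J (count_op y H) by move=> m m' mm; rewrite /count_op (Hl _ _ mm) mm.
have Sl : local_on J (add_op y H).
  by move=> m m' mm; apply: Hl => z zJ; rewrite /add_particle mm.
have SM m : `|add_op y H m| <= M by exact: HM.
have i1 := finite_measure_integrable_cst nu 1 measurableT.
have cv (G : Omega d -> R) B : local_on J G -> (forall m, `|G m| <= B) ->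
    \int[P]_w (G (box (exhaust n) w)) @[n --> \oo] --> \int[P]_w (G (eta s w)).
  move=> Gl GB; have [_] := box_integral_cvg Gl GB i1.
  rewrite (eq_Rintegral _ (g := fun w => G (eta s w))); last by move=> w _; rewrite mul1r.
  apply: cvg_trans; apply: near_eq_cvg; apply: nearW => n.
  by apply: eq_Rintegral => w _; rewrite mul1r.
have c2 : (rho * (\sum_(i <- exhaust n) q i y) * \int[P]_w (add_op y H (box (exhaust n) w)))
    @[n --> \oo] --> rho * 1 * \int[P]_w (add_op y H (eta s w)).
  apply: cvgM; last exact: (cv _ _ Sl SM).
  by apply: cvgM; [exact: cvg_cst | exact: transition_sum_cvg].
rewrite mulr1 in c2.
apply: (cvg_eventually_eq (cv _ _ Ml MM) c2); exists 0%N => n _.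
exact: (box_count_op hrho hnu heta s0 uJ (exhaust_uniq n) yJ Hl HM MM).
Qed.

End Stationarity.

(** * Self-duality *)

Section Covariance.
Variables (R : realType) (d : nat) (p : Zd d -> Zd d -> R) (rho : R).
Hypothesis hp : jump_kernel p.
Hypothesis hrho : 0 < rho.
Variables (nu : probability (Omega d) R).
Hypothesis hnu : poisson_product rho nu.
Variables (disp : measure_display) (T : measurableType disp) (P : probability T R).
Variables (X : Zd d * nat -> R -> T -> Zd d) (eta : R -> T -> Omega d).
Hypothesis heta : independent_walkers p nu P X eta.
Variable s : R.
Hypothesis s0 : 0 <= s.

Local Notation q := (transition p s).
Local Notation D := (list_dual rho).
Local Notation ip := (dual_ip nu rho).
Let rho0 : rho != 0. Proof. by rewrite gt_eqF. Qed.
Let meta := measurable_eta heta s0.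

Lemma eta_site_recursion (J : seq (Zd d)) (c : Omega d) y n : uniq (y :: J) ->
  n.+1%:R * fine (P [set w | {in J, eta s w =1 c} /\ eta s w y = n.+1]) =
  rho * fine (P [set w | {in J, eta s w =1 c} /\ eta s w y = n]).
Proof.
move=> uyJ; have /andP[yJ uJ] := uyJ.
pose b k (mu : Omega d) := all (fun z => mu z == c z) J && (mu y == k).
have bP k : [set w | {in J, eta s w =1 c} /\ eta s w y = k] = [set w | b k (eta s w)].
  apply/seteqP; split => w /=.
    by move=> [h hy]; rewrite /b hy eqxx andbT; apply/allP => z zJ /=; rewrite h.
  by move=> /andP[/allP h /eqP hy]; split => // z zJ; exact/eqP/h.
have mb k : measurable [set w | b k (eta s w)].
  rewrite -bP; have := measurableI _ _ (measurable_sites J c meta)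
    (measurable_sites [:: y] (fun=> k) meta).
  congr measurable; apply/seteqP; split => w /= [h1 h2]; split => //.
    by rewrite h2 ?mem_head.
  by move=> z; rewrite inE => /eqP ->.
have bl k : local_on (y :: J) (fun mu => (b k mu)%:R : R).
  move=> m m' mm; rewrite /b mm ?mem_head //; congr ((_ && _)%:R).
  by apply: eq_in_all => z zJ; rewrite mm // inE zJ orbT.
have b1 k (m : Omega d) : `|(b k m)%:R| <= 1 :> R by rewrite normr_nat lern1 leq_b1.
have Mb (m : Omega d) : count_op y (fun mu => (b n.+1 mu)%:R) m = n.+1%:R * (b n.+1 m)%:R :> R.
  by rewrite /count_op; case: (boolP (b n.+1 m)) => [/andP[_ /eqP ->]//|_]; rewrite !mulr0.
have MM (m : Omega d) : `|count_op y (fun mu => (b n.+1 mu)%:R) m| <= n.+1%:R :> R.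
  by rewrite Mb normrM normr_nat ler_piMr // b1.
have := mecke_eta hp hrho hnu heta s0 uyJ (mem_head y J) (bl n.+1) (b1 n.+1) MM.
rewrite (eq_Rintegral _ (g := fun w => n.+1%:R * (b n.+1 (eta s w))%:R)); last first.
  by move=> w _; rewrite Mb.
rewrite RintegralZl //; last first.
  apply: (@integrable_bounded _ _ _ P _ 1) => //.
  exact: (measurable_local meta (bl n.+1)).
rewrite Rintegral_bool // bP => ->; rewrite bP; congr (_ * _).
rewrite -Rintegral_bool //; apply: eq_Rintegral => w _; rewrite /add_op /b /add_particle eqxx addn1 eqSS.
congr ((_ && _)%:R); apply: eq_in_all => z zJ.
by have [zy|_] := eqVneq z y; [rewrite -zy zJ in yJ | rewrite addn0].
Qed.

(** [eta_site_recursion] determines the probabilities of the events [B n] up to a common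
factor [kappa], and the sum over [n] shows that [kappa] is the probability of the
cylinder on the remaining sites. *)
Lemma eta_cylinder (J : seq (Zd d)) (c : Omega d) : uniq J ->
  P [set w | {in J, eta s w =1 c}] = (\prod_(x <- J) poisson_pmf rho (c x))%:E.
Proof.
elim: J c => [|y J IH] c uJ.
  rewrite big_nil (_ : mkset _ = setT); last by apply/seteqP; split.
  exact: probability_setT.
have /andP[yJ uJ'] := uJ; have PA := IH c uJ'.
pose B n := [set w | {in J, eta s w =1 c} /\ eta s w y = n].
have mB n : measurable (B n).
  have := measurableI _ _ (measurable_sites J c meta)
    (measurable_sites [:: y] (fun=> n) meta).
  congr measurable; apply/seteqP; split => w /= [h1 h2]; split => //.
    by rewrite h2 ?mem_head.
  by move=> z; rewrite inE => /eqP ->.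
have pmf0 n : 0 < poisson_pmf rho n.
  by rewrite /poisson_pmf hrho mulr_gt0 ?expR_gt0 // divr_gt0 ?exprn_gt0 // ltr0n fact_gt0.
pose kappa := fine (P (B 0%N)) / poisson_pmf rho 0.
have BE n : fine (P (B n)) = kappa * poisson_pmf rho n.
  elim: n => [|n IHn]; first by rewrite /kappa divfK // gt_eqF.
  apply: (@mulfI _ n.+1%:R); first by rewrite pnatr_eq0.
  by rewrite eta_site_recursion // IHn mulrCA -poisson_pmfS //; ring.
have kappa0 : 0 <= kappa by rewrite divr_ge0 ?fine_ge0 // ltW.
have PBE n : P (B n) = (kappa%:E * nu [set mu : Omega d | mu y = n])%E.
  rewrite -[LHS]fineK ?fin_num_measure // BE EFinM; congr (_ * _)%E.
  have := hnu [fset y]%fset (fun=> n); rewrite big_seq_fset1 => <-; congr (nu _).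
  apply/seteqP; split => mu /=; first by apply; rewrite inE.
  by move=> e z; rewrite inE => /eqP ->.
have PAk : P [set w | {in J, eta s w =1 c}] = kappa%:E.
  have -> : [set w | {in J, eta s w =1 c}] = \bigcup_n B n.
    by apply/seteqP; split => w /=; [move=> h; exists (eta s w y) | move=> [n _ []]].
  rewrite measure_bigcup //; last by move=> i j _ _ [w [[_ <-] [_ <-]]].
  rewrite (eq_eseriesr (g := fun n => (kappa%:E * nu [set mu : Omega d | mu y = n])%E)); last first.
    by move=> n _; exact: PBE.
  rewrite nneseriesZl; last by move=> n _; exact: measure_ge0.
  rewrite -measure_bigcup; last 2 first.
  - by move=> n _; exact: measurable_site.
  - by move=> i j _ _ [w [/= <- <-]].
  rewrite (_ : \bigcup_n _ = setT); last by apply/seteqP; split => // mu _; exists (mu y).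
  by rewrite (_ : _ setT = 1%E) ?mule1 //; exact: probability_setT.
rewrite (_ : mkset _ = B (c y)); last first.
  apply/seteqP; split => w /=.
    by move=> h; split=> [z zJ|]; apply: h; rewrite inE ?eqxx ?zJ ?orbT.
  by move=> [h hy] z; rewrite inE => /predU1P[->|/h].
rewrite -[LHS]fineK ?fin_num_measure // BE big_cons mulrC; congr (_ * _)%:E.
by apply: EFin_inj; rewrite -PAk.
Qed.

Lemma eta_law A : measurable A -> P (eta s @^-1` A) = nu A.
Proof.
move=> mA; apply: (poisson_unique hnu (mu := image_measure P meta)) mA => J n.
exact: (eta_cylinder (J := enum_fset J) n (fset_uniq J)).
Qed.

(** By stationarity both factors are square integrable. *)
Lemma cov_integrable a b :
  P.-integrable [set: T] (EFin \o (fun w => D a (eta 0 w) * D b (eta s w))).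
Proof.
have i1 := integrable_law (measurable_eta heta (lexx 0)) (eta0_law heta)
  (dual_pair_integrable hrho hnu rho0 a a).
have i2 := integrable_law meta eta_law (dual_pair_integrable hrho hnu rho0 b b).
apply: (@le_integrable _ _ _ P _ measurableT _ _ _ _ (integrableD measurableT i1 i2)).
- apply/measurable_EFinP; apply: measurable_funM.
    exact: (measurable_local (measurable_eta heta (lexx 0)) (@list_dual_local _ _ rho a)).
  exact: (measurable_local meta (@list_dual_local _ _ rho b)).
- move=> w _ /=; rewrite lee_fin; move: (D a _) (D b _) => u v.
  rewrite [leRHS]ger0_norm; last by nra.
  by rewrite ler_norml; apply/andP; split; nra.
Qed.

(** Truncation makes [dual_particle_walk] applicable to the dual polynomials, which
are unbounded. *)
Definition clip (n : nat) (H : Omega d -> R) : Omega d -> R :=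
  fun m => Num.max (- n%:R) (Num.min n%:R (H m)).

Lemma clip_bounded n H m : `|clip n H m| <= n%:R.
Proof.
have n0 : (0 : R) <= n%:R by [].
rewrite /clip ler_norml le_max lexx /= ge_max ge_min lexx /= andbT.
by rewrite (le_trans _ n0) // oppr_le0.
Qed.

Lemma clipE n H m : `|H m| <= n%:R -> clip n H m = H m.
Proof.
rewrite ler_norml /clip => /andP[h1 h2].
by rewrite (min_idPr h2) (max_idPr h1).
Qed.

Lemma clip_norm_le n H m : `|clip n H m| <= `|H m|.
Proof.
have n0 : (0 : R) <= n%:R by [].
have [h|h] := leP `|H m| n%:R; first by rewrite clipE.
exact: le_trans (clip_bounded n H m) (ltW h).
Qed.

Lemma clip_local n J H : local_on J H -> local_on J (clip n H).
Proof. by move=> Hl m m' mm; rewrite /clip (Hl _ _ mm). Qed.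

Definition cov a b := \int[P]_w (D a (eta 0 w) * D b (eta s w)).

(** In [dual_particle_walk] with [H] the dual of [b], the differences of [H] are given
by [list_dual_add_particle]: the dual particle at [x] moves to a site [z] of [b] and is paired
with one of the particles of [b] at [z]. *)
Lemma cov_cons x a b : cov (x :: a) b =
  \sum_(z <- undup b) q x z * ((count_mem z b)%:R / rho) * cov a (rem z b).
Proof.
have uJ := undup_uniq b; set J := undup b in uJ *.
have Dl : local_on J (D b).
  by move=> m m' mm; apply: list_dual_local => z zb; apply: mm; rewrite mem_undup.
have m0 t : measurable_fun [set: T] (fun w => D t (eta 0 w)).
  exact: (measurable_local (measurable_eta heta (lexx 0)) (@list_dual_local _ _ rho t)).
have mH (H : Omega d -> R) : local_on J H -> measurable_fun [set: T] (fun w => H (eta s w)).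
  by move=> Hl; exact: (measurable_local meta Hl).
have lim t : \int[P]_w (D t (eta 0 w) * clip n (D b) (eta s w)) @[n --> \oo] --> cov t b.
  have [|||||_ c] := @Rintegral_eventually_eq _ _ _ P
    (fun n w => D t (eta 0 w) * clip n (D b) (eta s w))
    (fun w => D t (eta 0 w) * D b (eta s w)) (fun w => `|D t (eta 0 w) * D b (eta s w)|);
    last exact: c.
  - by move=> n; apply: measurable_funM => //; apply: mH; exact: clip_local.
  - by apply: measurable_funM => //; exact: mH.
  - apply/aeW => w; exists (Num.bound (D b (eta s w))) => n Nn; rewrite clipE //.
    apply/ltW; apply: lt_le_trans (unstable.ltr_norm_bound _) _.
    by rewrite ler_nat.
  - exact: (integrable_abse (cov_integrable t b)).
  - by apply/aeW => w n; rewrite !normrM ler_wpM2l // clip_norm_le.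
have ish z : P.-integrable [set: T] (EFin \o (fun w => D a (eta 0 w) * D b (add_particle (eta s w) z))).
  rewrite (_ : (fun w => _) = (fun w => D a (eta 0 w) * D b (eta s w) -
     ((count_mem z b)%:R / rho) * (D a (eta 0 w) * D (rem z b) (eta s w)))).
    by apply: integrable_subZ; exact: cov_integrable.
  by apply/funext => w; rewrite list_dual_add_particle //; ring.
(* A majorant for all truncation levels at once. *)
pose env w := `|D a (eta 0 w) * D b (eta s w)| + \sum_(z <- J) q x z *
  (`|D a (eta 0 w) * D b (add_particle (eta s w) z)| + `|D a (eta 0 w) * D b (eta s w)|).
have q0 z : 0 <= q x z by exact: (transition_ge0 heta s0).
have limT : \int[P]_w (D a (eta 0 w) * walk_op q J x (clip n (D b)) (eta s w)) @[n --> \oo] -->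
    \int[P]_w (D a (eta 0 w) * walk_op q J x (D b) (eta s w)).
  have [|||||_ c] := @Rintegral_eventually_eq _ _ _ P
    (fun n w => D a (eta 0 w) * walk_op q J x (clip n (D b)) (eta s w))
    (fun w => D a (eta 0 w) * walk_op q J x (D b) (eta s w)) env; last exact: c.
  - by move=> n; apply: measurable_funM => //; apply: mH; apply: walk_op_local; exact: clip_local.
  - by apply: measurable_funM => //; apply: mH; exact: walk_op_local.
  - apply/aeW => w.
    have ev (m : Omega d) : exists N, forall n, (N <= n)%N -> clip n (D b) m = D b m.
      exists (Num.bound (D b m)) => n Nn; rewrite clipE //.
      by apply/ltW; apply: lt_le_trans (unstable.ltr_norm_bound _) _; rewrite ler_nat.
    have [N hN] := ev (eta s w).
    suff [N' hN'] : exists N', forall n, (N' <= n)%N ->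
        forall z, z \in J -> clip n (D b) (add_particle (eta s w) z) = D b (add_particle (eta s w) z).
      exists (maxn N N') => n; rewrite geq_max => /andP[/hN e1 /hN' e2].
      congr (_ * _); rewrite /walk_op e1; congr (_ + _).
      by apply: eq_big_seq => z zJ; rewrite e2.
    elim: (J) => [|z J' [N1 h1]]; first by exists 0%N.
    have [N2 h2] := ev (add_particle (eta s w) z); exists (maxn N1 N2) => n.
    rewrite geq_max => /andP[n1 n2] z'; rewrite inE => /predU1P[->|]; [exact: h2|exact: h1].
  - have iA z : P.-integrable [set: T] (EFin \o (fun w =>
        `|D a (eta 0 w) * D b (add_particle (eta s w) z)| + `|D a (eta 0 w) * D b (eta s w)|)).
      have := integrableD measurableT (integrable_abse (ish z)) (integrable_abse (cov_integrable a b)).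
      by [].
    have [iS _] := Rintegral_sumZ J (q x) iA.
    have := integrableD measurableT (integrable_abse (cov_integrable a b)) iS.
    by [].
  - apply/aeW => w n; rewrite /env normrM /walk_op.
    apply: le_trans (ler_wpM2l (normr_ge0 _) (ler_normD _ _)) _; rewrite mulrDr.
    apply: lerD; first by rewrite normrM ler_wpM2l // clip_norm_le.
    apply: le_trans (ler_wpM2l (normr_ge0 _) (ler_norm_sum _ _ _)) _.
    rewrite mulr_sumr; apply: ler_sum => z _; rewrite normrM (ger0_norm (q0 z)) mulrCA.
    rewrite ler_wpM2l // !normrM -mulrDr ler_wpM2l //.
    apply: le_trans (ler_normB _ _) _; apply: lerD; exact: clip_norm_le.
have e : cov (x :: a) b = cov a b - \int[P]_w (D a (eta 0 w) * walk_op q J x (D b) (eta s w)).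
  apply: (cvg_eventually_eq (lim (x :: a)) (cvgB (lim a) limT)); exists 0%N => n _.
  exact: (dual_particle_walk hrho hnu heta s0 uJ x a (clip_local n Dl) (clip_bounded n (D b))).
rewrite e (eq_Rintegral _ (g := fun w => D a (eta 0 w) * D b (eta s w) -
   1 * \sum_(z <- J) (q x z * ((count_mem z b)%:R / rho)) *
     (D a (eta 0 w) * D (rem z b) (eta s w)))); last first.
  move=> w _; rewrite /walk_op mulrDr mul1r; congr (_ + _).
  rewrite mulr_sumr -sumrN; apply: eq_bigr => z _; rewrite list_dual_add_particle //; ring.
have [iS eS] := Rintegral_sumZ J (fun z => q x z * ((count_mem z b)%:R / rho))
  (fun z => cov_integrable a (rem z b)).
rewrite Rintegral_subZ //; last exact: cov_integrable.
by rewrite eS mul1r subKr.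
Qed.

Lemma cov_nil b : cov [::] b = ip [::] b.
Proof.
rewrite /cov (eq_Rintegral _ (g := fun w => D [::] (eta s w) * D b (eta s w))); last first.
  by move=> w _; rewrite !list_dual_nil.
apply: (Rintegral_law meta eta_law (F := fun m => D [::] m * D b m)).
by apply: measurable_funM; exact: measurable_list_dual.
Qed.

Lemma cov_size a b : size a != size b -> cov a b = 0.
Proof.
elim: a b => [|x a IH] b; first by move=> h; rewrite cov_nil (dual_ip_size hrho hnu).
move=> h; rewrite cov_cons big_seq big1 // => z; rewrite mem_undup => zb.
by rewrite IH ?mulr0 // size_rem //; case: b zb h.
Qed.

(** Pairing off the particles of [a] one at a time gives a factor [\sum_z q x z] over the
sites of what is left of [b].  It is at most 1, and at most [n e] when [n] particles are
left.  The second estimate is used for the last [k] particles only, which makes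
the constant independent of the number of particles.  The weights
[count_mem z b / rho] turn the norm of [rem z b] into that of [b]. *)
Lemma cov_bound (e : R) k a b : (forall i z, q i z <= e) -> size a = size b ->
  (k <= size a)%N -> `|cov a b| <= ip b b * (k`!%:R * e ^+ k).
Proof.
move=> qe; have e0 : 0 <= e.
  by apply: le_trans (qe 0 0); exact: (transition_ge0 heta s0).
have q0 i z : 0 <= q i z by exact: (transition_ge0 heta s0).
have step x a' b' B c : 0 <= B -> \sum_(z <- undup b') q x z <= c ->
    (forall z, z \in b' -> `|cov a' (rem z b')| <= ip (rem z b') (rem z b') * B) ->
    `|cov (x :: a') b'| <= ip b' b' * (c * B).
  move=> B0 qc hB; rewrite cov_cons; apply: le_trans (ler_norm_sum _ _ _) _.
  apply: (@le_trans _ _ (\sum_(z <- undup b') q x z * (ip b' b' * B))).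
    rewrite big_seq [leRHS]big_seq; apply: ler_sum => z; rewrite mem_undup => zb.
    rewrite normrM normrM (ger0_norm (q0 x z)) -mulrA ler_wpM2l //.
    rewrite (dual_sqnorm_rem hrho hnu zb) -[leRHS]mulrA.
    have r0 : 0 <= (count_mem z b')%:R / rho by rewrite divr_ge0 // ltW.
    by rewrite (ger0_norm r0) ler_wpM2l // hB.
  rewrite -mulr_suml [leRHS]mulrCA.
  by rewrite ler_wpM2r // mulr_ge0 // dual_sqnorm_ge0.
(* The last [k] particles. *)
have base n a' b' : size a' = n -> size b' = n -> `|cov a' b'| <= ip b' b' * (n`!%:R * e ^+ n).
  elim: n a' b' => [|n IH] [|x a'] b' //=.
    move=> _ /size0nil ->; rewrite cov_nil expr0 fact0 !mulr1 ger0_norm //.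
    exact: dual_sqnorm_ge0.
  move=> [an] bn; rewrite factS natrM exprS mulrACA.
  apply: step => [||z zb]; first by rewrite mulr_ge0 // exprn_ge0.
    apply: (@le_trans _ _ (\sum_(z <- undup b') e)); first exact: ler_sum.
    rewrite big_const_seq count_predT iter_addr_0 -[leLHS]mulr_natl ler_wpM2r //.
    by rewrite ler_nat -bn size_undup.
  by apply: IH => //; rewrite size_rem // bn.
elim: a b => [|x a IH] b ab ka.
  by rewrite leqn0 in ka; rewrite (eqP ka); apply: base.
have [kn|kn] := eqVneq k (size a).+1; first by rewrite kn; apply: base.
rewrite -[k`!%:R * _]mul1r; apply: step => [||z zb].
- by rewrite mulr_ge0 // exprn_ge0.
- exact: (transition_sum_le1 heta s0 _ (undup_uniq b)).
by apply: IH; [rewrite size_rem // -ab | rewrite -ltnS ltn_neqAle kn].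
Qed.

End Covariance.

(** * Square-integrable functions *)

Section SquareIntegrable.
Variables (disp : measure_display) (T : measurableType disp) (R : realType).
Variable mu : {measure set T -> \bar R}.
Implicit Types F G : T -> R.

Definition square_integrable F := measurable_fun [set: T] F /\
  mu.-integrable [set: T] (EFin \o (fun x => F x ^+ 2)).

Lemma square_integrable_mul F G : square_integrable F -> square_integrable G ->
  mu.-integrable [set: T] (EFin \o (fun x => F x * G x)).
Proof.
move=> [mF iF] [mG iG].
apply: (@le_integrable _ _ _ mu _ measurableT _ _ _ _ (integrableD measurableT iF iG)).
- by apply/measurable_EFinP; exact: measurable_funM.
- move=> w _ /=; rewrite lee_fin; move: (F _) (G _) => u v.
  rewrite [leRHS]ger0_norm; last by nra.
  by rewrite ler_norml; apply/andP; split; nra.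
Qed.

Lemma square_integrable_subZ F G a : square_integrable F -> square_integrable G ->
  square_integrable (fun x => F x - a * G x).
Proof.
move=> sF sG; have iFG := square_integrable_mul sF sG; case: sF sG => mF iF [mG iG]; split.
  by apply: measurable_funB => //; exact: measurable_funM.
rewrite (_ : (fun x => _ ^+ 2) = fun x => (F x ^+ 2 - (2 * a) * (F x * G x)) - (- a ^+ 2) * G x ^+ 2).
  by apply: integrable_subZ => //; exact: integrable_subZ.
by apply/funext => x; ring.
Qed.

Lemma square_integrable_B F G : square_integrable F -> square_integrable G -> square_integrable (fun x => F x - G x).
Proof.
move=> sF sG; have := square_integrable_subZ 1 sF sG.
by rewrite (_ : (fun x => F x - 1 * G x) = (fun x => F x - G x)) //; apply/funext => x; rewrite mul1r.
Qed.

Lemma square_integrable0 : square_integrable (fun=> 0).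
Proof.
split; first exact: measurable_cst.
rewrite (_ : _ \o _ = cst 0%E); first exact: integrable0.
by apply/funext => x; rewrite /= expr0n.
Qed.

Lemma square_integrable_sum (K : Type) (r : seq K) (c : K -> R) (f : K -> T -> R) :
  (forall i, square_integrable (f i)) -> square_integrable (fun x => \sum_(i <- r) c i * f i x).
Proof.
move=> sf; elim: r => [|i r IH].
  by rewrite (_ : (fun x => _) = fun=> 0); [exact: square_integrable0 | apply/funext => x; rewrite big_nil].
rewrite (_ : (fun x => _) = fun x => \sum_(i <- r) c i * f i x - (- c i) * f i x).
  exact: square_integrable_subZ.
by apply/funext => x; rewrite big_cons mulNr opprK addrC.
Qed.

(** The pointwise inequality [|u v| <= (b/a) u^2 / 2 + (a/b) v^2 / 2] with the weights
for which it is sharp. *)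
Lemma Rintegral_Cauchy_Schwarz F G a b : 0 < a -> 0 < b -> square_integrable F -> square_integrable G ->
  \int[mu]_x (F x ^+ 2) <= a ^+ 2 -> \int[mu]_x (G x ^+ 2) <= b ^+ 2 ->
  `|\int[mu]_x (F x * G x)| <= a * b.
Proof.
move=> a0 b0 sF sG Fa Gb; have iFG := square_integrable_mul sF sG; case: sF sG => mF iF [mG iG].
have main H : mu.-integrable [set: T] (EFin \o H) ->
    (forall x, H x <= (b / a / 2) * F x ^+ 2 - (- (a / b / 2)) * G x ^+ 2) ->
    \int[mu]_x H x <= a * b.
  move=> iH HH; apply: (@le_trans _ _ (\int[mu]_x
      ((b / a / 2) * F x ^+ 2 - (- (a / b / 2)) * G x ^+ 2))).
    apply: le_Rintegral => //; apply: integrable_subZ => //; exact: (integrableZl measurableT _ iF).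
  rewrite Rintegral_subZ //; last exact: (integrableZl measurableT _ iF).
  rewrite RintegralZl // mulNr opprK.
  have ca : 0 <= b / a / 2 by rewrite !divr_ge0 // ltW.
  have cb : 0 <= a / b / 2 by rewrite !divr_ge0 // ltW.
  apply: le_trans (lerD (ler_wpM2l ca Fa) (ler_wpM2l cb Gb)) _.
  by rewrite le_eqVlt; apply/orP; left; apply/eqP; field; rewrite !gt_eqF.
have key (u v : R) : `|u * v| <= (b / a / 2) * u ^+ 2 - (- (a / b / 2)) * v ^+ 2.
  have ab : 0 < a * b by rewrite mulr_gt0.
  rewrite -(ler_pM2l ab) mulNr opprK normrM.
  have -> : a * b * (b / a / 2 * u ^+ 2 + a / b / 2 * v ^+ 2) =
      ((b * `|u|) ^+ 2 + (a * `|v|) ^+ 2) / 2.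
    by rewrite !exprMn !real_normK ?num_real //; field; rewrite !gt_eqF.
  rewrite -subr_ge0 (_ : _ - _ = (b * `|u| - a * `|v|) ^+ 2 / 2); last by field.
  by rewrite divr_ge0 // sqr_ge0.
rewrite ler_norml; apply/andP; split.
  rewrite lerNl -[- _]mulN1r -RintegralZl //; apply: main.
    exact: (integrableZl measurableT (-1) iFG).
  move=> x; apply: le_trans (key (F x) (G x)).
  by rewrite mulN1r -normrN ler_norm.
by apply: main => // x; apply: le_trans (key (F x) (G x)); rewrite ler_norm.
Qed.

Lemma square_integrable_Lnorm F e : 0 < e -> measurable_fun [set: T] F ->
  ('N[mu]_2%:E[EFin \o F] < e%:E)%E ->
  square_integrable F /\ \int[mu]_x (F x ^+ 2) <= e ^+ 2.
Proof.
move=> e0 mF Ne.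
have N0 := Lnorm_ge0 mu 2%:E (EFin \o F).
have : ('N[mu]_2%:E[EFin \o F] `^ 2 <= (e ^+ 2)%:E)%E.
  rewrite -powR_mulrn ?(ltW e0) // -poweR_EFin gt0_ler_poweR ?ltW // ?in_itv /= ?leey ?andbT //.
  by rewrite lee_fin ltW.
rewrite powR_Lnorm //.
have E x : (`|(EFin \o F) x| `^ 2 = (F x ^+ 2)%:E)%E.
  by rewrite /= powR_mulrn // real_normK // num_real.
under eq_integral do rewrite E.
move=> h; have iF : mu.-integrable [set: T] (EFin \o (fun x => F x ^+ 2)).
  apply/integrableP; split; first by apply/measurable_EFinP; exact: measurable_funX.
  under eq_integral do rewrite /= ger0_norm ?sqr_ge0 //.
  exact: le_lt_trans h (ltry _).
split=> //; rewrite /Rintegral -[leRHS]/(fine (e ^+ 2)%:E) fine_le //.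
exact: integrable_fin_num.
Qed.

Lemma Lfun_square_integrable F : F \in Lfun mu 2%:E -> square_integrable F.
Proof.
move=> lF; split; last exact: Lfun2_integrable_sqr.
by move: lF; rewrite inE => /andP[]; rewrite inE.
Qed.

End SquareIntegrable.

Section SquareLaw.
Variables (R : realType) (d : nat) (disp : measure_display) (T : measurableType disp).
Variables (P : {measure set T -> \bar R}) (nu : {measure set (Omega d) -> \bar R}).
Variable phi : T -> Omega d.
Hypothesis mphi : measurable_fun [set: T] phi.
Hypothesis law : forall A, measurable A -> P (phi @^-1` A) = nu A.

Lemma square_integrable_law (F : Omega d -> R) : square_integrable nu F ->
  square_integrable P (F \o phi) /\ \int[P]_w (F (phi w) ^+ 2) = \int[nu]_c (F c ^+ 2).
Proof.
move=> [mF iF]; split; first split.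
- exact: measurableT_comp mF mphi.
- exact: (integrable_law mphi law iF).
- by apply: (Rintegral_law mphi law (F := fun c => F c ^+ 2)); exact: measurable_funX.
Qed.

End SquareLaw.

(** * The chaos expansion *)

Section Chaos.
Variables (R : realType) (d : nat) (rho : R).
Hypothesis hrho : 0 < rho.
Variables (nu : probability (Omega d) R).
Hypothesis hnu : poisson_product rho nu.
Local Notation D := (list_dual rho).
Local Notation ip := (dual_ip nu rho).
Let rho0 : rho != 0. Proof. by rewrite gt_eqF. Qed.

(** Links finitely supported configurations to the lists that index the duals. *)
Definition site_list (xi : Omegaf d) : seq (Zd d) := sites_of (finsupp xi) xi.

Lemma dualE xi eta : dual rho xi eta = D (site_list xi) eta.
Proof.
rewrite (@list_dualE _ _ rho _ (finsupp xi)) ?fset_uniq //; last first.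
  move=> x; rewrite -has_pred1 has_count count_sites_of ?fset_uniq //.
  by case: (x \in finsupp xi); rewrite ?muln0.
apply: eq_big_seq => x xs; congr charlier.
by rewrite count_sites_of ?fset_uniq // xs muln1.
Qed.

Lemma dual_funE xi : dual rho xi = D (site_list xi).
Proof. by apply/funext => eta; rewrite dualE. Qed.

Lemma massE xi : mass xi = size (site_list xi).
Proof.
rewrite /mass /site_list /sites_of size_flatten /shape -map_comp sumnE big_map.
by apply: eq_bigr => x _; rewrite /= size_nseq.
Qed.

Lemma dual_sqnormE xi : dual_sqnorm rho nu xi = ip (site_list xi) (site_list xi).
Proof. by apply: eq_Rintegral => eta _; rewrite dualE expr2. Qed.

Lemma dual_square_integrable xi : square_integrable nu (dual rho xi).
Proof.
rewrite dual_funE; split; first exact: measurable_list_dual.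
have := dual_pair_integrable hrho hnu rho0 (site_list xi) (site_list xi).
by rewrite (_ : (fun eta => _ * _) = (fun eta => D (site_list xi) eta ^+ 2)) //; apply/funext => c; rewrite expr2.
Qed.

Lemma dual_orthogonal xi xi' : mass xi != mass xi' ->
  \int[nu]_c (dual rho xi c * dual rho xi' c) = 0.
Proof.
move=> mm; rewrite (eq_Rintegral _ (g := fun c : Omega d => D (site_list xi) c * D (site_list xi') c)).
  by apply: (dual_ip_size hrho hnu); rewrite -!massE.
by move=> c _; rewrite !dualE.
Qed.

Lemma dual_chaos n xi : (mass xi <= n)%N -> chaos rho nu n (dual rho xi).
Proof.
move=> mn; have [mD iD] := dual_square_integrable xi; split.
  rewrite inE; apply/andP; split; first by rewrite inE.
  rewrite inE /finite_norm /= unlock.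
  rewrite poweR_lty //.
  rewrite (eq_integral (fun c => (dual rho xi c ^+ 2)%:E)); last first.
    by move=> c _; rewrite /= powR_mulrn // real_normK // num_real.
  have /integrableP[_] := iD; under eq_integral do rewrite /= ger0_norm ?sqr_ge0 //.
  by [].
move=> e e0; exists [:: xi], (fun=> 1); split; first by move=> x; rewrite inE => /eqP ->.
rewrite (@eq_Lnorm _ _ _ nu 2%:E _ (cst 0%E)); first by rewrite Lnorm0 ?lte_fin.
by move=> c; rewrite /= big_seq1 mul1r subrr.
Qed.

Lemma chaos_square_integrable n h : chaos rho nu n h -> square_integrable nu h.
Proof. by move=> [/Lfun_square_integrable]. Qed.

Lemma Rintegral_sum_mul (K : Type) (r : seq K) (c : K -> R) (F : K -> Omega d -> R) G :
  (forall i, square_integrable nu (F i)) -> square_integrable nu G ->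
  \int[nu]_x ((\sum_(i <- r) c i * F i x) * G x) =
  \sum_(i <- r) c i * \int[nu]_x (F i x * G x).
Proof.
move=> sF sG; rewrite -(proj2 (Rintegral_sumZ r c (fun i => square_integrable_mul (sF i) sG))).
by apply: eq_Rintegral => x _; rewrite mulr_suml; apply: eq_bigr => i _; rewrite mulrA.
Qed.

Lemma square_integrable_bound (h : Omega d -> R) : exists2 B : R, 0 < B & \int[nu]_x (h x ^+ 2) <= B ^+ 2.
Proof.
exists (1 + `|\int[nu]_x (h x ^+ 2)|); first by rewrite ltr_pwDl.
move: (\int[nu]_x _) => u; apply: le_trans (ler_norm u) _; have := normr_ge0 u; nra.
Qed.

(** Density: an element of the chaos is approximated by duals orthogonal to
[dual rho xi]. *)
Lemma chaos_orthogonal n xi h : (n < mass xi)%N -> chaos rho nu n h ->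
  \int[nu]_c (dual rho xi c * h c) = 0.
Proof.
move=> nxi ch; have sh := chaos_square_integrable ch; have sx := dual_square_integrable xi.
have [B B0 hB] := square_integrable_bound (dual rho xi).
apply/eqP; rewrite -normr_le0; apply/ler_addgt0Pr => e e0; rewrite add0r.
have eB : 0 < e / B by rewrite divr_gt0.
have [s [c [sm Ns]]] := ch.2 _ eB.
have ss := square_integrable_sum s c dual_square_integrable.
have [sr hr] := square_integrable_Lnorm eB (proj1 (square_integrable_B sh ss)) Ns.
have -> : \int[nu]_x (dual rho xi x * h x) = \int[nu]_x (dual rho xi x * (h x - \sum_(x0 <- s) c x0 * dual rho x0 x)).
  have e1 : (fun x => dual rho xi x * (h x - \sum_(x0 <- s) c x0 * dual rho x0 x)) =
      fun x => dual rho xi x * h x - 1 * ((\sum_(x0 <- s) c x0 * dual rho x0 x) * dual rho xi x).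
    by apply/funext => x; ring.
  rewrite e1 Rintegral_subZ; [|exact: square_integrable_mul|exact: square_integrable_mul].
  rewrite Rintegral_sum_mul // ?mul1r; last exact: dual_square_integrable.
  rewrite big_seq big1 ?subr0 // => y ys; rewrite dual_orthogonal ?mulr0 //.
  by rewrite neq_ltn (leq_ltn_trans (sm y ys)).
apply: le_trans (Rintegral_Cauchy_Schwarz B0 eB sx sr hB hr) _.
by rewrite mulrC divfK // gt_eqF.
Qed.

Variables (f : Omega d -> R) (C : Omegaf d -> R) (k : nat) (fk : Omega d -> R).
Hypothesis hf : f \in Lfun nu 2%:E.
Hypothesis hC : has_expansion rho nu f C.
Hypothesis hk : (1 <= k)%N.
Hypothesis hfk : chaos_projection rho nu (k - 1) f fk.

Lemma remainder_square_integrable : square_integrable nu (fun c => f c - fk c).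
Proof. by apply: square_integrable_B; [exact: Lfun_square_integrable | exact: chaos_square_integrable hfk.1]. Qed.

(** Let [h] and [l] be the parts of mass [>= k] and [< k] of a partial sum close to [f].
Then [f - (h + l)] is the sum of [f - fk - h] and [fk - l], which are orthogonal: dropping
the second one can only decrease the norm. *)
Lemma chaos_expansion e : 0 < e -> exists S : {fset Omegaf d},
  (forall xi, xi \in S -> (k <= mass xi)%N) /\
  \int[nu]_c ((f c - fk c - \sum_(xi <- S) C xi * dual rho xi c) ^+ 2) <= e ^+ 2.
Proof.
move=> e0; have [S0 hS0] := hC e0; have {hS0} Ne := hS0 S0 (fsubset_refl S0).
exists [fset xi in S0 | (k <= mass xi)%N]%fset; split.
  by move=> xi; rewrite !inE => /andP[].
have sf := Lfun_square_integrable hf; have sfk := chaos_square_integrable hfk.1.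
pose h c := \sum_(xi <- S0 | (k <= mass xi)%N) C xi * dual rho xi c.
pose l c := \sum_(xi <- S0 | ~~ (k <= mass xi)%N) C xi * dual rho xi c.
have hE c : \sum_(xi <- [fset xi in S0 | (k <= mass xi)%N]%fset) C xi * dual rho xi c = h c.
  by rewrite big_fset.
under eq_Rintegral do rewrite hE.
have sh : square_integrable nu h.
  rewrite /h; under [X in square_integrable _ X]funext do rewrite -big_filter.
  exact: square_integrable_sum dual_square_integrable.
have sl : square_integrable nu l.
  rewrite /l; under [X in square_integrable _ X]funext do rewrite -big_filter.
  exact: square_integrable_sum dual_square_integrable.
have sS := square_integrable_sum S0 C dual_square_integrable.
have [sr hr] := square_integrable_Lnorm e0 (proj1 (square_integrable_B sf sS)) Ne.
pose u c := f c - fk c - h c; pose v c := fk c - l c.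
have su : square_integrable nu u by apply: square_integrable_B => //; exact: square_integrable_B.
have sv : square_integrable nu v by exact: square_integrable_B.
have uv0 : \int[nu]_c (u c * v c) = 0.
  have low xi : ~~ (k <= mass xi)%N -> (mass xi <= k - 1)%N.
    by rewrite -ltnNge => kx; rewrite -ltnS subn1 prednK.
  have sg := remainder_square_integrable.
  have g_fk : \int[nu]_c ((f c - fk c) * fk c) = 0 by exact: hfk.2 hfk.1.
  have g_l : \int[nu]_c (l c * (f c - fk c)) = 0.
    rewrite /l; under eq_Rintegral do rewrite -big_filter.
    rewrite Rintegral_sum_mul //; last exact: dual_square_integrable.
    rewrite big_seq big1 // => xi; rewrite mem_filter => /andP[/low kx _].
    rewrite (eq_Rintegral _ (g := fun c : Omega d => (f c - fk c) * dual rho xi c)).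
      by rewrite (hfk.2 _ (dual_chaos kx)) mulr0.
    by move=> c _; rewrite mulrC.
  have h_fk : \int[nu]_c (h c * fk c) = 0.
    rewrite /h; under eq_Rintegral do rewrite -big_filter.
    rewrite Rintegral_sum_mul //; last exact: dual_square_integrable.
    rewrite big_seq big1 // => xi; rewrite mem_filter => /andP[kx _].
    by rewrite (chaos_orthogonal _ hfk.1) ?mulr0 // subn1 prednK.
  have h_l : \int[nu]_c (h c * l c) = 0.
    rewrite /h; under eq_Rintegral do rewrite -big_filter.
    rewrite Rintegral_sum_mul //; last exact: dual_square_integrable.
    rewrite big_seq big1 // => xi; rewrite mem_filter => /andP[kx _].
    rewrite (eq_Rintegral _ (g := fun c : Omega d => l c * dual rho xi c)); last by move=> c _; rewrite mulrC.
    rewrite /l; under eq_Rintegral do rewrite -big_filter.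
    rewrite Rintegral_sum_mul; [|exact: dual_square_integrable|exact: dual_square_integrable].
    rewrite big_seq big1 ?mulr0 // => xi'; rewrite mem_filter -ltnNge => /andP[kx' _].
    by rewrite dual_orthogonal ?mulr0 // neq_ltn (leq_trans kx' kx).
  have i1 := square_integrable_mul sg sfk; have i2 := square_integrable_mul sl sg.
  have i3 := square_integrable_mul sh sfk; have i4 := square_integrable_mul sh sl.
  have i12 := integrable_subZ 1 i1 i2; have i34 := integrable_subZ 1 i3 i4.
  rewrite (_ : (fun c => u c * v c) = fun c =>
     ((f c - fk c) * fk c - 1 * (l c * (f c - fk c))) - 1 * (h c * fk c - 1 * (h c * l c))).
    rewrite (Rintegral_subZ 1 i12 i34) (Rintegral_subZ 1 i1 i2) (Rintegral_subZ 1 i3 i4) g_fk g_l h_fk h_l; ring.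
  by apply/funext => c; rewrite /u /v; ring.
apply: le_trans hr.
rewrite [leRHS](eq_Rintegral _ (g := fun c : Omega d => (u c ^+ 2 - (- 2) * (u c * v c)) - (- 1) * v c ^+ 2)).
  case: su sv => mu iu [mv iv].
  have iuv := square_integrable_mul (conj mu iu) (conj mv iv).
  rewrite Rintegral_subZ //; last exact: integrable_subZ.
  rewrite Rintegral_subZ // uv0 mulr0 subr0 mulN1r opprK lerDl.
  by apply: Rintegral_ge0 => c _; exact: sqr_ge0.
move=> c _; have -> : \sum_(xi <- S0) C xi * dual rho xi c = h c + l c.
  by rewrite (bigID (fun xi => (k <= mass xi)%N)).
by rewrite /u /v; ring.
Qed.

End Chaos.

(** * Covariances of shifted observables *)

Section FieldCovariance.
Variables (R : realType) (d : nat) (p : Zd d -> Zd d -> R) (rho : R).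
Hypothesis hp : jump_kernel p.
Hypothesis hrho : 0 < rho.
Variables (nu : probability (Omega d) R).
Hypothesis hnu : poisson_product rho nu.
Variables (disp : measure_display) (T : measurableType disp) (P : probability T R).
Variables (X : Zd d * nat -> R -> T -> Zd d) (eta : R -> T -> Omega d).
Hypothesis heta : independent_walkers p nu P X eta.

Lemma measurable_tau_eta t x : 0 <= t -> measurable_fun [set: T] (fun w => tau x (eta t w)).
Proof. by move=> t0; exact: measurableT_comp (measurable_tau x) (measurable_eta heta t0). Qed.

Lemma tau_eta_law t x A : 0 <= t -> measurable A ->
  P ((fun w => tau x (eta t w)) @^-1` A) = nu A.
Proof.
move=> t0 mA; rewrite -(tau_law hnu x mA) -(eta_law hp hrho hnu heta t0) //.
by have := measurable_tau x measurableT mA; rewrite setTI.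
Qed.

Lemma square_integrable_tau_eta t x (F : Omega d -> R) : 0 <= t -> square_integrable nu F ->
  square_integrable P (fun w => F (tau x (eta t w))) /\
  \int[P]_w (F (tau x (eta t w)) ^+ 2) = \int[nu]_c (F c ^+ 2).
Proof.
move=> t0 sF; apply: (square_integrable_law (phi := fun w => tau x (eta t w))) => //.
  exact: measurable_tau_eta.
by move=> A mA; exact: tau_eta_law.
Qed.

Variables (f : Omega d -> R) (C : Omegaf d -> R) (k : nat) (fk : Omega d -> R).
Hypothesis hf : f \in Lfun nu 2%:E.
Hypothesis hC : has_expansion rho nu f C.
Hypothesis hsum : (\esum_(z in [set z : Omegaf d * Omegaf d | mass z.1 = mass z.2])
             (`|C z.1 * C z.2| * dual_sqnorm rho nu z.2)%:E < +oo)%E.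
Hypothesis hk : (1 <= k)%N.
Hypothesis hfk : chaos_projection rho nu (k - 1) f fk.

Definition coef_sum : R :=
  fine (\esum_(z in [set z : Omegaf d * Omegaf d | mass z.1 = mass z.2])
             (`|C z.1 * C z.2| * dual_sqnorm rho nu z.2)%:E)%E.

Lemma dual_sqnorm_nonneg xi : 0 <= dual_sqnorm rho nu xi.
Proof. by rewrite dual_sqnormE dual_sqnorm_ge0. Qed.

Lemma coef_sum_ge0 : 0 <= coef_sum.
Proof. by apply/fine_ge0/esum_ge0 => z _; rewrite lee_fin mulr_ge0 // dual_sqnorm_nonneg. Qed.

Lemma coef_sum_ge (S : {fset Omegaf d}) :
  \sum_(xi <- S) \sum_(xi' <- S | mass xi == mass xi')
    `|C xi * C xi'| * dual_sqnorm rho nu xi' <= coef_sum.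
Proof.
rewrite -lee_fin /coef_sum fineK; last first.
  rewrite ge0_fin_numE //; apply: esum_ge0 => z _.
  by rewrite lee_fin mulr_ge0 // dual_sqnorm_nonneg.
pose L := [seq z <- [seq (a, b) | a <- S, b <- S] | mass z.1 == mass z.2].
have uL : uniq L.
  apply: filter_uniq; apply: allpairs_uniq; rewrite ?fset_uniq //.
  by move=> [a b] [a' b'] _ _ /= [-> ->].
apply: esum_ge; exists [set` L].
  split; first by apply/finite_seqP; exists L.
  by move=> z /=; rewrite mem_filter => /andP[/eqP].
rewrite -(fsbig_seq _ _ uL) sumEFin lee_fin le_eqVlt; apply/orP; left; apply/eqP.
rewrite [RHS]big_filter [RHS]big_mkcond big_allpairs_dep /=.
by apply: eq_bigr => xi _; rewrite [LHS]big_mkcond.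
Qed.

(** Replace [f - fk] by a finite combination [h] of duals of mass at least [k].  For [h], the
pairs of different masses contribute nothing, and [cov_bound] applies to the
others: what appears is a part of the series [coef_sum].  The error is controlled by
stationarity and Cauchy-Schwarz. *)
Lemma field_cov_bound s e x y : 0 <= s -> (forall i z, transition p s i z <= e) ->
  `|\int[P]_w ((f (tau x (eta 0 w)) - fk (tau x (eta 0 w))) *
               (f (tau y (eta s w)) - fk (tau y (eta s w))))| <= coef_sum * (k`!%:R * e ^+ k).
Proof.
move=> s0 qe; set B := k`!%:R * e ^+ k.
have e0 : 0 <= e by apply: le_trans (qe 0 0); exact: (transition_ge0 heta s0).
have B0 : 0 <= B by rewrite mulr_ge0 // exprn_ge0.
pose g c := f c - fk c.
have sg : square_integrable nu g := remainder_square_integrable hf hfk.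
have [G0 G0gt hG0] := square_integrable_bound nu g.
pose G := 1 + G0; have G1 : 1 <= G by rewrite lerDl ltW.
have hG : \int[nu]_c (g c ^+ 2) <= G ^+ 2.
  by apply: le_trans hG0 _; rewrite lerXn2r ?nnegrE /G; lra.
have Ggt : 0 < G by lra.
(* [3 * G * r] is made of the errors [r * (2 * G)] and [G * r] of the two factors, where
   [G] bounds the norm of [g] and [2 * G] that of [h]. *)
suff main r : 0 < r -> r <= 1 -> `|\int[P]_w (g (tau x (eta 0 w)) * g (tau y (eta s w)))| <=
    coef_sum * B + 3 * G * r.
  apply/ler_addgt0Pr => r r0; have [r' [r'0 r'1 r'r]] : exists r', [/\ 0 < r', r' <= 1 & 3 * G * r' <= r].
    exists (Num.min 1 (r / (3 * G))); split; last first.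
    - have G3 : 0 < 3 * G by lra.
      by rewrite mulrC -ler_pdivlMr // ge_min lexx orbT.
    - by rewrite ge_min lexx.
    - by rewrite lt_min ltr01 divr_gt0 //; lra.
  by apply: le_trans (main r' r'0 r'1) _; rewrite lerD2l.
move=> r0 r1; have [S [Sk hS]] := chaos_expansion hrho hnu hf hC hk hfk r0.
pose h c := \sum_(xi <- S) C xi * dual rho xi c.
have sh : square_integrable nu h := square_integrable_sum S C (dual_square_integrable hrho hnu).
have sgh : square_integrable nu (fun c => g c - h c) := square_integrable_B sg sh.
have hh : \int[nu]_c (h c ^+ 2) <= (2 * G) ^+ 2.
  have [_ ig] := sg; have [_ igh] := sgh; have [_ ih] := sh.
  apply: (@le_trans _ _ (\int[nu]_c (2 * g c ^+ 2 - (- 2) * (g c - h c) ^+ 2))).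
    apply: le_Rintegral => //.
      by apply: integrable_subZ => //; exact: (integrableZl measurableT 2 ig).
    by move=> c _; have := sqr_ge0 (2 * g c - h c); nra.
  rewrite Rintegral_subZ //; last exact: (integrableZl measurableT 2 ig).
  rewrite RintegralZl // mulNr opprK exprMn.
  have r2 : r ^+ 2 <= G ^+ 2 by rewrite lerXn2r ?nnegrE; lra.
  have := le_trans hS r2; rewrite -/(h _); move: hG.
  by rewrite /g /h; move: (\int[nu]_c _) (\int[nu]_c _) => a b; rewrite expr2; lra.
have sP t z (F : Omega d -> R) (t0 : 0 <= t) := @square_integrable_tau_eta t z F t0.
have [sg0 eg0] := sP 0 x _ (lexx 0) sg; have [sgs egs] := sP s y _ s0 sg.
have [sh0 eh0] := sP 0 x _ (lexx 0) sh; have [shs ehs] := sP s y _ s0 sh.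
have [sd0 ed0] := sP 0 x _ (lexx 0) sgh; have [sds eds] := sP s y _ s0 sgh.
have split : \int[P]_w (g (tau x (eta 0 w)) * g (tau y (eta s w))) =
    \int[P]_w (h (tau x (eta 0 w)) * h (tau y (eta s w))) +
    \int[P]_w ((g (tau x (eta 0 w)) - h (tau x (eta 0 w))) * h (tau y (eta s w))) +
    \int[P]_w (g (tau x (eta 0 w)) * (g (tau y (eta s w)) - h (tau y (eta s w)))).
  have i1 := square_integrable_mul sh0 shs; have i2 := square_integrable_mul sd0 shs.
  have i3 := square_integrable_mul sg0 sds.
  have i12 := integrable_subZ (-1) i1 i2.
  rewrite (_ : (fun w => g _ * g _) = fun w =>
     (h (tau x (eta 0 w)) * h (tau y (eta s w)) -
      (-1) * ((g (tau x (eta 0 w)) - h (tau x (eta 0 w))) * h (tau y (eta s w)))) -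
     (-1) * (g (tau x (eta 0 w)) * (g (tau y (eta s w)) - h (tau y (eta s w))))).
    by rewrite (Rintegral_subZ (-1) i12 i3) (Rintegral_subZ (-1) i1 i2); ring.
  by apply/funext => w; ring.
rewrite split.
have G2 : 0 < 2 * G by lra.
have b2 : `|\int[P]_w ((g (tau x (eta 0 w)) - h (tau x (eta 0 w))) * h (tau y (eta s w)))| <= r * (2 * G).
  by apply: (Rintegral_Cauchy_Schwarz r0 G2 sd0 shs); rewrite ?ed0 ?ehs.
have b3 : `|\int[P]_w (g (tau x (eta 0 w)) * (g (tau y (eta s w)) - h (tau y (eta s w))))| <= G * r.
  by apply: (Rintegral_Cauchy_Schwarz Ggt r0 sg0 sds); rewrite ?eg0 ?eds.
have b1 : `|\int[P]_w (h (tau x (eta 0 w)) * h (tau y (eta s w)))| <= coef_sum * B.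
  (* Shifts act on the positions of the dual particles. *)
  pose sx xi := [seq z + x | z <- site_list xi]; pose sy xi := [seq z + y | z <- site_list xi].
  have cE xi xi' : \int[P]_w (dual rho xi (tau x (eta 0 w)) * dual rho xi' (tau y (eta s w))) =
      cov rho P eta s (sx xi) (sy xi').
    by apply: eq_Rintegral => w _; rewrite !dualE !list_dual_tau.
  have i2 xi xi' : P.-integrable [set: T]
      (EFin \o (fun w => dual rho xi (tau x (eta 0 w)) * dual rho xi' (tau y (eta s w)))).
    have [s1 _] := sP 0 x _ (lexx 0) (dual_square_integrable hrho hnu xi).
    by have [s2 _] := sP s y _ s0 (dual_square_integrable hrho hnu xi'); exact: square_integrable_mul.
  have -> : \int[P]_w (h (tau x (eta 0 w)) * h (tau y (eta s w))) =
      \sum_(xi <- S) C xi * \sum_(xi' <- S) C xi' * cov rho P eta s (sx xi) (sy xi').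
    have inner xi := Rintegral_sumZ S C (i2 xi).
    rewrite -(eq_bigr _ (fun xi _ => congr1 (fun v => C xi * v)
      (etrans (proj2 (inner xi)) (eq_bigr _ (fun xi' _ => congr1 (fun v => C xi' * v) (cE xi xi')))))).
    rewrite -(proj2 (Rintegral_sumZ S C (fun xi => proj1 (inner xi)))).
    apply: eq_Rintegral => w _; rewrite /h mulr_suml; apply: eq_bigr => xi _.
    by rewrite -mulrA mulr_sumr; congr (_ * _); apply: eq_bigr => xi' _; rewrite mulrCA.
  apply: (@le_trans _ _ ((\sum_(xi <- S) \sum_(xi' <- S | mass xi == mass xi')
    `|C xi * C xi'| * dual_sqnorm rho nu xi') * B)); last by rewrite ler_wpM2r // coef_sum_ge.
  apply: le_trans (ler_norm_sum _ _ _) _; rewrite mulr_suml big_seq [leRHS]big_seq.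
  apply: ler_sum => xi xiS; rewrite mulr_sumr; apply: le_trans (ler_norm_sum _ _ _) _.
  rewrite mulr_suml [leRHS]big_mkcond /=; apply: ler_sum => xi' _.
  rewrite mulrA normrM; case: ifPn => mm.
    rewrite -mulrA ler_wpM2l //.
    have e1 : size (sx xi) = size (sy xi') by rewrite !size_map -!massE (eqP mm).
    have e2 : (k <= size (sx xi))%N by rewrite size_map -massE Sk.
    apply: le_trans (cov_bound hp hrho hnu heta s0 qe e1 e2) _.
    by rewrite (dual_sqnorm_shift hnu) -dual_sqnormE.
  rewrite (cov_size hp hrho hnu heta s0) ?normr0 ?mulr0 //.
  by rewrite !size_map -!massE.
apply: le_trans (ler_normD _ _) _; apply: le_trans (lerD (ler_normD _ _) (lexx _)) _.
by apply: le_trans (lerD (lerD b1 b2) b3) _; rewrite le_eqVlt; apply/orP; left; apply/eqP; ring.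
Qed.

End FieldCovariance.

(** * Lattice sums of Schwartz functions *)

Section LatticeSum.
Variables (R : realType) (d : nat).

(** Expanding the product of the [1 + x_i^2] gives one decay condition for each set of
coordinates. *)
Lemma schwartz_product_bound (phi : 'rV[R]_d -> R) : schwartz phi ->
  exists M, 0 <= M /\ forall x, `|phi x| <= M * \prod_(i < d) (1 + x ord0 i ^+ 2)^-1.
Proof.
move=> hphi.
have /choice[M hM] : forall A : {set 'I_d}, exists M : R, forall x : 'rV[R]_d,
    `|(\prod_(i < d) x ord0 i ^+ (2 * (i \in A))) * phi x| <= M.
  by move=> A; exact: (schwartz_decay hphi (fun i => (2 * (i \in A))%N) [::]).
exists (\sum_A M A); split.
  by apply: sumr_ge0 => A _; exact: le_trans (hM A 0).
move=> x; rewrite prodfV ler_pdivlMr; last by apply: prodr_gt0 => i _; have := sqr_ge0 (x ord0 i); lra.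
have -> : \prod_(i < d) (1 + x ord0 i ^+ 2) = \sum_(A : {set 'I_d}) \prod_(i < d) x ord0 i ^+ (2 * (i \in A)).
  under eq_bigr do rewrite addrC.
  rewrite bigA_distr; apply: eq_bigr => A _; apply: eq_bigr => i _.
  by case: (i \in A).
rewrite mulr_sumr; apply: ler_sum => A _; apply: le_trans (hM A x).
rewrite normrM mulrC ler_wpM2r //; exact: ler_norm.
Qed.

(** Comparison with the telescoping series of [4 N^2 / ((N + i) (N + i + 1))]. *)
Lemma lattice_sum1 (N n : nat) : (0 < N)%N ->
  \sum_(i < n) (1 + (i%:R / N%:R) ^+ 2)^-1 <= 4 * N%:R :> R.
Proof.
move=> N0; have Np : 0 < N%:R :> R by rewrite ltr0n.
suff h : \sum_(i < n) (1 + (i%:R / N%:R) ^+ 2)^-1 <= 4 * N%:R ^+ 2 * (N%:R^-1 - (N%:R + n%:R)^-1) :> R.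
  apply: le_trans h _; rewrite mulrBr (_ : 4 * N%:R ^+ 2 * N%:R^-1 = 4 * N%:R :> R); last first.
    by field; rewrite gt_eqF.
  by rewrite gerBl mulr_ge0 ?invr_ge0 ?mulr_ge0 ?sqr_ge0 // addr_ge0 // ltW.
elim: n => [|n IH]; first by rewrite big_ord0 addr0 subrr mulr0.
rewrite big_ord_recr /=; apply: le_trans (lerD IH (lexx _)) _.
have n0 : 0 <= n%:R :> R by [].
have Nn : 1 <= N%:R :> R by rewrite ler1n.
rewrite -[n.+1%:R]natr1; move: (N%:R : R) (n%:R : R) Np n0 Nn => a b a0 b0 a1.
rewrite -subr_ge0 (_ : _ - _ = a ^+ 2 * (4 / ((a + b) * (a + (b + 1))) - (a ^+ 2 + b ^+ 2)^-1)); last first.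
  have p1 : 0 < a + b by lra.
  have p2 : 0 < a + (b + 1) by lra.
  have p3 : 0 < a ^+ 2 + b ^+ 2 by nra.
  by field; rewrite !gt_eqF.
apply: mulr_ge0; first exact: sqr_ge0.
have p1 : 0 < (a + b) * (a + (b + 1)) by apply: mulr_gt0; lra.
have p3 : 0 < a ^+ 2 + b ^+ 2 by nra.
rewrite subr_ge0 ler_pdivlMr // mulrC ler_pdivrMr //.
have := sqr_ge0 (a - b); nra.
Qed.

(** A coordinate is encoded by its sign and its absolute value, which leaves a power of
twice the one-dimensional sum. *)
Lemma lattice_sum (N : nat) (s : seq (Zd d)) : (0 < N)%N -> uniq s ->
  \sum_(x <- s) \prod_(i < d) (1 + ((x ord0 i)%:~R / N%:R) ^+ 2)^-1 <= (8 * N%:R) ^+ d :> R.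
Proof.
move=> N0 us; pose B := (\max_(x <- s) \max_(i < d) `|x ord0 i|)%N.
have hB x i : x \in s -> (`|x ord0 i| < B.+1)%N.
  move=> xs; rewrite ltnS /B (big_rem x xs) /=; apply: leq_trans (leq_maxl _ _).
  exact: (leq_bigmax i).
pose g (v : bool * 'I_B.+1) : R := (1 + (v.2%:R / N%:R) ^+ 2)^-1.
have g0 v : 0 <= g v by rewrite invr_ge0 addr_ge0 // sqr_ge0.
pose code (x : Zd d) : {ffun 'I_d -> bool * 'I_B.+1} :=
  [ffun i => (x ord0 i < 0, inord `|x ord0 i|%N)].
have codeI : {in s &, injective code}.
  move=> x y xs ys /ffunP e; apply/rowP => i; have := e i; rewrite !ffunE => -[e1].
  move=> /(congr1 val); rewrite /= !inordK ?hB // => e2.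
  by rewrite [LHS]intEsign [RHS]intEsign e1 e2.
have -> : \sum_(x <- s) \prod_(i < d) (1 + ((x ord0 i)%:~R / N%:R) ^+ 2)^-1 =
    \sum_(h <- map code s) \prod_(i < d) g (h i).
  rewrite big_map; apply: eq_big_seq => x xs; apply: eq_bigr => i _.
  rewrite ffunE /g /= inordK ?hB //; congr (1 + _)^-1.
  by rewrite !expr_div_n -[in LHS](@real_normK R _%:~R) ?num_real // -intr_norm -abszE.
rewrite (big_uniq _ (_ : uniq (map code s))) /=; last by rewrite map_inj_in_uniq.
apply: (@le_trans _ _ (\sum_(h : {ffun 'I_d -> bool * 'I_B.+1}) \prod_(i < d) g (h i))).
  rewrite big_mkcond /=; apply: ler_sum => h _; case: ifP => // _.
  by apply: prodr_ge0 => i _; exact: g0.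
rewrite -(bigA_distr_bigA (fun _ : 'I_d => g)) prodr_const card_ord.
rewrite lerXn2r ?nnegrE ?mulr_ge0 ?sumr_ge0 //.
rewrite -(pair_bigA _ (fun b i => g (b, i))) big_bool /g /=.
by have := lattice_sum1 B.+1 N0; lra.
Qed.

Lemma schwartz_lattice_sum (phi : 'rV[R]_d -> R) : schwartz phi ->
  exists K, 0 <= K /\ forall (N : nat) (s : seq (Zd d)), (0 < N)%N -> uniq s ->
    \sum_(x <- s) `|phi (\row_(i < d) ((x ord0 i)%:~R / N%:R))| <= K * N%:R ^+ d.
Proof.
move=> /schwartz_product_bound[M [M0 hM]]; exists (M * 8 ^+ d); split.
  by rewrite mulr_ge0 ?exprn_ge0.
move=> N s N0 us; rewrite -mulrA -exprMn; apply: le_trans (ler_wpM2l M0 (lattice_sum N0 us)).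
rewrite mulr_sumr; apply: ler_sum => x _; apply: le_trans (hM _) _.
rewrite le_eqVlt; apply/orP; left; apply/eqP; congr (_ * _).
by apply: eq_bigr => i _; rewrite mxE.
Qed.

End LatticeSum.

(** * Covariance of two infinite series *)

Section Exhaustion.
Variables (R : realType) (d : nat).

Lemma exhaust_leq m n : (m <= n)%N -> exists r, exhaust d n = exhaust d m ++ r.
Proof.
move=> mn; exists (pmap (fun k => choice.pickle_inv k : option (Zd d)) (iota m (n - m))).
by rewrite /exhaust -pmap_cat -[in RHS](add0n m) -iotaD add0n subnKC.
Qed.

Lemma exhaust_sum_nd (u : Zd d -> \bar R) : (forall x, 0 <= u x)%E ->
  nondecreasing_seq (fun n => \sum_(x <- exhaust d n) u x)%E.
Proof.
move=> u0 m n /exhaust_leq[r ->]; rewrite big_cat /= leeDl //.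
by apply: sume_ge0 => x _.
Qed.

Lemma esum_exhaust (u : Zd d -> \bar R) : (forall x, 0 <= u x)%E ->
  ((\sum_(x <- exhaust d n) u x)%E @[n --> \oo] --> \esum_(x in [set: Zd d]) u x)%E.
Proof.
move=> u0; rewrite (_ : esum _ _ = ereal_sup (range (fun n => \sum_(x <- exhaust d n) u x)%E)).
  by apply: ereal_nondecreasing_cvgn; exact: exhaust_sum_nd.
apply/eqP; rewrite eq_le; apply/andP; split.
  apply: ge_ereal_sup => _ [A [fA _] <-].
  have [N hN] := sub_exhaust (fset_set A).
  apply: le_ereal_sup_tmp; exists (\sum_(x <- exhaust d N) u x)%E; first by exists N.
  rewrite (fsbig_finite _ _ fA) /=.
  have pe : perm_eq (fset_set A) [seq x <- exhaust d N | x \in fset_set A].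
    apply: uniq_perm; rewrite ?filter_uniq ?exhaust_uniq ?fset_uniq //.
    by move=> x; rewrite mem_filter; case: (boolP (x \in _)) => // xA; rewrite hN.
  rewrite (perm_big _ pe) big_filter big_mkcond /=.
  by apply: lee_sum => x _; case: ifP.
apply: ge_ereal_sup => _ [n _ <-]; apply: esum_ge; exists [set` exhaust d n].
  by split => //; apply/finite_seqP; exists (exhaust d n).
by rewrite -fsbig_seq // exhaust_uniq.
Qed.

(** The positive and the negative parts converge separately. *)
Lemma asum_exhaust (u : Zd d -> R) (M : R) :
  (forall n, \sum_(x <- exhaust d n) `|u x| <= M) ->
  \sum_(x <- exhaust d n) u x @[n --> \oo] --> asum u.
Proof.
move=> uM.
have fin (v : Zd d -> R) : (forall x, 0 <= v x <= `|u x|) ->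
   \esum_(x in [set: Zd d]) (v x)%:E \is a fin_num /\
   (\sum_(x <- exhaust d n) v x @[n --> \oo] --> fine (\esum_(x in [set: Zd d]) (v x)%:E)).
  move=> hv; have v0 x : (0 <= (v x)%:E)%E by rewrite lee_fin; case/andP: (hv x).
  have c := esum_exhaust v0.
  have f : \esum_(x in [set: Zd d]) (v x)%:E \is a fin_num.
    rewrite ge0_fin_numE; last exact: esum_ge0.
    apply: (@le_lt_trans _ _ M%:E); last exact: ltry.
    rewrite -(cvg_lim (@ereal_hausdorff _) c); apply: lime_le; first by apply/cvg_ex; eexists; exact: c.
    apply: nearW => n; rewrite sumEFin lee_fin; apply: le_trans (uM n).
    by apply: ler_sum => x _; case/andP: (hv x).
  split => //; apply: (fine_cvg (f := fun n => (\sum_(x <- exhaust d n) v x)%:E)); rewrite fineK //.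
  rewrite (_ : (fun n => _) = fun n => (\sum_(x <- exhaust d n) (v x)%:E)%E) //.
  by apply/funext => n /=; rewrite sumEFin.
have [|f1 c1] := fin (fun x => Num.max (u x) 0).
  by move=> x; rewrite le_max lexx orbT ge_max ler_norm normr_ge0.
have [|f2 c2] := fin (fun x => Num.max (- u x) 0).
  by move=> x; rewrite le_max lexx orbT ge_max -normrN ler_norm normr_ge0.
rewrite /asum.
rewrite (_ : ((EFin \o u)^\+)%E = fun x => (Num.max (u x) 0)%:E); last first.
  by apply/funext => x; rewrite funeposE /= EFin_max.
rewrite (_ : ((EFin \o u)^\-)%E = fun x => (Num.max (- u x) 0)%:E); last first.
  by apply/funext => x; rewrite funenegE /= EFin_max.
rewrite fineB // (_ : (fun n => _) = (fun n => \sum_(x <- exhaust d n) Num.max (u x) 0 -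
    \sum_(x <- exhaust d n) Num.max (- u x) 0)); first exact: cvgB c1 c2.
apply/funext => n; rewrite -sumrB; apply: eq_bigr => x _.
by rewrite /Num.max; case: ltP => h1; case: ltP => h2; lra.
Qed.

Lemma measurable_asum (disp : measure_display) (T : measurableType disp) (u : Zd d -> T -> R) :
  (forall x, measurable_fun [set: T] (u x)) ->
  measurable_fun [set: T] (fun w => asum (fun x => u x w)).
Proof.
move=> mu; have me (v : T -> Zd d -> \bar R) : (forall w x, 0 <= v w x)%E ->
    (forall x, measurable_fun [set: T] (fun w => v w x)) ->
    measurable_fun [set: T] (fun w => \esum_(x in [set: Zd d]) v w x)%E.
  move=> v0 mv; apply: (emeasurable_fun_cvg (fun n w => \sum_(x <- exhaust d n) v w x)%E).
    by move=> n; exact: emeasurable_sum.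
  by move=> w _; exact: esum_exhaust.
apply: (measurableT_comp (fine_measurable measurableT)).
apply: emeasurable_funB.
  apply: me => // x; rewrite (_ : (fun w => _) = fun w => (Num.max (u x w) 0)%:E).
    by apply/measurable_EFinP; exact: measurable_maxr.
  by apply/funext => w; rewrite funeposE /= EFin_max.
apply: me => // x; rewrite (_ : (fun w => _) = fun w => (Num.max (- u x w) 0)%:E).
  by apply/measurable_EFinP; apply: measurable_maxr => //; exact: measurableT_comp.
by apply/funext => w; rewrite funenegE /= EFin_max.
Qed.

End Exhaustion.

Section SeriesCovariance.
Variables (R : realType) (d : nat) (disp : measure_display) (T : measurableType disp).
Variables (mu : {measure set T -> \bar R}).

Lemma series_product_bound (r : seq (Zd d)) (a : Zd d -> R) (F G : Zd d -> T -> R) (A B : R) :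
  (forall x, square_integrable mu (F x)) -> (forall x, square_integrable mu (G x)) ->
  \sum_(x <- r) `|a x| <= A -> 0 <= B -> (forall x y, `|\int[mu]_w (F x w * G y w)| <= B) ->
  `|\int[mu]_w ((\sum_(x <- r) a x * F x w) * (\sum_(y <- r) a y * G y w))| <= A ^+ 2 * B.
Proof.
move=> sF sG aA B0 hB.
have inner x := Rintegral_sumZ r a (fun y => square_integrable_mul (sF x) (sG y)).
rewrite (eq_Rintegral _ (g := fun w => \sum_(x <- r) a x * \sum_(y <- r) a y * (F x w * G y w))).
  rewrite (proj2 (Rintegral_sumZ r a (fun x => proj1 (inner x)))).
  apply: le_trans (ler_norm_sum _ _ _) _.
  have A0 : 0 <= A by apply: le_trans aA; exact: sumr_ge0.
  apply: (@le_trans _ _ (\sum_(x <- r) `|a x| * (A * B))).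
    apply: ler_sum => x _; rewrite (proj2 (inner x)) normrM ler_wpM2l //.
    apply: le_trans (ler_norm_sum _ _ _) _; apply: le_trans (ler_wpM2r B0 aA).
    by rewrite mulr_suml; apply: ler_sum => y _; rewrite normrM ler_wpM2l.
  by rewrite -mulr_suml expr2 -mulrA ler_wpM2r // mulr_ge0.
move=> w _; rewrite mulr_suml; apply: eq_bigr => x _; rewrite -mulrA mulr_sumr; congr (_ * _).
by apply: eq_bigr => y _; ring.
Qed.

Variables (a : Zd d -> R) (A : R).
Hypothesis aA : forall n, \sum_(x <- exhaust d n) `|a x| <= A.

(** The partial sums increase, so the limit of their squares is integrable as soon as
their second moments are bounded; Cauchy-Schwarz bounds these by [A^2 B^2]. *)
Lemma abs_series_dominated (H : Zd d -> T -> R) (B : R) :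
  (forall x, square_integrable mu (H x)) -> (forall x w, 0 <= H x w) -> (forall x, \int[mu]_w (H x w ^+ 2) <= B ^+ 2) ->
  0 < B ->
  exists Z : T -> \bar R, mu.-integrable [set: T] Z /\
    forall w n, (((\sum_(x <- exhaust d n) `|a x| * H x w) ^+ 2)%:E <= Z w)%E.
Proof.
move=> sH H0 HB B0.
pose V n w : R := \sum_(x <- exhaust d n) `|a x| * H x w.
have V0 n w : 0 <= V n w by apply: sumr_ge0 => x _; rewrite mulr_ge0.
have sV n : square_integrable mu (V n) by exact: square_integrable_sum.
have ndV w : nondecreasing_seq (fun n => (V n w ^+ 2)%:E).
  move=> m n mn; rewrite lee_fin lerXn2r ?nnegrE //.
  have u0 x : (0 <= (`|a x| * H x w)%:E)%E by rewrite lee_fin mulr_ge0.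
  by have := exhaust_sum_nd u0 mn; rewrite !sumEFin lee_fin.
pose Z w := limn (fun n => (V n w ^+ 2)%:E).
have cZ w : (V n w ^+ 2)%:E @[n --> \oo] --> Z w by exact: ereal_nondecreasing_is_cvgn (ndV w).
have ZV w n : ((V n w ^+ 2)%:E <= Z w)%E.
  apply: lime_ge; first exact: ereal_nondecreasing_is_cvgn (ndV w).
  by exists n => // m /= nm; exact: ndV.
have mV n : measurable_fun [set: T] (fun w => (V n w ^+ 2)%:E).
  by apply/measurable_EFinP; apply: measurable_funX; case: (sV n).
have mZ : measurable_fun [set: T] Z.
  by apply: (emeasurable_fun_cvg (fun n w => (V n w ^+ 2)%:E)) => // w _; exact: cZ.
exists Z; split => //; apply/integrableP; split => //.
under eq_integral do rewrite gee0_abs ?(le_trans _ (ZV _ 0%N)) ?lee_fin ?sqr_ge0 //.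
apply: (@le_lt_trans _ _ (A ^+ 2 * B ^+ 2)%:E); last exact: ltry.
have c : (\int[mu]_w (V n w ^+ 2)%:E)%E @[n --> \oo] --> (\int[mu]_w Z w)%E.
  apply: (cvg_monotone_convergence measurableT mV) => [n w _|w _]; last exact: ndV.
  by rewrite lee_fin sqr_ge0.
rewrite -(cvg_lim (@ereal_hausdorff _) c); apply: lime_le.
  by apply/cvg_ex; eexists; exact: c.
apply: nearW => n; have [_ iV] := sV n.
rewrite -[leLHS](fineK (integrable_fin_num measurableT iV)) lee_fin.
have aA' : \sum_(x <- exhaust d n) `|(`|a x|)| <= A.
  by rewrite (eq_bigr (fun x => `|a x|)) // => x _; rewrite normr_id.
apply: le_trans (series_product_bound sH sH aA' (sqr_ge0 B) _); last first.
  by move=> x y; rewrite expr2; exact: Rintegral_Cauchy_Schwarz.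
by rewrite -[leLHS]/(\int[mu]_w (V n w ^+ 2)); exact: ler_norm.
Qed.

(** The partial sums of both series are dominated by those of [\sum_x |a x| H x], where
[H = |F| + |G|]: the products of partial sums stay below the integrable majorant [Z]
of [abs_series_dominated], and both series converge absolutely where [Z] is finite. *)
Lemma asum_cov_bound (F G : Zd d -> T -> R) (g B : R) : 0 < g ->
  (forall x, square_integrable mu (F x) /\ \int[mu]_w (F x w ^+ 2) <= g ^+ 2) ->
  (forall x, square_integrable mu (G x) /\ \int[mu]_w (G x w ^+ 2) <= g ^+ 2) ->
  0 <= B -> (forall x y, `|\int[mu]_w (F x w * G y w)| <= B) ->
  (`|\int[mu]_w (asum (fun x => F x w * a x) * asum (fun y => G y w * a y))%:E| <= (A ^+ 2 * B)%:E)%E.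
Proof.
move=> g0 hF hG B0 hB.
have sF x : square_integrable mu (fun w => `|F x w|).
  have [[m i] _] := hF x; split; first exact: measurableT_comp.
  by under [fun w => `|_| ^+ 2]funext do rewrite real_normK ?num_real //.
have sG x : square_integrable mu (fun w => `|G x w|).
  have [[m i] _] := hG x; split; first exact: measurableT_comp.
  by under [fun w => `|_| ^+ 2]funext do rewrite real_normK ?num_real //.
pose H x w := `|F x w| + `|G x w|.
have sH x : square_integrable mu (H x).
  have := square_integrable_subZ (-1) (sF x) (sG x).
  rewrite (_ : (fun w => _ - _) = H x) //.
  by apply/funext => w; rewrite mulN1r opprK.
have [|||Z [iZ HZ]] := @abs_series_dominated H (2 * g) sH.
- by move=> x w; rewrite addr_ge0.
- move=> x; have [[_ i1] b1] := hF x; have [[_ i2] b2] := hG x.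
  apply: (@le_trans _ _ (\int[mu]_w (2 * F x w ^+ 2 - (- 2) * G x w ^+ 2))).
    have j1 := integrableZl measurableT 2 i1.
    apply: le_Rintegral => //; [by case: (sH x) | exact: integrable_subZ|].
    move=> w _; rewrite /H -[F x w ^+ 2]real_normK ?num_real // -[G x w ^+ 2]real_normK ?num_real //.
    by have := sqr_ge0 (`|F x w| - `|G x w|); nra.
  have j1 := integrableZl measurableT 2 i1.
  by rewrite Rintegral_subZ // RintegralZl //; lra.
- by lra.
pose S (K : Zd d -> T -> R) n w := \sum_(x <- exhaust d n) a x * K x w.
have le_S K n w : (forall x, `|K x w| <= H x w) -> `|S K n w| <= \sum_(x <- exhaust d n) `|a x| * H x w.
  move=> KH; apply: le_trans (ler_norm_sum _ _ _) _.
  by apply: ler_sum => x _; rewrite normrM ler_wpM2l.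
have mS K n : (forall x, measurable_fun [set: T] (K x)) -> measurable_fun [set: T] (S K n).
  by move=> mK; apply: measurable_sum => x; exact: measurable_funM.
have mF x : measurable_fun [set: T] (F x) by case: (hF x) => -[].
have mG x : measurable_fun [set: T] (G x) by case: (hG x) => -[].
have FH w x : `|F x w| <= H x w by rewrite lerDl.
have GH w x : `|G x w| <= H x w by rewrite lerDr.
have cS K w z : (forall x, `|K x w| <= H x w) -> (Z w <= z%:E)%E ->
    S K n w @[n --> \oo] --> asum (fun x => K x w * a x).
  move=> KH Zz; rewrite (_ : (fun n => _) = fun n => \sum_(x <- exhaust d n) K x w * a x).
    (* [v <= 1 + v^2] for the partial sum [v] of the absolute values. *)
    apply: (asum_exhaust (M := 1 + z)) => n.
    apply: (@le_trans _ _ (\sum_(x <- exhaust d n) `|a x| * H x w)).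
      by apply: ler_sum => x _; rewrite normrM mulrC ler_wpM2l.
    have := le_trans (HZ w n) Zz; rewrite lee_fin; move: (\sum_(x <- _) _) => v.
    by have := sqr_ge0 (v - 1); nra.
  by apply/funext => n; apply: eq_bigr => x _; rewrite mulrC.
have [|||||fi _ cv] := @dominated_convergence _ _ _ mu _ measurableT
   (fun n w => (S F n w * S G n w)%:E)
   (fun w => (asum (fun x => F x w * a x) * asum (fun y => G y w * a y))%:E) Z.
- by move=> n; apply/measurable_EFinP; apply: measurable_funM; exact: mS.
- apply/measurable_EFinP; apply: measurable_funM; apply: measurable_asum => x; exact: measurable_funM.
- have := integrable_ae measurableT iZ; apply: filterS => w /(_ I) Zw _.
  have Zle : (Z w <= (fine (Z w))%:E)%E by rewrite fineK.
  by apply: cvg_EFin; [exact: nearW | apply: cvgM; apply: cS Zle].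
- exact: iZ.
- apply/aeW => w n _; rewrite abse_EFin; apply: le_trans (HZ w n); rewrite lee_fin normrM expr2.
  by apply: ler_pM => //; exact: le_S.
have /(_ eventually_filter) c := cvg_abse cv.
rewrite -(cvg_lim (@ereal_hausdorff _) c); apply: lime_le.
  by apply/cvg_ex; eexists; exact: c.
apply: nearW => n /=.
have sFn : square_integrable mu (S F n) by apply: square_integrable_sum => x; case: (hF x).
have sGn : square_integrable mu (S G n) by apply: square_integrable_sum => x; case: (hG x).
rewrite -(fineK (integrable_fin_num measurableT (square_integrable_mul sFn sGn))) lee_fin.
by apply: series_product_bound => // x; [case: (hF x) | case: (hG x)].
Qed.

End SeriesCovariance.

(** * Covariance of the fluctuation field *)

Theorem theorem3p3
  (R : realType) (d : nat) (hd : (1 <= d)%N)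
  (p : Zd d -> Zd d -> R) (hp : jump_kernel p)
  (rho : R) (hrho : 0 < rho)
  (nu : probability (Omega d) R) (hnu : poisson_product rho nu)
  (disp : measure_display) (T : measurableType disp) (P : probability T R)
  (X : Zd d * nat -> R -> T -> Zd d) (eta : R -> T -> Omega d)
  (heta : independent_walkers p nu P X eta)
  (f : Omega d -> R) (hf : f \in Lfun nu 2%:E)
  (C : Omegaf d -> R) (hC : has_expansion rho nu f C)
  (hsum : (\esum_(z in [set z : Omegaf d * Omegaf d | mass z.1 = mass z.2])
             (`|C z.1 * C z.2| * dual_sqnorm rho nu z.2)%:E < +oo)%E)
  (k : nat) (hk : (1 <= k)%N)
  (fk : Omega d -> R) (hfk : chaos_projection rho nu (k - 1) f fk)
  (phi : 'rV[R]_d -> R) (hphi : schwartz phi)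
  (t : R) (ht : 0 < t) :
  exists K : R, \forall N \near \oo,
    (`| 'E_P[fun w =>
          (fluct_field N (fun zeta => f zeta - fk zeta) (eta 0 w) phi *
           fluct_field N (fun zeta => f zeta - fk zeta) (eta (N%:R ^+ 2 * t) w) phi)%R] |
     <= (K * N%:R ^ (- (d%:Z * (k%:Z - 2))))%:E)%E.
Proof.
have [K1 [K10 hK1]] := transition_le hp ht.
have [K2 [K20 hK2]] := schwartz_lattice_sum hphi.
have sg : square_integrable nu (fun c => f c - fk c) := remainder_square_integrable hf hfk.
have [g g0 hg] := square_integrable_bound nu (fun c => f c - fk c).
pose B := coef_sum rho nu C * k`!%:R.
have B0 : 0 <= B by rewrite mulr_ge0 // coef_sum_ge0.
exists (K2 ^+ 2 * (B * K1 ^+ k)); exists 1%N => // N /= N0.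
have Np : 0 < N%:R :> R by rewrite ltr0n.
have s0 : 0 <= N%:R ^+ 2 * t by rewrite mulr_ge0 ?sqr_ge0 // ltW.
pose a (x : Zd d) := phi (\row_(i < d) ((x ord0 i)%:~R / N%:R)).
have aA n : \sum_(x <- exhaust d n) `|a x| <= K2 * N%:R ^+ d by apply: hK2 => //; exact: exhaust_uniq.
have e0 : 0 <= K1 / N%:R ^+ d by rewrite divr_ge0 // exprn_ge0 // ltW.
have B'0 : 0 <= B * (K1 / N%:R ^+ d) ^+ k by rewrite mulr_ge0 // exprn_ge0.
have sP s x (s1 : 0 <= s) : square_integrable P (fun w => f (tau x (eta s w)) - fk (tau x (eta s w))) /\
    \int[P]_w ((f (tau x (eta s w)) - fk (tau x (eta s w))) ^+ 2) <= g ^+ 2.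
  by have [h1 h2] := square_integrable_tau_eta hp hrho hnu heta x s1 sg; split => //; rewrite h2.
rewrite unlock.
have h := asum_cov_bound aA g0 (fun x => sP 0 x (lexx 0)) (fun x => sP _ x s0) B'0.
apply: le_trans (h _) _.
  move=> x y; apply: le_trans (field_cov_bound hp hrho hnu heta hf hC hsum hk hfk x y s0 (fun i z => hK1 _ i z N0)) _.
  by rewrite /= mulrA.
rewrite lee_fin le_eqVlt; apply/orP; left; apply/eqP.
(* [N^(2d)] comes from the two lattice sums, [N^(-dk)] from the heat kernel. *)
have Nu : (N%:R : R) != 0 by rewrite gt_eqF.
rewrite (_ : N%:R ^ (- (d%:Z * (k%:Z - 2))) = N%:R ^+ (d * 2) / N%:R ^+ (d * k)); last first.
  rewrite mulrBr opprB expfzDr // -PoszM exprnN; congr (_ * _).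
rewrite !exprMn exprVn -!exprM; ring.
Qed.
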